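(* Let $L$ be a global function field which is an $A$-field, and let $r\geq1$. There exist explicit constants $C_1$ and $C_2$, depending only on $A$, $L$, and $r$, such that for every Drinfeld $A$-module $\phi/L$ of rank $r$ and all $x\in L^{\mathrm{sep}}$, $$-C_1-\left(\frac{1}{1-q^{-r}}\right)h(\phi)\leq \hat{h}_\phi(x)-h(x)\leq h(\phi)+C_2.$$ If $L$ is a finite extension of the field $K$ of fractions of $A$, and the heights above are taken relative to $K$, then $C_1$ and $C_2$ depend only on $A$ and $r$.
   Context: **Drinfeld modules.** $q$ is a prime power, $X/\mathbb{F}_q$ is a smooth projective geometrically irreducible curve, $K=\mathbb{F}_q(X)$, $\infty\in X(\mathbb{F}_q)$ is a fixed point, and $A\subseteq K$ is the ring of functions regular away from $\infty$. For nonzero $a\in A$, $|a|_\infty=\#(A/aA)$ and $|a|_\infty=q^{\deg(a)}$. An $A$-field is a field $L$ with an injective homomorphism $A\to L$. A Drinfeld $A$-module $\phi/L$ is a ring homomorphism $A\to\mathrm{End}_L(\mathbb{G}_{\mathrm a})$, $a\mapsto\phi_a$ (additive polynomials over $L$ under composition), with $\phi_a(x)=ax+O(x^q)\in L[x]$ for all $a$, and $\phi_a(x)\ne ax$ for at least some $a$; its rank $r\ge1$ is the integer with $\deg\phi_a=|a|_\infty^r$ for all nonzero $a\in A$. Fix once and for all non-constant generators $T_1,\dots,T_m$ of $A$ as an $\mathbb{F}_q$-algebra, and write $\phi_{T_i}(x)=T_ix+\sum_{j=1}^{r\deg(T_i)}a_{i,j}x^{q^j}$. **Global function fields and heights.**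 Logarithms are normalized so that $\log q=1$; $\log^+t=\max\{0,\log t\}$. A global function field is a field $L$ with a set $M_L$ of non-trivial non-archimedean absolute values satisfying the product formula $\sum_{v\in M_L}\log|x|_v=0$ for all $x\in L^*$ (almost all terms being zero). For a finite extension $L'/L$, $M_{L'}$ consists of the extensions to $L'$ of the absolute values in $M_L$. With ground field $L$, and $L'/L$ a finite separable extension (for which $\sum_{w\mid v}[L'_w:L_v]=[L':L]$ for all $v\in M_L$), put, for $x\in L'$, $$h(x)=\sum_{v\in M_{L'}}\frac{[L'_v:L_v]}{[L':L]}\log^+|x|_v,\qquad \hat h_\phi(x)=\sum_{v\in M_{L'}}\frac{[L'_v:L_v]}{[L':L]}G_{\phi,v}(x),$$ where $G_{\phi,v}(x)=\lim_{N\to\infty}|T|_\infty^{-rN}\log^+|\phi_{T^N}(x)|_v$ for any non-constant $T\in A$ (independent of $T$). These are independent of $L'\ni x$. Further, $c_v(\phi)=-\frac{1}{q^{r\deg(T)}-1}\log|\Delta_T|_v$, where $\Delta_T$ is the leading coefficient of $\phi_T$ (independent of the non-constant $T\in A$), and $$h(\phi)=h(j_\phi)+\sum_{v\in M_L}\max\{0,c_v(\phi)\},\qquad h(j_\phi)=\sum_{v\in M_L}\max_{i,j}\frac{1}{q^j-1}\log|a_{i,j}|_v .$$ When $L/K$ is finite, ''heights relative to $K$'' means that $K$ (with its usual set of places $M_K$) is taken as ground field: all sums are over places $v$ of a finite extension $L'/K$ containing $L$ and $x$, with weights $[L'_v:K_v]/[L':K]$ and absolute values extending those of $K$. *)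

(* Defs.v *)
From HB Require Import structures.
From mathcomp Require Import all_boot all_order all_algebra all_field finmap.
From mathcomp Require Import all_classical all_reals all_analysis.

Set Implicit Arguments.
Unset Strict Implicit.
Unset Printing Implicit Defensive.

Import Order.TTheory GRing.Theory Num.Theory.
Import numFieldNormedType.Exports.

Local Open Scope classical_set_scope.
Local Open Scope ring_scope.

(* In this file [q] is a natural number (in the theorem, the order of the
   finite field of constants), and [v], [w] are absolute values with values in
   a [realType] R. *)

Definition logq (R : realType) (q : nat) (t : R) : R := ln t / ln q%:R.

(* [ln 0 = 0] in the library, hence [logp q 0 = 0], as it should be. *)
Definition logp (R : realType) (q : nat) (t : R) : R := Num.max 0 (logq q t).

Record nontrivial_nonarch_abs (R : realType) (L : fieldType) (v : L -> R) :
    Prop := {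
  abs_ge0 : forall x, 0 <= v x;
  abs_eq0 : forall x, v x = 0 <-> x = 0;
  absM : forall x y, v (x * y) = v x * v y;
  abs_ultra : forall x y, v (x + y) <= Num.max (v x) (v y);
  abs_nontrivial : exists2 x, x != 0 & v x != 1 }.

Definition product_formula (R : realType) (q : nat) (L : fieldType)
    (M : set (L -> R)) : Prop :=
  forall x : L, x != 0 ->
    finite_set [set v | M v /\ v x != 1] /\
    \sum_(v \in M) logq q (v x) = 0.

Definition global_function_field (R : realType) (q : nat) (L : fieldType)
    (M : set (L -> R)) : Prop :=
  (forall v, M v -> nontrivial_nonarch_abs v) /\ product_formula q M.

(* The absolute value of G below w, for w an absolute value of E/G. *)
Definition below (R : realType) (G : fieldType) (E : fieldExtType G)
    (w : E -> R) : G -> R := fun a => w (in_alg E a).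

Definition places_above (R : realType) (G : fieldType) (E : fieldExtType G)
    (M : set (G -> R)) : set (E -> R) :=
  [set w | nontrivial_nonarch_abs w /\ M (below w)].

Definition complete_abs (R : realType) (L : fieldType) (v : L -> R) : Prop :=
  forall u : nat -> L,
    (forall e : R, 0 < e -> exists N : nat, forall m n : nat,
        (N <= m)%N -> (N <= n)%N -> v (u m - u n) < e) ->
    exists l : L, forall e : R, 0 < e -> exists N : nat, forall n : nat,
        (N <= n)%N -> v (u n - l) < e.

Record is_completion (R : realType) (L : fieldType) (v : L -> R)
    (Lv : fieldType) (vv : Lv -> R) (i : {rmorphism L -> Lv}) : Prop := {
  completion_abs : nontrivial_nonarch_abs vv;
  completion_isometry : forall x, vv (i x) = v x;
  completion_dense : forall (y : Lv) (e : R), 0 < e -> exists x, vv (y - i x) < e;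
  completion_complete : complete_abs vv }.

(* n = [E_w : G_v], where v is the absolute value of G below w and E_w is an
   extension of G_v through the continuous extension of the inclusion of G
   in E. *)
Definition is_local_degree (R : realType) (G : fieldType) (E : fieldExtType G)
    (w : E -> R) (n : nat) : Prop :=
  exists (Gv : fieldType) (vv : Gv -> R) (i : {rmorphism G -> Gv})
         (Ew : fieldExtType Gv) (ww : Ew -> R) (j : {rmorphism E -> Ew}),
    [/\ is_completion (below w) vv i,
        is_completion w ww j,
        (forall a : Gv, ww (in_alg Ew a) = vv a),
        (forall a : G, j (in_alg E a) = in_alg Ew (i a)) &
        n = \dim {:Ew}].

Definition local_degree (R : realType) (G : fieldType) (E : fieldExtType G)
    (w : E -> R) : nat := xget 0%N (is_local_degree w).

(* The weight [E_w : G_v] / [E : G]. *)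
Definition weight (R : realType) (G : fieldType) (E : fieldExtType G)
    (w : E -> R) : R := (local_degree w)%:R / (\dim {:E})%:R.

Definition rational_function_of (F K : fieldType) (cK : {rmorphism F -> K})
    (t : K) : set K :=
  [set z | exists f g : {poly F},
     z = (map_poly cK f).[t] / (map_poly cK g).[t]].

(* K = F(X) for a smooth projective geometrically irreducible curve X over the
   finite field F: K is a finite extension of F(t) for some transcendental t,
   and F is algebraically closed in K. *)
Definition curve_function_field (F : finFieldType) (K : fieldType)
    (cK : {rmorphism F -> K}) : Prop :=
  (exists t : K, ~ algebraicOver cK t /\
     exists (n : nat) (b : 'I_n -> K), forall x : K,
       exists c : 'I_n -> K,
         (forall i, rational_function_of cK t (c i)) /\
         x = \sum_(i < n) c i * b i) /\
  (forall x : K, algebraicOver cK x -> range cK x).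

Definition residue_field (R : realType) (K : fieldType) (v : K -> R) :
    set (set K) :=
  [set [set y | v (y - x) < 1] | x in [set x | v x <= 1]].

(* The closed points of X, as normalized absolute values of K: v has a finite
   residue field with N elements and |pi|_v = 1/N for a generator |pi|_v of
   its value group. *)
Definition curve_places (R : realType) (K : fieldType) : set (K -> R) :=
  [set v | nontrivial_nonarch_abs v /\
     exists (N : nat) (pi : K),
       [/\ (residue_field v #= `I_N)%card, v pi = N%:R^-1 &
           forall x : K, x != 0 -> exists k : int, v x = v pi ^ k]].

(* Points whose residue field is the constant field F. *)
Definition rational_point (R : realType) (F : finFieldType) (K : fieldType)
    (cK : {rmorphism F -> K}) (v : K -> R) : Prop :=
  curve_places v /\
  forall x : K, v x <= 1 -> exists c : F, v (x - cK c) < 1.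

Definition regular_away_from (R : realType) (K : fieldType) (vinf : K -> R) :
    set K :=
  [set x | forall v : K -> R, curve_places v -> v <> vinf -> v x <= 1].

Definition constant_element (F K : fieldType) (cK : {rmorphism F -> K})
    (A : idomainType) (iA : {rmorphism A -> K}) : set A :=
  [set a | range cK (iA a)].

Definition algebra_generators (F K : fieldType) (cK : {rmorphism F -> K})
    (A : idomainType) (iA : {rmorphism A -> K}) (m : nat) (T : 'I_m -> A) :
    Prop :=
  forall S : set A,
    constant_element cK iA `<=` S -> (forall i, S (T i)) ->
    (forall a b, S a -> S b -> S (a + b)) ->
    (forall a b, S a -> S b -> S (a * b)) ->
    S = setT.

(* |a|_oo = #(A/aA), for a <> 0. *)
Definition norminf (A : idomainType) (a : A) : nat :=
  #|` fset_set (range (fun x : A => [set y : A | exists z, y = x + a * z]))|.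

(* |a|_oo is a power of q, for a <> 0. *)
Definition deginf (q : nat) (A : idomainType) (a : A) : nat :=
  trunc_log q (norminf a).

(* p('X + 'Y) = p('X) + p('Y) in L['X, 'Y]. *)
Definition additive_poly (L : fieldType) (p : {poly L}) : Prop :=
  poly_XaY p = map_poly polyC p + p%:P.

Record drinfeld_module (q : nat) (A : idomainType) (L : fieldType)
    (iL : {rmorphism A -> L}) (phi : A -> {poly L}) : Prop := {
  drinfeld_additive : forall a, additive_poly (phi a);
  drinfeld1 : phi 1 = 'X;
  drinfeldD : forall a b, phi (a + b) = phi a + phi b;
  drinfeldM : forall a b, phi (a * b) = phi a \Po phi b;
  drinfeld_linear : forall a, 'X^q %| phi a - iL a *: 'X;
  drinfeld_nontrivial : exists a, phi a != iL a *: 'X }.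

(* [size p] is the degree of p plus one. *)
Definition drinfeld_rank (A : idomainType) (L : fieldType)
    (phi : A -> {poly L}) (r : nat) : Prop :=
  forall a : A, a != 0 -> size (phi a) = (norminf a ^ r).+1.

Definition base_change (A : idomainType) (L L' : fieldType) (f : L -> L')
    (phi : A -> {poly L}) : A -> {poly L'} := fun a => map_poly f (phi a).

(* G_{phi,v}(x), computed with the non-constant element S of A. *)
Definition local_green (R : realType) (q : nat) (A : idomainType)
    (L : fieldType) (r : nat) (phi : A -> {poly L}) (S : A) (v : L -> R)
    (x : L) : R :=
  limn (fun N : nat =>
    ((norminf S)%:R ^- (r * N)) * logp q (v (phi (S ^+ N)).[x])).

(* c_v(phi), computed with the non-constant element S of A. *)
Definition local_c (R : realType) (q : nat) (A : idomainType) (L : fieldType)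
    (r : nat) (phi : A -> {poly L}) (S : A) (v : L -> R) : R :=
  - (logq q (v (lead_coef (phi S))) / (q%:R ^+ (r * deginf q S) - 1)).

(* The local term max_{i,j} log|a_{i,j}|_v / (q^j - 1) of h(j_phi), where
   a_{i,j} is the coefficient of x^(q^j) in phi_{T_i}. The vanishing a_{i,j},
   for which the logarithm is -oo, do not contribute to the maximum. *)
Definition local_j (R : realType) (q : nat) (A : idomainType) (L : fieldType)
    (r m : nat) (T : 'I_m -> A) (phi : A -> {poly L}) (v : L -> R) : R :=
  fine (\big[maxe/-oo%E]_(i < m)
    \big[maxe/-oo%E]_(1 <= j < (r * deginf q (T i)).+1
                     | (phi (T i))`_(q ^ j) != 0)
       (logq q (v (phi (T i))`_(q ^ j)) / (q%:R ^+ j - 1))%:E).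

(* h(phi) as a sum over the absolute values v in M with weights wt v: the
   weights are 1 if M is the set of places of the ground field. The element S
   of A is the one used for c_v(phi). *)
Definition drinfeld_height (R : realType) (q : nat) (A : idomainType)
    (L : fieldType) (r m : nat) (T : 'I_m -> A) (M : set (L -> R))
    (wt : (L -> R) -> R) (phi : A -> {poly L}) (S : A) : R :=
  \sum_(v \in M) wt v * local_j q r T phi v +
  \sum_(v \in M) wt v * Num.max 0 (local_c q r phi S v).

(* h(x) for x in the extension E of the ground field G. *)
Definition weil_height (R : realType) (q : nat) (G : fieldType)
    (M : set (G -> R)) (E : fieldExtType G) (x : E) : R :=
  \sum_(w \in places_above (E := E) M) weight w * logp q (w x).

Definition canonical_height (R : realType) (q : nat) (A : idomainType)
    (G : fieldType) (M : set (G -> R)) (E : fieldExtType G) (r : nat)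
    (phi : A -> {poly E}) (S : A) (x : E) : R :=
  \sum_(w \in places_above (E := E) M) weight w * local_green q r phi S w x.

(* Main.v *)
Require Import Defs.
From HB Require Import structures.
From mathcomp Require Import all_boot all_order all_algebra all_field finmap.
From mathcomp Require Import all_classical all_reals all_analysis.
From mathcomp Require Import ring lra zify.
Set Implicit Arguments.
Unset Strict Implicit.
Unset Printing Implicit Defensive.

Import Order.TTheory GRing.Theory Num.Theory.
Import numFieldNormedType.Exports.

Local Open Scope classical_set_scope.
Local Open Scope ring_scope.

(* Fix one of the generators T = T_i.  At a place w put J = max_{i,j} log|a_{i,j}|_w /
   (q^j - 1), c = c_w(phi) and t = log^+|T|_w; the leading coefficient of phi_T
   gives J + c >= 0.  Following the size of the iterates phi_{T^N}(x) yields
     - (max(0,c) + (J + c) + t) <= G_w(x) - log^+|x|_w <= J + max(0,c) + t: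
   for the upper bound rescale x so that the a_{i,j} become integral; for the
   lower bound note that beyond the radius q^(c + (J + c) + t) the leading term
   of phi_T dominates, and that G_w >= 0.  The sum of c over all places
   vanishes by the product formula, so both sides sum to h(phi) + C, where C is
   the sum of t, and (1 - q^-r)^-1 >= 1 because h(phi) >= 0.

   Over a ground field L, terms depending only on the place below are summed
   with sum_{w|v} [E_w : G_v] <= [E : G], which follows from weak approximation
   and the equivalence of norms over complete fields.

   Relative to K, the product formula on the extension E with weights
   [E_w : K_v] is needed.  For w above a closed point, #(O_w / yO_w) =
   |y|_w^(-[E_w : K_v]).  Let y be transcendental over F = F_q.  With k the size of
   an F[y]-independent family, counting residues modulo y gives
   prod_{|y|_w < 1} |y|_w^(-n_w) <= q^k, and counting the combinations
   sum_j P_j(y) b_j with deg P_j bounded gives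
   q^k <= prod_{|y|_w > 1} |y|_w^(n_w); apply this to y and 1/y.  Places where a
   given element is small come from maximal subrings containing it as a
   non-unit. *)

(** * Non-archimedean absolute values *)

(** Sums over places are finitary: a sum of infinite support is 0 by convention. So each one comes
    with a finite set of places off which its local terms vanish. Likewise [local_degree] is 0
    unless completions exist; hence they are constructed, and the positivity of local degrees yields
    the finiteness of the places above a given one. Over a general ground field only an inequality
    is proved for the sum of the local degrees above a place. It suffices because both local bounds
    are nonnegative, which is what J + c >= 0 ensures, and because the product formula is applied on
    the ground field itself, where [phi] is defined. Relative to K the terms J and c live on E and
    do not descend, so an inequality no longer makes the sum of c vanish: the exact local degrees
    must be matched with a count of residues. Only the term t comes from K, which is why C does not
    see L. *)

Section NonarchAbs.
Variables (R : realType) (L : fieldType) (v : L -> R).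
Hypothesis Hv : nontrivial_nonarch_abs v.

Lemma abs0 : v 0 = 0.
Proof. by apply/(abs_eq0 Hv). Qed.

Lemma abs_gt0 x : x != 0 -> 0 < v x.
Proof.
move=> x0; rewrite lt_neqAle (abs_ge0 Hv) andbT eq_sym.
by apply: contra_neq x0 => /(abs_eq0 Hv).
Qed.

Lemma abs_neq0 x : 0 < v x -> x != 0.
Proof. by move=> xp; apply: contraTneq xp => ->; rewrite abs0 ltxx. Qed.

Lemma abs1 : v 1 = 1.
Proof.
have h : v 1 * v 1 = v 1 * 1 by rewrite -(absM Hv) !mulr1.
by apply: (mulfI _ h); rewrite gt_eqF// abs_gt0// oner_neq0.
Qed.

Lemma absX x n : v (x ^+ n) = v x ^+ n.
Proof. by elim: n => [|n ih]; rewrite ?expr0 ?abs1// !exprS (absM Hv) ih. Qed.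

Lemma abs_unity x n : (0 < n)%N -> x ^+ n = 1 -> v x = 1.
Proof.
move=> n0 /(congr1 v); rewrite absX abs1 => h; apply/eqP.
by rewrite -(@pexpr_eq1 _ _ n) ?h ?(abs_ge0 Hv)// -lt0n.
Qed.

Lemma absN x : v (- x) = v x.
Proof.
have h : v (-1) = 1 by apply: (@abs_unity _ 2) => //; rewrite sqrrN expr1n.
by rewrite -mulN1r (absM Hv) h mul1r.
Qed.

Lemma absD_le x y r : v x <= r -> v y <= r -> v (x + y) <= r.
Proof. by move=> hx hy; rewrite (le_trans (abs_ultra Hv _ _))// ge_max hx hy. Qed.

Lemma absB_le x y r : v x <= r -> v y <= r -> v (x - y) <= r.
Proof. by move=> hx hy; apply: absD_le => //; rewrite absN. Qed.

Lemma absD_lt x y r : v x < r -> v y < r -> v (x + y) < r.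
Proof. by move=> hx hy; rewrite (le_lt_trans (abs_ultra Hv _ _))// gt_max hx hy. Qed.

Lemma absB_lt x y r : v x < r -> v y < r -> v (x - y) < r.
Proof. by move=> hx hy; apply: absD_lt => //; rewrite absN. Qed.

Lemma absBC x y : v (x - y) = v (y - x).
Proof. by rewrite -absN opprB. Qed.

Lemma absV x : v x^-1 = (v x)^-1.
Proof.
have [->|x0] := eqVneq x 0; first by rewrite invr0 abs0 invr0.
have vx0 : v x != 0 by rewrite gt_eqF// abs_gt0.
by apply: (mulfI vx0); rewrite -(absM Hv) !divff// abs1.
Qed.

Lemma abs_div x y : v (x / y) = v x / v y.
Proof. by rewrite (absM Hv) absV. Qed.

Lemma absXz x (k : int) : v (x ^ k) = v x ^ k.
Proof.
case: k => n; first by rewrite -!exprnP absX.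
by rewrite NegzE -!exprnN absV absX.
Qed.

Lemma absD_eq x y : v y < v x -> v (x + y) = v x.
Proof.
move=> yx; apply/eqP; rewrite eq_le; apply/andP; split.
  by rewrite absD_le// ltW.
rewrite leNgt; apply/negP => h.
have : v (x + y - y) < v x by apply: absB_lt.
by rewrite addrK ltxx.
Qed.

Lemma abs_sum_le (I : Type) (s : seq I) (P : pred I) (f : I -> L) r :
  0 <= r -> (forall i, P i -> v (f i) <= r) -> v (\sum_(i <- s | P i) f i) <= r.
Proof.
move=> r0 h; elim/big_ind: _ => //; first by rewrite abs0.
by move=> x y; apply: absD_le.
Qed.

Lemma abs_sum_lt (I : Type) (s : seq I) (P : pred I) (f : I -> L) r :
  0 < r -> (forall i, P i -> v (f i) < r) -> v (\sum_(i <- s | P i) f i) < r.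
Proof.
move=> r0 h; elim/big_ind: _ => //; first by rewrite abs0.
by move=> x y; apply: absD_lt.
Qed.

Lemma exists_abs_lt1 : exists2 x, x != 0 & v x < 1.
Proof.
case: (abs_nontrivial Hv) => x x0 x1.
have [h|h] := ltP (v x) 1; first by exists x.
exists x^-1; rewrite ?invr_eq0// absV invf_lt1 ?abs_gt0//.
by rewrite lt_neqAle eq_sym x1.
Qed.

Lemma exists_abs_gt1 : exists x, 1 < v x.
Proof.
case: exists_abs_lt1 => x x0 x1; exists x^-1.
by rewrite absV invf_gt1// abs_gt0.
Qed.

Lemma exists_abs_lt (e : R) : 0 < e -> exists2 x, x != 0 & v x < e.
Proof.
case: exists_abs_lt1 => x x0 x1 e0.
have ax : `|v x| < 1 by rewrite ger0_norm// (abs_ge0 Hv).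
have /cvgrPdist_lt/(_ _ e0) [N _ h] := cvg_expr ax.
exists (x ^+ N); first exact: expf_neq0.
have := h N (leqnn N); rewrite /= sub0r normrN absX.
by apply: le_lt_trans; rewrite ler_norm.
Qed.

Lemma exists_abs_gt (e : R) : exists x, e < v x.
Proof.
have m0 : 0 < Num.max 1 e by rewrite lt_max ltr01.
have [x x0 h] := exists_abs_lt (eq_ind_r is_true m0 (invr_gt0 _)).
exists x^-1; rewrite absV (@le_lt_trans _ _ (Num.max 1 e))//.
  by rewrite le_max lexx orbT.
by rewrite -[ltLHS]invrK ltf_pV2// posrE ?invr_gt0// abs_gt0.
Qed.

Lemma abs_poly_le (p : {poly L}) x r :
  (forall i, v p`_i * v x ^+ i <= r) -> v p.[x] <= r.
Proof.
move=> h; rewrite horner_coef; apply: abs_sum_le => [|i _].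
  by have := h (size p); rewrite nth_default// abs0 mul0r.
by rewrite (absM Hv) absX.
Qed.

(* Integrality: the leading term cannot dominate. *)
Lemma abs_root_le1 (p : {poly L}) x :
  p \is monic -> (forall i, v p`_i <= 1) -> root p x -> v x <= 1.
Proof.
move=> pm hp /rootP px; rewrite leNgt; apply/negP => x1.
have p0 : (0 < size p)%N by rewrite size_poly_gt0 monic_neq0.
have : v (p.[x] - x ^+ (size p).-1) < v (x ^+ (size p).-1).
  rewrite horner_coef; case sp: (size p) p0 => [//|n] _.
  have pn : p`_n = 1 by rewrite -(eqP pm) lead_coefE sp.
  rewrite big_ord_recr/= pn mul1r addrK.
  apply: abs_sum_lt => [|i _]; first by rewrite abs_gt0// expf_neq0// abs_neq0// (lt_trans _ x1)// ltr01.
  rewrite (absM Hv) !absX (@le_lt_trans _ _ (v x ^+ i))//.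
    by rewrite ler_piMl// exprn_ge0// (abs_ge0 Hv).
  by rewrite ltr_eXn2l.
by rewrite px sub0r absN ltxx.
Qed.

End NonarchAbs.

(** * Indices of additive subgroups *)

(** Replaces the choice of bases and of coset representatives: when the families with property [P]
    have bounded size, one of largest size cannot be extended by a single element. *)
Lemma max_family (V : Type) (P : forall I : finType, (I -> V) -> Prop) (n : nat) :
  (forall f : void -> V, P void f) ->
  (forall (I : finType) (f : I -> V), P I f -> (#|I| <= n)%N) ->
  exists (I : finType) (f : I -> V), P I f /\ ~ exists x,
    P (option I) (fun i => if i is Some j then f j else x).
Proof.
move=> P0 Pn.
pose Q k := `[< exists (I : finType) (f : I -> V), #|I| = k /\ P I f >].
have Q0 : exists k, Q k.
  by exists 0%N; apply/asboolP; exists void, (of_void V); split; rewrite ?card_void.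
have Qn k : Q k -> (k <= n)%N by move=> /asboolP[I [f [<- /Pn]]].
case: (ex_maxnP Q0 Qn) => k /asboolP[I [f [Ik Pf]]] kmax.
exists I, f; split=> // -[x Px].
suff : (k.+1 <= k)%N by rewrite ltnn.
by apply: kmax; apply/asboolP; do 2!eexists; split; last exact: Px; rewrite card_option Ik.
Qed.

Section Index.
Variable V : zmodType.
Implicit Types X Y Z : set V.

Definition subgroup Y := Y 0 /\ forall x y, Y x -> Y y -> Y (x - y).

Definition separated X Y (I : finType) (f : I -> V) :=
  (forall i, X (f i)) /\ forall i j, Y (f i - f j) -> i = j.

(* [X] meets exactly [k] cosets of [Y]. *)
Definition index_eq X Y (k : nat) := exists (I : finType) (f : I -> V),
  [/\ #|I| = k, separated X Y f & forall x, X x -> exists i, Y (x - f i)].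

Lemma subgroupN Y x : subgroup Y -> Y x -> Y (- x).
Proof. by move=> [Y0 YB] Yx; rewrite -[- x]sub0r; exact: YB. Qed.

Lemma subgroupD Y x y : subgroup Y -> Y x -> Y y -> Y (x + y).
Proof. by move=> sY Yx Yy; rewrite -[y]opprK; apply: sY.2 => //; exact: subgroupN. Qed.

Lemma subgroup_sum Y (I : Type) (s : seq I) (P : pred I) (f : I -> V) :
  subgroup Y -> (forall i, P i -> Y (f i)) -> Y (\sum_(i <- s | P i) f i).
Proof.
move=> sY Yf; elim/big_ind: _ => //; first exact: sY.1.
by move=> x y; exact: subgroupD.
Qed.

Lemma subgroupBC Y x y : subgroup Y -> Y (x - y) -> Y (y - x).
Proof. by move=> sY h; rewrite -opprB; exact: subgroupN. Qed.

Lemma subgroup_trans Y x y z : subgroup Y -> Y (x - y) -> Y (y - z) -> Y (x - z).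
Proof. by move=> sY xy yz; have := subgroupD sY xy yz; rewrite addrA subrK. Qed.

Lemma separated_le X Y (I : finType) (f : I -> V) k :
  subgroup Y -> separated X Y f -> index_eq X Y k -> (#|I| <= k)%N.
Proof.
move=> sY [Xf sf] [J [g [<- _ gX]]].
have [h hP] := choice (fun i => gX _ (Xf i)).
apply: (@leq_card _ _ h) => i j hij; apply: sf.
apply: (subgroup_trans sY (hP i)); rewrite hij; exact: subgroupBC.
Qed.

(** A separated family of maximal size meets every coset, since an element of a missed coset could
    be added to it. *)
Lemma index_exists X Y n : subgroup Y ->
  (forall (I : finType) (f : I -> V), separated X Y f -> (#|I| <= n)%N) ->
  exists2 k, (k <= n)%N & index_eq X Y k.
Proof.
move=> sY hn.
have [||I [f [sf fmax]]] := @max_family V (@separated X Y) n => //.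
exists #|I|; first exact: hn sf.
exists I, f; split=> // x Xx; apply: contrapT => nx; apply: fmax; exists x.
split=> [[i|]//|]; first exact: sf.1.
move=> [i|] [j|]// h; first by rewrite (sf.2 _ _ h).
- by exfalso; apply: nx; exists i; exact: subgroupBC.
- by exfalso; apply: nx; exists j.
Qed.

Lemma index_gt0 X Y k : (exists x, X x) -> index_eq X Y k -> (0 < k)%N.
Proof.
move=> [x Xx] [I [f [<- _ h]]]; have [i _] := h _ Xx.
by apply/card_gt0P; exists i.
Qed.

(** The sums f i + g j of representatives of [X] modulo [Y] and of [Y] modulo [Z] represent [X]
    modulo [Z]. *)
Lemma indexM X Y Z k l : subgroup X -> subgroup Y -> subgroup Z ->
  Y `<=` X -> Z `<=` Y -> index_eq X Y k -> index_eq Y Z l ->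
  index_eq X Z (k * l).
Proof.
move=> sX sY sZ YX ZY [I [f [<- [Xf sf] fX]]] [J [g [<- [Yg sg] gY]]].
exists (I * J)%type, (fun p => f p.1 + g p.2); split; first by rewrite card_prod.
  split=> [[i j]|[i j] [i' j']] /=; first by apply: (subgroupD sX) => //; exact: YX.
  move=> h; have ii' : i = i'.
    apply: sf; have -> : f i - f i' = (f i + g j - (f i' + g j')) - (g j - g j').
      by rewrite opprD addrACA addrK.
    by apply: sY.2; [exact: ZY | exact: sY.2].
  rewrite ii'; congr pair; apply: sg; move: h; rewrite ii' opprD addrACA subrr.
  by rewrite add0r.
move=> x Xx; have [i hi] := fX _ Xx; have [j hj] := gY _ hi.
by exists (i, j); rewrite /= opprD addrA.
Qed.

End Index.

Lemma index_le (V V' : zmodType) (X Y : set V) (X' Y' : set V') (h : V -> V') k k' :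
  subgroup Y' -> (forall x, X x -> X' (h x)) ->
  (forall x y, X x -> X y -> Y' (h x - h y) -> Y (x - y)) ->
  index_eq X Y k -> index_eq X' Y' k' -> (k <= k')%N.
Proof.
move=> sY' hX hY [I [f [<- [Xf sf] _]]]; apply: (separated_le (f := h \o f)) => //.
split=> [i|i j /= hij]; first exact: hX.
by apply: sf; apply: hY hij.
Qed.

Lemma index_uniq (V : zmodType) (X Y : set V) k k' : subgroup Y ->
  index_eq X Y k -> index_eq X Y k' -> k = k'.
Proof.
move=> sY hk hk'; apply/eqP; rewrite eqn_leq.
by apply/andP; split; apply: (@index_le _ _ X Y X Y idfun).
Qed.

Lemma index_coarse (V : zmodType) (X Y Z : set V) k : subgroup Y -> subgroup Z ->
  Z `<=` Y -> index_eq X Z k -> exists2 l, (l <= k)%N & index_eq X Y l.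
Proof.
move=> sY sZ ZY hk; apply: index_exists => // I f [Xf sf].
by apply: (separated_le sZ _ hk); split; [exact: Xf | move=> i j /ZY; exact: sf].
Qed.

Section ScaledIndex.
Variable E : fieldType.

Definition scaled (y : E) (X : set E) : set E := [set y * x | x in X].

Lemma scaled_subgroup y X : subgroup X -> subgroup (scaled y X).
Proof.
move=> sX; split; first by exists 0; rewrite ?mulr0//; exact: sX.1.
by move=> _ _ [x Xx <-] [z Xz <-]; exists (x - z); [exact: sX.2|rewrite mulrBr].
Qed.

Lemma scaledM y z X : scaled y (scaled z X) = scaled (y * z) X.
Proof.
apply/seteqP; split=> [_ [_ [x Xx <-] <-]|_ [x Xx <-]].
  by exists x => //; rewrite mulrA.
by exists (z * x); [exists x|rewrite mulrA].
Qed.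

Lemma scaledP y X x : y != 0 -> scaled y X x <-> X (y^-1 * x).
Proof.
move=> y0; split=> [[z Xz <-]|Xx]; first by rewrite mulKf.
by exists (y^-1 * x) => //; rewrite mulVKf.
Qed.

Lemma index_scaled y X Y k : y != 0 ->
  index_eq X Y k -> index_eq (scaled y X) (scaled y Y) k.
Proof.
move=> y0 [I [f [Ik [Xf sf] fX]]]; exists I, (fun i => y * f i); split=> //.
  split=> [i|i j]; first by exists (f i).
  by rewrite -mulrBr scaledP// mulKf//; exact: sf.
move=> _ [x Xx <-]; have [i hi] := fX _ Xx; exists i.
by exists (x - f i); rewrite ?mulrBr.
Qed.

End ScaledIndex.

Lemma sum_option (V : nmodType) (I : finType) (f : option I -> V) :
  \sum_i f i = \sum_i f (Some i) + f None.
Proof.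
rewrite (bigD1 None)//= addrC; congr (_ + _).
rewrite (reindex_omap Some id) => [|[]//].
by apply: eq_bigl => i; rewrite eqxx.
Qed.

Section FinSpace.
Variables (F : finFieldType) (E : fieldType) (c : {rmorphism F -> E}).

Definition indep_mod (Y : set E) (I : finType) (f : I -> E) :=
  forall g : I -> F, Y (\sum_i c (g i) * f i) -> forall i, g i = 0.

(** The quotient is an [F]-space of dimension at most [n]: a maximal family independent modulo [Y]
    is a basis, and its [F]-combinations represent the cosets. *)
Lemma index_finspace (X Y : set E) n :
  subgroup X -> subgroup Y -> Y `<=` X ->
  (forall a x, X x -> X (c a * x)) -> (forall a x, Y x -> Y (c a * x)) ->
  (forall (I : finType) (f : I -> E), (forall i, X (f i)) -> indep_mod Y f ->
    (#|I| <= n)%N) ->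
  exists (I : finType) (f : I -> E), [/\ forall i, X (f i), indep_mod Y f &
    index_eq X Y (#|F| ^ #|I|)].
Proof.
move=> sX sY YX FX FY hn.
have [||I [f [[Xf inf] fmax]]] := @max_family E
  (fun I f => (forall i, X (f i)) /\ indep_mod Y f) n.
- by move=> f; split=> [[]|g _ []].
- by move=> I f []; exact: hn.
exists I, f; split=> //; exists {ffun I -> F}, (fun g : {ffun I -> F} => \sum_i c (g i) * f i).
split; first by rewrite card_ffun.
  split=> [g|g h].
    by apply: subgroup_sum => // i _; exact: FX.
  rewrite -sumrB => hgh; apply/ffunP => i; apply/eqP; rewrite -subr_eq0; apply/eqP.
  apply: (inf (fun i => g i - h i)); move: hgh; congr Y.
  by apply: eq_bigr => j _; rewrite rmorphB mulrBl.
move=> x Xx; apply: contrapT => nx; apply: fmax; exists x; split.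
  by move=> [i|].
move=> g; rewrite sum_option /= => hY.
(* Dividing by a nonzero coefficient of [x] would place [x] in the coset of a combination of [f]. *)
have gN : g None = 0.
  apply: contrapT => /eqP gN; apply: nx.
  exists [ffun i => - (g (Some i) / g None)].
  have := FY (g None)^-1 _ hY; congr Y.
  rewrite mulrDr mulrA -rmorphM mulVf// rmorph1 mul1r addrC; congr (_ + _).
  rewrite mulr_sumr -sumrN; apply: eq_bigr => i _.
  by rewrite ffunE rmorphN mulNr opprK mulrA -rmorphM mulrC [_^-1 * _]mulrC mulrC.
move: hY; rewrite gN rmorph0 mul0r addr0 => /inf h [i|] //; exact: h.
Qed.

End FinSpace.

(** * Weak approximation *)

Lemma exprn_lt (R : realType) (x e : R) : 0 <= x -> x < 1 -> 0 < e ->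
  exists N : nat, forall n, (N <= n)%N -> x ^+ n < e.
Proof.
move=> x0 x1 e0; have ax : `|x| < 1 by rewrite ger0_norm.
have /cvgrPdist_lt/(_ _ e0) [N _ h] := cvg_expr ax.
exists N => n Nn; have := h n Nn; rewrite /= sub0r normrN ger0_norm//.
exact: exprn_ge0.
Qed.

Lemma uniform_eventually (I : eqType) (s : seq I) (P : I -> nat -> Prop) :
  (forall i, i \in s -> exists N : nat, forall n, (N <= n)%N -> P i n) ->
  exists N : nat, forall n i, (N <= n)%N -> i \in s -> P i n.
Proof.
elim: s => [|i s ih] h; first by exists 0%N.
have [N1 h1] := h i (mem_head _ _).
have [|N2 h2] := ih; first by move=> j js; apply: h; rewrite inE js orbT.
exists (maxn N1 N2) => n j; rewrite geq_max => /andP[n1 n2].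
by rewrite inE => /orP[/eqP ->|js]; [exact: h1|exact: h2].
Qed.

Section WeakApproximation.
Variables (R : realType) (E : fieldType) (I : finType) (w : I -> E -> R).
Hypothesis wabs : forall i, nontrivial_nonarch_abs (w i).
Hypothesis w_indep : forall i j, i != j -> exists a, w i a < 1 /\ 1 < w j a.

(** Induction on [s], with [b] large at [i0] and small at the new index [j]. A high power of [a]
    makes a^N b small on [s]. If |a|_j > 1, the factor a^N is replaced by a^(N+1) / (1 + a^(N+1)),
    which has absolute value 1 where [a] is large and |a|^(N+1) where [a] is small. *)
Lemma exists_abs_separating i0 (s : seq I) : i0 \notin s ->
  exists a, 1 < w i0 a /\ forall j, j \in s -> w j a < 1.
Proof.
elim: s => [|j s ih]; first by move=> _; have [a] := exists_abs_gt1 (wabs i0); exists a.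
rewrite inE negb_or => /andP[ij /ih [a [a1 aS]]].
have [|b [bj bi]] := @w_indep j i0; first by rewrite eq_sym.
have [N hN] : exists N : nat, forall n l, (N <= n)%N -> l \in s -> w l a ^+ n * w l b < 1.
  apply: uniform_eventually => l ls.
  have b0 : 0 < w l b by apply: abs_gt0 => //; apply: (abs_neq0 (wabs i0)); rewrite (lt_trans _ bi).
  have [|N h] := @exprn_lt R (w l a) (w l b)^-1 (abs_ge0 (wabs l) _) (aS _ ls).
    by rewrite invr_gt0.
  by exists N => n /h; rewrite -ltr_pdivlMr// mul1r.
have aN1 : 1 <= w i0 a ^+ N by rewrite exprn_ege1// ltW.
have [aj|aj] := leP (w j a) 1.
  exists (a ^+ N * b); split=> [|l].
    by rewrite (absM (wabs _)) (absX (wabs _)) (lt_le_trans bi)// ler_peMl// (abs_ge0 (wabs _)).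
  rewrite (absM (wabs _)) (absX (wabs _)) inE => /orP[/eqP ->|/hN]; last exact.
  rewrite (le_lt_trans _ bj)// ler_piMl ?exprn_ile1//; exact: (abs_ge0 (wabs _)).
have big l : 1 < w l a -> w l (a ^+ N.+1 / (1 + a ^+ N.+1)) = 1.
  move=> la; rewrite (abs_div (wabs l)) addrC (absD_eq (wabs l)).
    by rewrite divff// (absX (wabs l)) gt_eqF// exprn_gt0// (lt_trans _ la).
  by rewrite (abs1 (wabs l)) (absX (wabs l)) exprn_egt1.
exists (a ^+ N.+1 / (1 + a ^+ N.+1) * b); split=> [|l].
  by rewrite (absM (wabs _)) big// mul1r.
rewrite (absM (wabs _)) inE => /orP[/eqP ->|ls]; first by rewrite big// mul1r.
rewrite (abs_div (wabs l)) (absD_eq (wabs l)).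
  by rewrite (abs1 (wabs l)) divr1 (absX (wabs l)) hN.
rewrite (abs1 (wabs l)) (absX (wabs l)) exprn_ilt1 ?aS//; exact: (abs_ge0 (wabs _)).
Qed.

(** The quotient a^n / (1 + a^n) differs from 1 by 1 / (1 + a^n), so it tends to 1 where |a| > 1 and
    to 0 where |a| < 1. *)
Lemma weak_approximation1 i0 (e : R) : 0 < e ->
  exists y, w i0 (y - 1) < e /\ forall j, j != i0 -> w j y < e.
Proof.
move=> e0; have [|a [a1 aS]] := @exists_abs_separating i0 (rem i0 (enum I)).
  by rewrite mem_rem_uniqF// enum_uniq.
have [N hN] : exists N : nat, forall n l, (N <= n)%N -> l \in enum I ->
   (if l == i0 then (w l a)^-1 else w l a) ^+ n < e.
  apply: uniform_eventually => l _; apply: exprn_lt => //.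
    by case: ifP => _; rewrite ?invr_ge0 (abs_ge0 (wabs l)).
  case: eqP => [->|/eqP li]; first by rewrite invf_lt1// (lt_trans _ a1).
  by apply: aS; rewrite mem_rem_uniq ?enum_uniq// !inE li mem_enum.
exists (a ^+ N.+1 / (1 + a ^+ N.+1)); split.
  have h : w i0 (1 + a ^+ N.+1) = w i0 a ^+ N.+1.
    rewrite addrC (absD_eq (wabs i0)) ?(absX (wabs i0))//.
    by rewrite (abs1 (wabs i0)) exprn_egt1.
  have n0 : 1 + a ^+ N.+1 != 0.
    by apply: (abs_neq0 (wabs i0)); rewrite h exprn_gt0// (lt_trans _ a1).
  rewrite -[X in _ - X](divff n0) -mulrBl opprD addrCA subrr addr0.
  rewrite (abs_div (wabs i0)) (absN (wabs i0)) (abs1 (wabs i0)) h.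
  by have := hN N.+1 i0 (leqnSn _); rewrite mem_enum eqxx exprVn mul1r; apply.
move=> j ji; have aj : w j a < 1.
  by apply: aS; rewrite mem_rem_uniq ?enum_uniq// !inE ji mem_enum.
rewrite (abs_div (wabs j)) (absD_eq (wabs j)).
  rewrite (abs1 (wabs j)) divr1 (absX (wabs j)).
  by have := hN N.+1 j (leqnSn _); rewrite mem_enum (negbTE ji); apply.
rewrite (abs1 (wabs j)) (absX (wabs j)) exprn_ilt1//; exact: (abs_ge0 (wabs _)).
Qed.

Lemma weak_approximation (x : I -> E) (e : R) : 0 < e ->
  exists y, forall i, w i (y - x i) < e.
Proof.
(* [M] dominates every |x_j|_i, so approximations of 0 and 1 to within e/M may be multiplied by the
   x_j. *)
move=> e0; pose M : R := 1 + \sum_i \sum_j w i (x j).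
have M0 : 0 < M.
  by rewrite ltr_wpDr// sumr_ge0// => i _; rewrite sumr_ge0// => j _; exact: (abs_ge0 (wabs _)).
have Mb i j : w i (x j) < M.
  rewrite /M (bigD1 i)//= (bigD1 j)//= addrA addrA ltr_wpDr//.
    by rewrite sumr_ge0// => k _; rewrite sumr_ge0// => l _; exact: (abs_ge0 (wabs _)).
  rewrite ltr_wpDr ?ltrDr//.
  by rewrite sumr_ge0// => k _; exact: (abs_ge0 (wabs _)).
have eM : 0 < e / M by rewrite divr_gt0.
have [f hf] := choice (fun i => weak_approximation1 i eM).
have key i j u : w i u < e / M -> w i (u * x j) < e.
  move=> hu; rewrite (absM (wabs i)) -[e](divfK (lt0r_neq0 M0)).
  by rewrite ltr_pM// ?(abs_ge0 (wabs _)).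
exists (\sum_j f j * x j) => i; rewrite (bigD1 i)//= addrAC -[X in _ - X]mul1r -mulrBl.
apply: (absD_lt (wabs i)); first by apply: key; exact: (hf i).1.
apply: (abs_sum_lt (wabs i)) => // j ji; apply: key; apply: (hf j).2.
by rewrite eq_sym.
Qed.

End WeakApproximation.

(** * Linear independence over a complete field *)

Section FiniteDimNorm.
Variables (R : realType) (G E : fieldType) (k : {rmorphism G -> E}).
Variables (v : G -> R) (w : E -> R).
Hypothesis vabs : nontrivial_nonarch_abs v.
Hypothesis wabs : nontrivial_nonarch_abs w.
Hypothesis wk : forall a, w (k a) = v a.

Definition lin_indep (I : finType) (e : I -> E) :=
  forall g : I -> G, \sum_i k (g i) * e i = 0 -> forall i, g i = 0.

Lemma abs_lincomb_le (I : finType) (e : I -> E) : exists2 C : R, 0 < C &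
  forall (g : I -> G) r, (forall i, v (g i) <= r) -> 0 <= r ->
    w (\sum_i k (g i) * e i) <= C * r.
Proof.
pose C : R := 1 + \sum_i w (e i); have Cs i : w (e i) <= C.
  rewrite /C (bigD1 i)//= addrCA lerDl addr_ge0// sumr_ge0// => j _.
  exact: (abs_ge0 wabs).
have C0 : 0 < C by rewrite ltr_wpDr// sumr_ge0// => j _; exact: (abs_ge0 wabs).
exists C => // g r gr r0; apply: (abs_sum_le wabs) => [|i _].
  by rewrite mulr_ge0// ltW.
by rewrite (absM wabs) wk mulrC ler_pM// ?(abs_ge0 vabs) ?(abs_ge0 wabs).
Qed.

Hypothesis vcomplete : complete_abs v.

Section Family.
Variables (I : finType) (e : I -> E).

Let supp (S : {set I}) (g : I -> G) := forall i, i \notin S -> g i = 0.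

Let norm_bound (S : {set I}) (c : R) := forall g, supp S g ->
  forall i, c * v (g i) <= w (\sum_i k (g i) * e i).

(** By the norm bound, the coordinates of a sequence of combinations converging to [x] are Cauchy;
    their limits are coordinates of [x]. *)
Let span_closed (S : {set I}) c x : 0 < c -> norm_bound S c ->
  (forall r, 0 < r -> exists2 g, supp S g & w (x - \sum_i k (g i) * e i) < r) ->
  exists2 g, supp S g & x = \sum_i k (g i) * e i.
Proof.
move=> c0 hc hx.
have /choice[g hg] : forall n : nat, exists g, supp S g /\
    w (x - \sum_i k (g i) * e i) < n.+1%:R^-1.
  by move=> n; have [|g ? ?] := hx n.+1%:R^-1; [rewrite invr_gt0|exists g].
have lim i : exists l, (i \notin S -> l = 0) /\ forall r : R, 0 < r ->
    exists N : nat, forall n, (N <= n)%N -> v (g n i - l) < r.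
  have [iS|iS] := boolP (i \in S); last first.
    exists 0; split=> // r r0; exists 0%N => n _.
    by rewrite subr0 (hg n).1// (abs0 vabs).
  have [|l hl] := vcomplete (u := g^~ i); last by exists l.
  move=> r r0; have cr : 0 < c * r by rewrite mulr_gt0.
  exists (Num.truncn (c * r)^-1) => m n hm hn.
  have small p : (Num.truncn (c * r)^-1 <= p)%N ->
      w (x - \sum_i k (g p i) * e i) < c * r.
    move=> hp; apply: (lt_le_trans (hg p).2).
    rewrite -[leRHS]invrK lef_pV2 ?posrE ?invr_gt0//.
    by rewrite (le_trans (ltW (truncnS_gt _)))// ler_nat.
  rewrite -(ltr_pM2l c0).
  apply: (le_lt_trans (hc (fun i => g m i - g n i) _ i)).
    by move=> j jS; rewrite (hg m).1// (hg n).1// subrr.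
  have -> : \sum_j k (g m j - g n j) * e j =
     (x - \sum_j k (g n j) * e j) - (x - \sum_j k (g m j) * e j).
    rewrite opprB addrC addrA subrK -sumrB.
    by apply: eq_bigr => j _; rewrite rmorphB mulrBl.
  by apply: (absB_lt wabs); exact: small.
have [l hl] := choice lim; exists l; first by move=> i; exact: (hl i).1.
apply/eqP; rewrite -subr_eq0; apply/eqP/(abs_eq0 wabs)/eqP.
rewrite eq_le (abs_ge0 wabs) andbT; apply/ler_addgt0Pr => r r0; rewrite add0r.
have [C C0 hC] := abs_lincomb_le e.
have rC : 0 < r / C by rewrite divr_gt0.
have [N hN] : exists N : nat, forall n i, (N <= n)%N -> i \in enum I -> v (g n i - l i) < r / C.
  by apply: uniform_eventually => i _; exact: (hl i).2.
pose n := maxn N (Num.truncn r^-1).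
have -> : x - \sum_i k (l i) * e i =
    (x - \sum_i k (g n i) * e i) + \sum_i k (g n i - l i) * e i.
  rewrite -[LHS](subrKA (\sum_i k (g n i) * e i)); congr (_ + _); rewrite -sumrB.
  by apply: eq_bigr => j _; rewrite rmorphB mulrBl.
apply: (absD_le wabs).
  apply: ltW; apply: (lt_le_trans (hg n).2).
  rewrite -[leRHS]invrK lef_pV2 ?posrE ?invr_gt0//.
  by rewrite (le_trans (ltW (truncnS_gt _)))// ler_nat ltnS leq_maxr.
rewrite -[leRHS](divfK (lt0r_neq0 C0)) mulrC; apply: hC; last exact: ltW.
by move=> i; rewrite ltW// hN ?mem_enum ?leq_maxl.
Qed.

Hypothesis e_indep : lin_indep e.

(** Induction on [S]: by the induction hypothesis the span of [S] without [a] is closed, and e a is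
    not in it, so e a stays at some distance d > 0 from that span. This controls the coefficient at
    [a]; the other coefficients follow after subtracting the term at [a]. *)
Let norm_bound_exists (S : {set I}) : exists2 c, 0 < c & norm_bound S c.
Proof.
have [n] := ubnP #|S|; elim: n S => // n ih S Sn.
have [->|[a aS]] := set_0Vmem S.
  by exists 1 => // g g0 i; rewrite g0 ?inE// (abs0 vabs) mulr0 (abs_ge0 wabs).
have [|c c0 hc] := ih (S :\ a); first by move: Sn; rewrite (cardsD1 a S) aS.
have [d d0 hd] : exists2 d, 0 < d & forall g, supp (S :\ a) g ->
    d <= w (e a - \sum_i k (g i) * e i).
  apply: contrapT => nd; have [|g gS ea] := @span_closed (S :\ a) c (e a) c0 hc.
    move=> r r0; apply: contrapT => ng; apply: nd; exists r => // g gS.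
    by rewrite leNgt; apply/negP => lt; apply: ng; exists g.
  pose g' i := if i == a then -1 else g i.
  have /e_indep/(_ a) : \sum_i k (g' i) * e i = 0.
    rewrite (bigD1 a)//= /g' eqxx rmorphN1 mulN1r {1}ea (bigD1 a)//= gS ?inE ?eqxx//.
    rewrite rmorph0 mul0r add0r addrC; apply/eqP; rewrite subr_eq0; apply/eqP.
    by apply: eq_bigr => i /negbTE ->.
  by rewrite /g' eqxx => /eqP; rewrite oppr_eq0 oner_eq0.
have da g : supp S g -> d * v (g a) <= w (\sum_i k (g i) * e i).
  move=> gS; have [g0|g0] := eqVneq (g a) 0.
    by rewrite g0 (abs0 vabs) mulr0 (abs_ge0 wabs).
  have -> : \sum_i k (g i) * e i = k (g a) *
     (e a - \sum_i k (if i == a then 0 else - (g i / g a)) * e i).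
    rewrite (bigD1 a)//= mulrBr; congr (_ + _).
    rewrite [in RHS](bigD1 a)//= eqxx rmorph0 mul0r add0r mulr_sumr -sumrN.
    apply: eq_bigr => i /negbTE ->; rewrite mulrA -rmorphM mulrN mulrCA divff//.
    by rewrite mulr1 rmorphN mulNr opprK.
  rewrite (absM wabs) wk mulrC ler_wpM2l ?(abs_ge0 vabs)// hd// => i.
  rewrite !inE negb_and negbK; case: eqP => //= _ iS.
  by rewrite gS// mul0r oppr0.
(* Since d |g a| <= |s|, removing the term at [a] from the sum [s] leaves an element of absolute
   value at most M |s|. *)
pose M := Num.max 1 (w (e a) / d).
have M1 : 1 <= M by rewrite le_max lexx.
have M0 : 0 < M by rewrite (lt_le_trans _ M1).
exists (Num.min d (c / M)); first by rewrite lt_min d0 divr_gt0.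
move=> g gS i; set s := \sum_i _.
have [->|ia] := eqVneq i a.
  by apply: le_trans (da _ gS); rewrite ler_wpM2r ?(abs_ge0 vabs)// ge_min lexx.
rewrite (@le_trans _ _ (c / M * v (g i)))//.
  by rewrite ler_wpM2r ?(abs_ge0 vabs)// ge_min lexx orbT.
rewrite mulrAC ler_pdivrMr//.
have hg' : supp (S :\ a) (fun i => if i == a then 0 else g i).
  by move=> j; rewrite !inE negb_and negbK; case: eqP => //= _; exact: gS.
have := hc _ hg' i; rewrite (negbTE ia) => /le_trans; apply.
have -> : \sum_j k (if j == a then 0 else g j) * e j = s - k (g a) * e a.
  rewrite /s (bigD1 a)//= eqxx rmorph0 mul0r add0r [in RHS](bigD1 a)//= addrAC subrr add0r.
  by apply: eq_bigr => j /negbTE ->.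
apply: (absB_le wabs); first by rewrite ler_peMr ?(abs_ge0 wabs).
rewrite (absM wabs) wk (@le_trans _ _ (w s * (w (e a) / d)))//.
  rewrite [leRHS]mulrCA [leRHS]mulrC ler_wpM2r ?(abs_ge0 wabs)//.
  by rewrite ler_pdivlMr// mulrC da.
by rewrite ler_wpM2l ?(abs_ge0 wabs)// le_max lexx orbT.
Qed.

Lemma lin_indep_norm : exists2 c, 0 < c & forall g i,
  c * v (g i) <= w (\sum_i k (g i) * e i).
Proof.
have [c c0 h] := norm_bound_exists [set: I]; exists c => // g i.
by apply: h => j; rewrite inE.
Qed.

Lemma lin_indep_closed x :
  (forall r, 0 < r -> exists g, w (x - \sum_i k (g i) * e i) < r) ->
  exists g, x = \sum_i k (g i) * e i.
Proof.
move=> hx; have [c c0 hc] := norm_bound_exists [set: I].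
have [|g _ ->] := span_closed (x := x) c0 hc; last by exists g.
by move=> r /hx[g hg]; exists g => // j; rewrite inE.
Qed.

End Family.
End FiniteDimNorm.

Lemma exp_sandwich (R : realType) (c y : R) : 1 < c -> 0 < y ->
  exists m : int, c ^ m <= y < c ^ (m + 1).
Proof.
move=> c1 y0; have c0 : 0 < c by rewrite (lt_trans _ c1).
have lc : 0 < ln c by rewrite ln_gt0.
exists (Num.floor (ln y / ln c)).
have e m : c ^ m = expR (m%:~R * ln c).
  by rewrite -powR_intmul ?ltW// /powR gt_eqF.
rewrite !e -[X in _ <= X < _](lnK (x := y)) ?posrE// ler_expR ltr_expR.
by rewrite -ler_pdivlMr// -ltr_pdivrMr// floor_le floorD1_gt.
Qed.

(** * Separating absolute values that agree at a large element *)

Section PowerComparison.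
Variables (R : realType) (E : fieldType) (w w' : E -> R).
Hypothesis wabs : nontrivial_nonarch_abs w.
Hypothesis w'abs : nontrivial_nonarch_abs w'.
Variable z : E.
Hypothesis z1 : 1 < w z.
Hypothesis zz : w z = w' z.

(** For [k] large the gap between |x^k|_w and |x^k|_w' exceeds the factor |z|, so some power z^(m+1)
    has absolute value strictly in between; divide x^k by it. *)
Let separate_lt x : w x < w' x -> x != 0 -> exists a, w a < 1 /\ 1 < w' a.
Proof.
move=> lt x0; have wx0 : 0 < w x by exact: abs_gt0.
have zp : 0 < w z by rewrite (lt_trans _ z1).
have [k] : exists k : nat, w z * w x ^+ k < w' x ^+ k.
  have [|||N h] := @exprn_lt _ (w x / w' x) (w z)^-1.
  - by rewrite divr_ge0 ?(abs_ge0 wabs) ?(abs_ge0 w'abs).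
  - by rewrite ltr_pdivrMr ?mul1r// abs_gt0.
  - by rewrite invr_gt0.
  exists N; have := h N (leqnn N); rewrite expr_div_n ltr_pdivrMr ?exprn_gt0 ?abs_gt0//.
  by rewrite mulrC ltr_pdivlMr// mulrC.
have [m /andP[m1 m2]] := exp_sandwich z1 (exprn_gt0 k wx0).
move=> hk; have zm : 0 < w z ^ (m + 1) by exact: exprz_gt0.
exists (x ^+ k / z ^ (m + 1)); rewrite (abs_div wabs) (abs_div w'abs).
rewrite (absX wabs) (absX w'abs) (absXz wabs) (absXz w'abs) -zz ltr_pdivrMr// ltr_pdivlMr// !mul1r; split=> //.
apply: le_lt_trans hk; rewrite addrC expfzDr ?gt_eqF// expr1z.
by rewrite ler_wpM2l// ltW.
Qed.

Lemma abs_separate : w <> w' -> exists a, w a < 1 /\ 1 < w' a.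
Proof.
move=> ww; have [x hx] : exists x, w x != w' x.
  apply: contrapT => nx; apply: ww; apply/funext => x; apply/eqP.
  by apply: contrapT => h; apply: nx; exists x; apply/negP.
have x0 : x != 0 by apply: contra_neq hx => ->; rewrite !abs0.
have [lt|gt|eq] := ltgtP (w x) (w' x); [exact: separate_lt lt x0| |by rewrite eq eqxx in hx].
apply: (@separate_lt x^-1); rewrite ?invr_eq0// !absV//.
by rewrite ltf_pV2// posrE abs_gt0.
Qed.

End PowerComparison.

Lemma card_lin_indep_le (G : fieldType) (E : fieldExtType G) (J : finType) (e : J -> E) :
  lin_indep (in_alg E) e -> (#|J| <= \dim {:E})%N.
Proof.
move=> he; pose X := [tuple e (enum_val i) | i < #|J|].
have XE (i : 'I_#|J|) : X`_i = e (enum_val i) by rewrite -tnth_nth tnth_mktuple.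
have /freeP fX : forall k : 'I_#|J| -> G, \sum_i k i *: X`_i = 0 -> forall i, k i = 0.
  move=> k hk i; have := he (fun j => k (enum_rank j)) _ (enum_val i).
  rewrite enum_valK; apply; rewrite -[RHS]hk [RHS](reindex enum_rank).
    by apply: eq_bigr => j _; rewrite XE enum_rankK mulr_algl.
  by apply: onW_bij; exact: enum_rank_bij.
have := dimvS (subvf <<X>>%VS); move: fX; rewrite /free => /eqP ->.
by rewrite size_tuple.
Qed.

Lemma lin_indep_vbasis (G : fieldType) (E : fieldExtType G) :
  lin_indep (in_alg E) (fun i : 'I_(\dim {:E}) => (vbasis {:E})`_i).
Proof.
move=> g; have /freeP h := basis_free (vbasisP {:E}) => hg; apply: h.
by rewrite -[RHS]hg; apply: eq_bigr => i _; rewrite mulr_algl.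
Qed.

Lemma is_completion_abs (R : realType) (L Lv : fieldType) (v : L -> R) (vv : Lv -> R)
  (i : {rmorphism L -> Lv}) : is_completion v vv i -> v 0 = 0.
Proof. by move=> C; rewrite -(completion_isometry C) rmorph0 (abs0 (completion_abs C)). Qed.

(** * Local degrees above a common place *)

Section LocalDegree.
Variables (R : realType) (G : fieldType) (E : fieldExtType G).

(** The [y l] approximate a basis of the completion, so their [G]-combinations are dense for [w].
    The lower bound holds for every [y'] near [y] because [sum_local_degree_le] approximates such
    bases at several places by common elements of [E]. *)
Lemma local_basis (w : E -> R) n : is_local_degree w n ->
  exists (c d : R) (y : 'I_n -> E), [/\ 0 < c, 0 < d,
    forall y', (forall l, w (y' l - y l) < d) ->
      forall (g : 'I_n -> G) l, c * below w (g l) <= w (\sum_l in_alg E (g l) * y' l) &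
    forall x r, 0 < r -> exists g : 'I_n -> G, w (x - \sum_l in_alg E (g l) * y l) < r].
Proof.
move=> [Gv [vv [i [Ew [ww [j [Cv Cw wv jG nE]]]]]]].
have vabs := completion_abs Cv; have wabs := completion_abs Cw; subst n.
pose e (l : 'I_(\dim {:Ew})) := (vbasis {:Ew})`_l.
have ei : lin_indep (in_alg Ew) e by exact: lin_indep_vbasis.
have [c c0 hc] := lin_indep_norm vabs wabs wv (completion_complete Cv) ei.
have c20 : 0 < c / 2 by rewrite divr_gt0.
have [y hy] := choice (fun l => completion_dense Cw (e l) c20).
have key y' : (forall l, w (y' l - y l) < c / 2) -> forall (g : 'I_(\dim {:Ew}) -> Gv) l,
    c * vv (g l) <= ww (\sum_l in_alg Ew (g l) * j (y' l)).
  (* Passing from the basis [e] to [y'] changes the sum by at most c/2 times the largest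
     coefficient, which is less than the lower bound known for [e]. *)
  move=> hy' g l; pose l0 := [arg max_(l0 > l) vv (g l0)]%O.
  have gl0 l1 : vv (g l1) <= vv (g l0) by rewrite /l0; case: arg_maxP => // l2 _; apply.
  have -> : \sum_l in_alg Ew (g l) * j (y' l) =
      \sum_l in_alg Ew (g l) * e l + \sum_l in_alg Ew (g l) * (j (y' l) - e l).
    rewrite -big_split; apply: eq_bigr => l1 _ /=.
    by rewrite -mulrDr (addrC (e l1)) subrK.
  have [g0|g0] := eqVneq (vv (g l0)) 0.
    have -> : vv (g l) = 0 by apply/eqP; rewrite eq_le -{1}g0 gl0 (abs_ge0 vabs).
    by rewrite mulr0 (abs_ge0 wabs).
  have gp : 0 < vv (g l0) by rewrite lt_neqAle eq_sym g0 (abs_ge0 vabs).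
  rewrite (absD_eq wabs); first by rewrite (le_trans _ (hc g l0))// ler_wpM2l// ltW.
  apply: lt_le_trans (hc g l0); apply: (abs_sum_lt wabs); first by rewrite mulr_gt0.
  move=> l1 _; rewrite (absM wabs) wv mulrC.
  rewrite (@le_lt_trans _ _ ((c / 2) * vv (g l0)))//.
    rewrite ler_pM ?(abs_ge0 wabs) ?(abs_ge0 vabs)//.
    rewrite ltW//; have -> : j (y' l1) - e l1 = j (y' l1 - y l1) + (j (y l1) - e l1).
      by rewrite rmorphB subrKA.
    apply: (absD_lt wabs); first by rewrite (completion_isometry Cw) hy'.
    by rewrite (absBC wabs) hy.
  by rewrite ltr_pM2r// ltr_pdivrMr// mulr_natr mulr2n ltrDl.
have jsum (g : 'I_(\dim {:Ew}) -> G) y' :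
    j (\sum_l in_alg E (g l) * y' l) = \sum_l in_alg Ew (i (g l)) * j (y' l).
  by rewrite rmorph_sum; apply: eq_bigr => l _; rewrite rmorphM jG.
exists c, (c / 2), y; split=> // [y' hy' g l|x r r0].
  rewrite -(completion_isometry Cw) -(completion_isometry Cv) jsum.
  exact: (key y' hy' (fun l => i (g l))).
(* The bound [key] makes the images of the [y l] independent, hence a basis; the coordinates of [x]
   in it are then approximated from [G]. *)
have fX : free [tuple j (y l) | l < \dim {:Ew}].
  apply/freeP => g hg l; apply: (abs_eq0 vabs _).1; apply/eqP.
  rewrite eq_le (abs_ge0 vabs) andbT -(ler_pM2l c0) mulr0.
  apply: le_trans (key y _ g l) _ => [l1|]; first by rewrite subrr (is_completion_abs Cw).
  rewrite (_ : \sum_l _ = 0) ?(abs0 wabs)// -[RHS]hg.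
  by apply: eq_bigr => l1 _; rewrite -tnth_nth tnth_mktuple mulr_algl.
have bX : basis_of {:Ew} [tuple j (y l) | l < \dim {:Ew}].
  by rewrite basisEfree fX subvf size_tuple leqnn.
pose g l := coord [tuple j (y l) | l < \dim {:Ew}] l (j x).
have jx : j x = \sum_l in_alg Ew (g l) * j (y l).
  rewrite {1}(coord_basis bX (memvf (j x))); apply: eq_bigr => l _.
  by rewrite -tnth_nth tnth_mktuple mulr_algl.
have [C C0 hC] := abs_lincomb_le vabs wabs wv (fun l => j (y l)).
have rC : 0 < r / 2 / C by rewrite !divr_gt0.
have [h hh] := choice (fun l => completion_dense Cv (g l) rC).
exists h; rewrite -(completion_isometry Cw) rmorphB jsum jx -sumrB.
apply: (@le_lt_trans _ _ (r / 2)); last by rewrite ltr_pdivrMr// mulr_natr mulr2n ltrDl.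
rewrite -[leRHS](divfK (lt0r_neq0 C0)) [leRHS]mulrC.
rewrite (_ : \sum_l _ = \sum_l in_alg Ew (g l - i (h l)) * j (y l)).
  by apply: hC => [l|]; exact: ltW.
by apply: eq_bigr => l _; rewrite rmorphB mulrBl.
Qed.

(** Weak approximation gives elements Y (i, l) of [E] that are close to a local basis at [w i] and
    close to 0 at the other places. They are independent over [G]. *)
Lemma sum_local_degree_le (I : finType) (w : I -> E -> R) (v : G -> R) (n : I -> nat) :
  nontrivial_nonarch_abs v -> (forall i, nontrivial_nonarch_abs (w i)) ->
  (forall i, below (w i) = v) -> injective w ->
  (forall i, is_local_degree (w i) (n i)) -> (\sum_i n i <= \dim {:E})%N.
Proof.
move=> vabs wabs wv winj hn.
have incomp i j : i != j -> exists a, w i a < 1 /\ 1 < w j a.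
  move=> ij; have [z z1] := exists_abs_gt1 vabs.
  have zi l : w l (in_alg E z) = v z by rewrite -(wv l).
  by apply: (@abs_separate _ _ (w i) (w j) _ _ (in_alg E z)); rewrite ?zi// => /winj /eqP; apply/negP.
have hb i : exists b : R * R * ('I_(n i) -> E), [/\ 0 < b.1.1, 0 < b.1.2 &
    forall y', (forall l, w i (y' l - b.2 l) < b.1.2) ->
      forall (g : 'I_(n i) -> G) l, b.1.1 * v (g l) <= w i (\sum_l in_alg E (g l) * y' l)].
  have [c [d [y [c0 d0 h _]]]] := local_basis (hn i).
  by exists (c, d, y); split=> //= y' /h; rewrite wv.
have [b hb'] : {b : forall i, R * R * ('I_(n i) -> E) & forall i, [/\ 0 < (b i).1.1, 0 < (b i).1.2 &
    forall y', (forall l, w i (y' l - (b i).2 l) < (b i).1.2) ->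
      forall (g : 'I_(n i) -> G) l, (b i).1.1 * v (g l) <= w i (\sum_l in_alg E (g l) * y' l)]}.
  exists (fun i => projT1 (cid (hb i))) => i; exact: projT2 (cid (hb i)).
have [e e0 he] : exists2 e : R, 0 < e & forall i, e <= (b i).1.1 /\ e <= (b i).1.2.
  exists (\big[Num.min/1]_i Num.min (b i).1.1 (b i).1.2).
    elim/big_ind: _ => // [x y|i _]; first by rewrite lt_min => -> ->.
    by have [h1 h2 _] := hb' i; rewrite lt_min h1.
  move=> i; rewrite (bigD1 i)//=; split.
    by rewrite !ge_min lexx.
  by rewrite !ge_min lexx orbT.
pose J : finType := {i : I & 'I_(n i)}.
pose mk i (l : 'I_(n i)) : J := existT (fun i => 'I_(n i)) i l.
have /choice[Y hY] : forall p : J, exists y, forall i : I,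
    w i (y - (if i == tag p then (b (tag p)).2 (tagged p) else 0)) < e.
  by move=> p; exact: weak_approximation.
have <- : #|J| = (\sum_i n i)%N.
  by rewrite card_tagged sumnE big_map big_enum; apply: eq_bigr => i _; rewrite card_ord.
apply: (card_lin_indep_le (e := Y)) => g hg p1.
apply: contrapT => /eqP gp1.
(* At the place belonging to the largest coefficient, the terms of that place have a sum too large
   to be cancelled by the small terms of the others. *)
pose p := [arg max_(p > p1) v (g p)]%O.
have gp p2 : v (g p2) <= v (g p).
  by rewrite /p; case: arg_maxP => // p3 _; apply.
have gp0 : 0 < v (g p) by rewrite (lt_le_trans _ (gp p1))// abs_gt0.
case: p gp gp0 => i l gp gp0.
have [b1 b2 h] := hb' i.
have [e1 e2] := he i.
have : (b i).1.1 * v (g (mk i l)) <= w i (\sum_l in_alg E (g (mk i l)) * Y (mk i l)).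
  apply: (h (fun l => Y (mk i l)) _ (fun l => g (mk i l))) => l1.
  by have := hY (mk i l1) i; rewrite /= eqxx => /lt_le_trans; apply.
have swap : \sum_p in_alg E (g p) * Y p =
    \sum_i' \sum_l' in_alg E (g (mk i' l')) * Y (mk i' l').
  by rewrite sig_big_dep; apply: eq_bigr => -[].
move: hg; rewrite swap (bigD1 i)//= => /eqP; rewrite addr_eq0 => /eqP ->.
rewrite (absN (wabs i)) leNgt => /negP; apply.
have bM : 0 < (b i).1.1 * v (g (mk i l)) by rewrite mulr_gt0.
apply: (abs_sum_lt (wabs i)) => // i' ii'; apply: (abs_sum_lt (wabs i)) => // l' _.
rewrite (absM (wabs i)) [ltRHS]mulrC.
have -> : w i (in_alg E (g (mk i' l'))) = v (g (mk i' l')) by rewrite -(wv i).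
apply: (@le_lt_trans _ _ (v (g (mk i l)) * w i (Y (mk i' l')))).
  by rewrite ler_wpM2r// (abs_ge0 (wabs i)).
rewrite ltr_pM2l// (lt_le_trans _ e1)//.
by have := hY (mk i' l') i; rewrite /= eq_sym (negbTE ii') subr0.
Qed.
End LocalDegree.

(** * Completions and local degrees *)

Section FieldExtOf.
Variables (G E : fieldType) (k : {rmorphism G -> E}) (n : nat) (b : 'I_n -> E).
Hypothesis b_indep : lin_indep k b.
Hypothesis b_span : forall x, exists g : 'I_n -> G, x = \sum_i k (g i) * b i.

(** A copy of [E] whose type remembers [k] and the basis, so that a structure of finite field
    extension of [G] can be attached to it. *)
Definition ext_of of lin_indep k b & (forall x, exists g : 'I_n -> G, x = \sum_i k (g i) * b i) : Type := E.

Local Notation X := (ext_of b_indep b_span).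

HB.instance Definition _ := GRing.Field.on X.

Definition ext_scale (a : G) (u : X) : X := (k a : X) * u.

Lemma ext_scaleA a c u : ext_scale a (ext_scale c u) = ext_scale (a * c) u.
Proof. by rewrite /ext_scale mulrA rmorphM. Qed.
Lemma ext_scale1 u : ext_scale 1 u = u.
Proof. by rewrite /ext_scale rmorph1 mul1r. Qed.
Lemma ext_scaleDr a u v : ext_scale a (u + v) = ext_scale a u + ext_scale a v.
Proof. exact: mulrDr. Qed.
Lemma ext_scaleDl v a c : ext_scale (a + c) v = ext_scale a v + ext_scale c v.
Proof. by rewrite /ext_scale rmorphD mulrDl. Qed.

HB.instance Definition _ := GRing.Zmodule_isLmodule.Build G X
  ext_scaleA ext_scale1 ext_scaleDr ext_scaleDl.

Lemma ext_scaleAl (a : G) (u v : X) : a *: (u * v) = (a *: u) * v.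
Proof. exact: mulrA. Qed.

HB.instance Definition _ := GRing.Lmodule_isLalgebra.Build G X ext_scaleAl.

Lemma ext_scaleAr (a : G) (u v : X) : a *: (u * v) = u * (a *: v).
Proof. exact: mulrCA. Qed.

HB.instance Definition _ := GRing.Lalgebra_isAlgebra.Build G X ext_scaleAr.

Lemma ext_vect_axiom : Vector.axiom n X.
Proof.
pose r (g : 'rV[G]_n) : X := \sum_i k (g 0 i) * b i.
have rinj : injective r.
  move=> g h gh; apply/rowP => i; apply/eqP; rewrite -subr_eq0; apply/eqP.
  apply: (b_indep (g := fun i => g 0 i - h 0 i)).
  transitivity (r g - r h); last by rewrite gh subrr.
  by rewrite -sumrB; apply: eq_bigr => j _; rewrite rmorphB mulrBl.
have rP (x : X) : exists g, r g = x.
  have [g ->] := b_span x; exists (\row_i g i).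
  by apply: eq_bigr => i _; rewrite mxE.
have [c hc] := choice rP; exists c; last by exists r => // g; apply: rinj; rewrite hc.
move=> a u v; apply: rinj; rewrite hc -{1}(hc u) -{1}(hc v) /r.
rewrite [_ *: _]mulr_sumr -big_split; apply: eq_bigr => i _ /=.
by rewrite !mxE rmorphD rmorphM mulrDl mulrA.
Qed.

HB.instance Definition _ := Lmodule_hasFinDim.Build G X ext_vect_axiom.

Lemma exists_fieldext : exists (Y : fieldExtType G) (h : {rmorphism E -> Y}),
  (forall a, h (k a) = in_alg Y a) /\ forall y, exists x, h x = y.
Proof.
exists (X : fieldExtType G), (idfun : {rmorphism E -> E}); split=> [a|y]; last by exists y.
by rewrite in_algE /=; apply: esym; exact: mulr1.
Qed.

End FieldExtOf.

(** * Completion as Cauchy sequences modulo null sequences *)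

Section Completion.
Variables (R : realType) (E : fieldType) (w : E -> R).
Hypothesis wabs : nontrivial_nonarch_abs w.

Definition cauchy (u : nat -> E) := forall e : R, 0 < e -> exists N : nat,
  forall m n : nat, (N <= m)%N -> (N <= n)%N -> w (u m - u n) < e.

Definition null (u : nat -> E) := forall e : R, 0 < e -> exists N : nat,
  forall n : nat, (N <= n)%N -> w (u n) < e.

Lemma cauchy_bounded u : cauchy u -> exists2 B, 0 < B & forall n, w (u n) <= B.
Proof.
move=> /(_ 1 ltr01) [N hN]; pose B : R := 1 + \sum_(i < N.+1) w (u i).
have B1 : 1 <= B by rewrite lerDl sumr_ge0// => i _; exact: (abs_ge0 wabs).
have small n : (n <= N)%N -> w (u n) <= B.
  move=> nN; rewrite /B (bigD1 (Ordinal (nN : (n < N.+1)%N)))//= addrCA lerDl.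
  by rewrite addr_ge0// sumr_ge0// => i _; exact: (abs_ge0 wabs).
exists B; first by rewrite (lt_le_trans _ B1).
move=> n; have [|Nn] := leqP n N; first exact: small.
rewrite -[u n](subrK (u N)); apply: (absD_le wabs); last exact: small.
by rewrite ltW// (lt_le_trans _ B1)// hN// ltnW.
Qed.

Definition cauchy_seq : {pred nat -> E} := fun u => `[< cauchy u >].

Lemma cauchy_seq_closed : subring_closed cauchy_seq.
Proof.
split.
- by apply/asboolP => e e0; exists 0%N => m n _ _; rewrite subrr (abs0 wabs).
- move=> u u' /asboolP hu /asboolP hu'; apply/asboolP => e e0.
  have [N h] := hu _ e0; have [N' h'] := hu' _ e0; exists (maxn N N') => m n.
  rewrite !geq_max => /andP[m1 m2] /andP[n1 n2].
  have -> : (u - u') m - (u - u') n = (u m - u n) - (u' m - u' n) by rewrite /= !fctE; ring.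
  by apply: (absB_lt wabs); [exact: h|exact: h'].
- move=> u u' /asboolP hu /asboolP hu'; apply/asboolP => e e0.
  have [B B0 hB] := cauchy_bounded hu; have [B' B'0 hB'] := cauchy_bounded hu'.
  have [|N h] := hu (e / B'); first by rewrite divr_gt0.
  have [|N' h'] := hu' (e / B); first by rewrite divr_gt0.
  exists (maxn N N') => m n; rewrite !geq_max => /andP[m1 m2] /andP[n1 n2].
  have -> : (u * u') m - (u * u') n = (u m - u n) * u' m + u n * (u' m - u' n).
    by rewrite /= !fctE; ring.
  apply: (absD_lt wabs); rewrite (absM wabs).
    apply: (@le_lt_trans _ _ (w (u m - u n) * B')); last by rewrite -ltr_pdivlMr// h.
    by rewrite ler_wpM2l// (abs_ge0 wabs).
  apply: (@le_lt_trans _ _ (B * w (u' m - u' n))).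
    by rewrite ler_wpM2r// (abs_ge0 wabs).
  by rewrite mulrC -ltr_pdivlMr// h'.
Qed.

HB.instance Definition _ := GRing.isSubringClosed.Build (nat -> E) cauchy_seq cauchy_seq_closed.

Record cseq := CSeq { cseq_val :> nat -> E; cseq_valP : cseq_val \in cauchy_seq }.

HB.instance Definition _ := [isSub for cseq_val].
HB.instance Definition _ := [Choice of cseq by <:].
HB.instance Definition _ := [SubChoice_isSubComNzRing of cseq by <:].

Definition null_seq : {pred cseq} := fun u => `[< null u >].

Lemma null_seq_closed : idealr_closed null_seq.
Proof.
split.
- by apply/asboolP => e e0; exists 0%N => n _; rewrite (abs0 wabs).
- apply/negP => /asboolP /(_ 1 ltr01) [N /(_ N (leqnn N))].
  by rewrite (_ : _ N = 1)// (abs1 wabs) ltxx.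
- move=> a u v /asboolP hu /asboolP hv; apply/asboolP => e e0.
  have /asboolP ca := cseq_valP a; have [B B0 hB] := cauchy_bounded ca.
  have [|N h] := hu (e / B); first by rewrite divr_gt0.
  have [N' h'] := hv _ e0; exists (maxn N N') => n; rewrite geq_max => /andP[n1 n2].
  rewrite (_ : _ n = a n * u n + v n)//; apply: (absD_lt wabs); last exact: h'.
  rewrite (absM wabs); apply: (@le_lt_trans _ _ (B * w (u n))).
    by rewrite ler_wpM2r// (abs_ge0 wabs).
  by rewrite mulrC -ltr_pdivlMr// h.
Qed.

HB.instance Definition _ := isIdealr.Build cseq null_seq null_seq_closed.

Definition completion : Type := {ideal_quot null_seq}.

HB.instance Definition _ := GRing.ComNzRing.on completion.

Definition cpi : {rmorphism cseq -> completion} := \pi_({ideal_quot null_seq})%qT.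

Lemma cpi_surj x : exists u, cpi u = x.
Proof. by exists (repr x); exact: reprK. Qed.

Lemma cpi_eq0 u : cpi u = 0 <-> null u.
Proof.
rewrite -(rmorph0 cpi); split.
  by move=> /eqP; rewrite -Quotient.idealrBE subr0 => /asboolP.
by move=> /asboolP h; apply/eqP; rewrite -Quotient.idealrBE subr0.
Qed.

Lemma cseqP (u : cseq) : cauchy u.
Proof. exact/asboolP/cseq_valP. Qed.

(** Once the terms differ by less than [e] and one of them has absolute value at least [e], the
    ultrametric inequality makes all later absolute values equal. So the extended absolute value
    needs no limit. *)
Lemma cauchy_eventually_const u : cauchy u -> ~ null u ->
  exists r : R, 0 < r /\ exists N : nat, forall n, (N <= n)%N -> w (u n) = r.
Proof.
move=> cu nu; have [e [e0 he]] : exists e : R, 0 < e /\ forall N : nat, exists2 n, (N <= n)%N & e <= w (u n).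
  apply: contrapT => ne; apply: nu => e e0; apply: contrapT => nN; apply: ne; exists e; split=> // N.
  apply: contrapT => nn; apply: nN; exists N => n Nn; rewrite ltNge; apply/negP => h.
  by apply: nn; exists n.
have [N hN] := cu e e0; have [n0 Nn0 hn0] := he N.
exists (w (u n0)); split; first exact: lt_le_trans hn0.
exists N => n Nn; rewrite -[u n](subrK (u n0)) addrC (absD_eq wabs)//.
exact: lt_le_trans (hN _ _ Nn Nn0) hn0.
Qed.

Definition cconst (a : E) : cseq.
Proof.
exists (fun=> a); apply/asboolP => e e0; exists 0%N => m n _ _.
by rewrite subrr (abs0 wabs).
Defined.

Lemma completion_inverse (x : completion) : x != 0 -> exists y, y * x = 1.
Proof.
have [u <-] := cpi_surj x => /eqP ux.
have [|r [r0 [N hN]]] := cauchy_eventually_const (cseqP u); first by move=> /cpi_eq0.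
have u0 n : (N <= n)%N -> u n != 0.
  by move=> Nn; apply: (abs_neq0 wabs); rewrite hN.
have cv : cauchy (fun n => (u n)^-1).
  move=> e e0; have [|N' hN'] := cseqP u (e := e * r ^+ 2); first by rewrite mulr_gt0 ?exprn_gt0.
  exists (maxn N N') => m n; rewrite !geq_max => /andP[m1 m2] /andP[n1 n2].
  have -> : (u m)^-1 - (u n)^-1 = (u n - u m) / (u m * u n).
    by field; rewrite !u0.
  rewrite (abs_div wabs) (absM wabs) !hN// ltr_pdivrMr ?mulr_gt0// -expr2.
  exact: hN'.
have cv' : (fun n => (u n)^-1) \in cauchy_seq by exact/asboolP.
exists (cpi (CSeq cv')); rewrite -rmorphM -(rmorph1 cpi); apply/eqP.
rewrite -subr_eq0 -rmorphB; apply/eqP/cpi_eq0 => e e0; exists N => n Nn.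
by rewrite (_ : _ n = (u n)^-1 * u n - 1)// mulVf ?u0// subrr (abs0 wabs).
Qed.

Definition completion_inv (x : completion) : completion :=
  if x == 0 then 0 else xget 0 [set y | y * x = 1].

Lemma completion_mulVf x : x != 0 -> completion_inv x * x = 1.
Proof.
move=> x0; rewrite /completion_inv (negbTE x0); case: xgetP => // h.
by have [y hy] := completion_inverse x0; have := h y.
Qed.

Lemma completion_inv0 : completion_inv 0 = 0.
Proof. by rewrite /completion_inv eqxx. Qed.

HB.instance Definition _ := GRing.ComNzRing_isField.Build completion
  completion_mulVf completion_inv0.

(** The eventual value of |u n| on a representative [u]; [cabsE] shows that it exists and does not
    depend on [u]. *)
Definition cabs (x : completion) : R :=
  if x == 0 then 0 else xget 0 [set r | exists u : cseq, cpi u = x /\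
    exists N : nat, forall n, (N <= n)%N -> w (u n) = r].

Lemma cabsE (u : cseq) : cpi u != 0 -> 0 < cabs (cpi u) /\
  exists N : nat, forall n, (N <= n)%N -> w (u n) = cabs (cpi u).
Proof.
move=> u0; have nu : ~ null u by move/cpi_eq0/eqP; apply/negP.
have [r [r0 [N hN]]] := cauchy_eventually_const (cseqP u) nu.
suff -> : cabs (cpi u) = r by split=> //; exists N.
rewrite /cabs (negbTE u0); case: xgetP => [s _ [u' [uu' [N' hN']]]|h]; last first.
  by exfalso; apply: (h r); exists u; split=> //; exists N.
have /cpi_eq0/(_ _ r0)[N2 hN2] : cpi (u' - u) = 0 by rewrite rmorphB uu' subrr.
pose n := maxn N (maxn N' N2).
rewrite -(hN' n) ?leq_max ?leqnn ?orbT// -(hN n) ?leq_max ?leqnn ?orbT//.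
rewrite -[u' n](subrK (u n)) addrC (absD_eq wabs)//.
by rewrite hN ?leq_maxl// hN2// !leq_max leqnn !orbT.
Qed.

Lemma cabs0 : cabs 0 = 0. Proof. by rewrite /cabs eqxx. Qed.

Lemma cabs_ge0 x : 0 <= cabs x.
Proof.
have [->|x0] := eqVneq x 0; first by rewrite cabs0.
by have [u ux] := cpi_surj x; move: x0; rewrite -ux => /cabsE[/ltW].
Qed.

(* Any bound valid for almost all terms of [u] is valid for its class. *)
Lemma cabs_le (u : cseq) r N : 0 <= r -> (forall n, (N <= n)%N -> w (u n) <= r) ->
  cabs (cpi u) <= r.
Proof.
move=> r0 hr; have [->|/cabsE[_ [N' hN']]] := eqVneq (cpi u) 0; first by rewrite cabs0.
by rewrite -(hN' (maxn N N')) ?leq_maxr// hr// leq_maxl.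
Qed.

Lemma cabs_ge (u : cseq) r : cabs (cpi u) < r ->
  exists N : nat, forall n, (N <= n)%N -> w (u n) < r.
Proof.
have [u0|/cabsE[u0 [N hN]] ur] := eqVneq (cpi u) 0; last by exists N => n /hN ->.
by rewrite u0 cabs0 => r0; exact: ((cpi_eq0 u).1 u0 r r0).
Qed.

Lemma cabs_const a : cabs (cpi (cconst a)) = w a.
Proof.
have [->|a0] := eqVneq a 0.
  have /cpi_eq0 -> : null (cconst 0) by move=> e e0; exists 0%N => n _; rewrite (abs0 wabs).
  by rewrite cabs0 (abs0 wabs).
have /cabsE[_ [N]] : cpi (cconst a) != 0; last by move=> /(_ N (leqnn N)) <-.
apply/eqP => /cpi_eq0 /(_ (w a)) [|N /(_ N (leqnn N))]; last by rewrite ltxx.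
exact: abs_gt0.
Qed.

Lemma cconst_zmod : zmod_morphism (cpi \o cconst).
Proof.
move=> a b; rewrite -[RHS](rmorphB cpi) -[LHS]/(cpi _).
by congr (cpi _); apply: val_inj.
Qed.

Lemma cconst_monoid : monoid_morphism (cpi \o cconst).
Proof.
split=> [|a b]; rewrite -[LHS]/(cpi _).
  by rewrite -[RHS](rmorph1 cpi); congr (cpi _); apply: val_inj.
by rewrite -[RHS](rmorphM cpi); congr (cpi _); apply: val_inj.
Qed.

Definition cinj := cpi \o cconst.
HB.instance Definition _ := GRing.isZmodMorphism.Build E completion cinj cconst_zmod.
HB.instance Definition _ := GRing.isMonoidMorphism.Build E completion cinj cconst_monoid.

Lemma cabs_abs : nontrivial_nonarch_abs cabs.
Proof.
split.
- exact: cabs_ge0.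
- move=> x; split=> [h|->]; last exact: cabs0.
  apply/eqP/negPn/negP => x0; have [u ux] := cpi_surj x.
  by move: x0 h; rewrite -ux => /cabsE[/lt0r_neq0/eqP].
- move=> x y; have [->|x0] := eqVneq x 0; first by rewrite mul0r cabs0 mul0r.
  have [->|y0] := eqVneq y 0; first by rewrite mulr0 cabs0 mulr0.
  have := mulf_neq0 x0 y0; have [u ux] := cpi_surj x; have [u' uy] := cpi_surj y.
  move: x0 y0; rewrite -ux -uy => /cabsE[_ [N hN]] /cabsE[_ [N' hN']].
  rewrite -rmorphM => /cabsE[_ [N2 hN2]].
  pose n := maxn N (maxn N' N2).
  rewrite -(hN2 n) ?leq_max ?leqnn ?orbT// -(hN n) ?leq_max ?leqnn ?orbT//.
  by rewrite -(hN' n) ?leq_max ?leqnn ?orbT// -(absM wabs).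
- move=> x y; have [u <-] := cpi_surj x; have [u' <-] := cpi_surj y.
  rewrite -rmorphD; apply/ler_addgt0Pr => e e0.
  have [|N hN] := @cabs_ge u (Num.max (cabs (cpi u)) (cabs (cpi u')) + e).
    by rewrite ltr_pwDr// le_max lexx.
  have [|N' hN'] := @cabs_ge u' (Num.max (cabs (cpi u)) (cabs (cpi u')) + e).
    by rewrite ltr_pwDr// le_max lexx orbT.
  apply: (@cabs_le _ _ (maxn N N')) => [|n].
    by rewrite addr_ge0 ?(ltW e0)// le_max cabs_ge0.
  by rewrite geq_max => /andP[/hN n1 /hN' n2]; apply: (absD_le wabs); exact: ltW.
- have [a a0 a1] := abs_nontrivial wabs; exists (cinj a); first by rewrite fmorph_eq0.
  by rewrite /cinj /= cabs_const.
Qed.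

Lemma cabs_dense (y : completion) (e : R) : 0 < e -> exists a, cabs (y - cinj a) < e.
Proof.
move=> e0; have [u <-] := cpi_surj y; have e2 : 0 < e / 2 by rewrite divr_gt0.
have [N hN] := cseqP u e2; exists (u N); apply: (@le_lt_trans _ _ (e / 2)).
  rewrite -rmorphB; apply: (@cabs_le _ _ N); first exact: ltW.
  by move=> n Nn; rewrite ltW// hN.
by rewrite ltr_pdivrMr// mulr_natr mulr2n ltrDl.
Qed.

(** Replace x n by a constant a n within 1/(n+1). The sequence [a] is Cauchy in [E], and its class
    is the limit. *)
Lemma cabs_complete : complete_abs cabs.
Proof.
move=> x cx; have inv0 (n : nat) : 0 < n.+1%:R^-1 :> R by rewrite invr_gt0.
have [a ha] := choice (fun n => cabs_dense (x n) (inv0 n)).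
have small e : 0 < e -> exists N : nat, forall n, (N <= n)%N -> cabs (x n - cinj (a n)) < e.
  move=> e0; exists (Num.truncn e^-1) => n hn; apply: (lt_le_trans (ha n)).
  rewrite -[leRHS]invrK lef_pV2 ?posrE ?invr_gt0//.
  by rewrite (le_trans (ltW (truncnS_gt _)))// ler_nat.
have ca : cauchy a.
  move=> e e0; have [N hN] := cx e e0; have [N' hN'] := small e e0.
  exists (maxn N N') => m n; rewrite !geq_max => /andP[m1 m2] /andP[n1 n2].
  rewrite -cabs_const -[cpi _]/(cinj _) rmorphB.
  have -> : cinj (a m) - cinj (a n) =
    (x m - x n) + ((x n - cinj (a n)) - (x m - cinj (a m))) by ring.
  apply: (absD_lt cabs_abs); first exact: hN.
  by apply: (absB_lt cabs_abs); exact: hN'.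
have ca' : a \in cauchy_seq by exact/asboolP.
exists (cpi (CSeq ca')) => e e0; have e2 : 0 < e / 2 by rewrite divr_gt0.
have [N hN] := small e e0; have [N' hN'] := ca _ e2.
exists (maxn N N') => n; rewrite geq_max => /andP[n1 n2].
rewrite -[X in X - _](subrK (cinj (a n))) -addrA; apply: (absD_lt cabs_abs); first exact: hN.
apply: (@le_lt_trans _ _ (e / 2)); last by rewrite ltr_pdivrMr// mulr_natr mulr2n ltrDl.
rewrite -[X in cabs X](rmorphB cpi (cconst (a n)) (CSeq ca')).
apply: (@cabs_le _ _ N'); first exact: ltW.
by move=> m hm; rewrite ltW// hN'.
Qed.

Lemma exists_completion : exists (Ew : fieldType) (ww : Ew -> R) (j : {rmorphism E -> Ew}),
  is_completion w ww j.
Proof.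
exists completion, cabs, cinj; split; [exact: cabs_abs|exact: cabs_const|exact: cabs_dense|exact: cabs_complete].
Qed.

End Completion.

(** * Closure of a subfield in a complete field *)

Section ClosedSubfield.
Variables (R : realType) (G E : fieldType) (w : E -> R) (i : {rmorphism G -> E}).
Hypothesis wabs : nontrivial_nonarch_abs w.
Hypothesis wcomplete : complete_abs w.
Hypothesis inontriv : exists2 a, a != 0 & w (i a) != 1.

Definition adherent (x : E) := forall e : R, 0 < e -> exists a, w (x - i a) < e.

Definition closure_pred : {pred E} := fun x => `[< adherent x >].

Let adhM x y : adherent x -> adherent y -> adherent (x * y).
Proof.
move=> hx hy e e0; have m0 : 0 < w y + 1 by rewrite ltr_wpDl// (abs_ge0 wabs).
have [|a ha] := hx (e / (w y + 1)); first by rewrite divr_gt0.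
have n0 : 0 < w (i a) + 1 by rewrite ltr_wpDl// (abs_ge0 wabs).
have [|b hb] := hy (e / (w (i a) + 1)); first by rewrite divr_gt0.
exists (a * b); have -> : x * y - i (a * b) = (x - i a) * y + i a * (y - i b).
  by rewrite rmorphM; ring.
have lt1 (p q r : R) : 0 <= p -> 0 <= q -> p < r / (q + 1) -> p * q < r.
  move=> p0 q0; have q1 : 0 < q + 1 by rewrite ltr_wpDl.
  by rewrite ltr_pdivlMr//; apply: le_lt_trans; rewrite ler_wpM2l// lerDl.
apply: (absD_lt wabs); rewrite (absM wabs); first by apply: lt1; rewrite ?(abs_ge0 wabs).
by rewrite mulrC; apply: lt1; rewrite ?(abs_ge0 wabs).
Qed.

Let adhV x : adherent x -> adherent x^-1.
Proof.
have [->|x0] := eqVneq x 0; first by rewrite invr0.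
move=> hx e e0; have wx : 0 < w x by exact: abs_gt0.
(* Closeness within |x| forces |i a| = |x|, and then |1/x - 1/(i a)| = |i a - x| / |x|^2. *)
have [|a ha] := hx (Num.min (w x) (e * w x ^+ 2)).
  by rewrite lt_min wx mulr_gt0// exprn_gt0.
move: ha; rewrite lt_min => /andP[a1 a2].
have wa : w (i a) = w x.
  by rewrite -[i a](subrK x) addrC (absD_eq wabs)// (absBC wabs).
have a0 : i a != 0 by apply: (abs_neq0 wabs); rewrite wa.
exists a^-1; rewrite fmorphV; have -> : x^-1 - (i a)^-1 = (i a - x) / (x * i a).
  by field; rewrite a0 x0.
by rewrite (abs_div wabs) (absM wabs) wa (absBC wabs) ltr_pdivrMr ?mulr_gt0// -expr2.
Qed.

Lemma closure_divring : divring_closed closure_pred.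
Proof.
split.
- by apply/asboolP => e e0; exists 1; rewrite rmorph1 subrr (abs0 wabs).
- move=> x y /asboolP hx /asboolP hy; apply/asboolP => e e0.
  have [a ha] := hx e e0; have [b hb] := hy e e0; exists (a - b).
  have -> : x - y - i (a - b) = (x - i a) - (y - i b) by rewrite rmorphB; ring.
  exact: (absB_lt wabs).
- move=> x y /asboolP hx /asboolP hy; apply/asboolP.
  by apply: adhM => //; exact: adhV.
Qed.

HB.instance Definition _ := GRing.isDivringClosed.Build E closure_pred closure_divring.

Record closure_field := ClosureField {
  closure_val :> E; closure_valP : closure_val \in closure_pred }.

HB.instance Definition _ := [isSub for closure_val].
HB.instance Definition _ := [Choice of closure_field by <:].
HB.instance Definition _ := [SubChoice_isSubComUnitRing of closure_field by <:].
HB.instance Definition _ := [SubComUnitRing_isSubIntegralDomain of closure_field by <:].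
HB.instance Definition _ := [SubIntegralDomain_isSubField of closure_field by <:].

Definition closure_inj : {rmorphism closure_field -> E} := val.

Definition to_closure (a : G) : closure_field.
Proof.
by exists (i a); apply/asboolP => e e0; exists a; rewrite subrr (abs0 wabs).
Defined.

Lemma to_closure_zmod : zmod_morphism to_closure.
Proof. by move=> a b; apply: val_inj; rewrite /= rmorphB. Qed.

Lemma to_closure_monoid : monoid_morphism to_closure.
Proof. by split=> [|a b]; apply: val_inj; rewrite /= ?rmorph1 ?rmorphM. Qed.

HB.instance Definition _ := GRing.isZmodMorphism.Build G closure_field to_closure to_closure_zmod.
HB.instance Definition _ := GRing.isMonoidMorphism.Build G closure_field to_closure to_closure_monoid.

Lemma exists_closure_completion : exists (Gv : fieldType) (k : {rmorphism Gv -> E})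
  (i' : {rmorphism G -> Gv}), (forall a, k (i' a) = i a) /\
  is_completion (w \o i) (w \o k) i'.
Proof.
exists closure_field, closure_inj, to_closure; split=> //; split.
- split.
  + by move=> x; exact: (abs_ge0 wabs).
  + move=> x; rewrite /= (abs_eq0 wabs); split=> [h|->]; last exact: (rmorph0 closure_inj).
    by apply: val_inj; exact: h.
  + by move=> x y; rewrite /= (absM wabs).
  + by move=> x y; rewrite /= (abs_ultra wabs).
  + by have [a a0 a1] := inontriv; exists (to_closure a); rewrite ?fmorph_eq0.
- by [].
- move=> y e e0; have /asboolP/(_ e e0)[a ha] := closure_valP y.
  by exists a.
- move=> u hu; have [|l hl] := wcomplete (u := closure_inj \o u).
    by move=> e /hu[N hN]; exists N => m n h h'; exact: hN.
  have lP : l \in closure_pred.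
    apply/asboolP => e e0; have [N hN] := hl e e0.
    have /asboolP/(_ e e0)[a ha] := closure_valP (u N); exists a.
    rewrite -[l](subrK (closure_inj (u N))) -addrA; apply: (absD_lt wabs) => //.
    by rewrite (absBC wabs) hN.
  by exists (ClosureField lP) => e /hl[N hN]; exists N => n /hN.
Qed.

End ClosedSubfield.

(* The closure of [G] in the completion of [E] is a completion of [G], over
   which the image of a basis of [E] spans a complete, hence closed, hence
   full subspace. *)
Lemma exists_local_degree (R : realType) (G : fieldType) (E : fieldExtType G) (w : E -> R) :
  nontrivial_nonarch_abs w -> nontrivial_nonarch_abs (below w) ->
  exists n, is_local_degree w n.
Proof.
move=> wabs vabs; have [Ew [ww [j Cj]]] := exists_completion wabs.
have wwabs := completion_abs Cj; have jw := completion_isometry Cj.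
pose i : {rmorphism G -> Ew} := j \o in_alg E.
have wi a : ww (i a) = below w a by rewrite /i /= jw.
have [|Gv [k [i' [ki Ci']]]] := exists_closure_completion (i := i) wwabs (completion_complete Cj).
  by have [a a0 a1] := abs_nontrivial vabs; exists a; rewrite ?wi.
have wiE : ww \o i = below w by apply/funext => a; exact: wi.
rewrite wiE in Ci'; have vvabs := completion_abs Ci'.
pose b (l : 'I_(\dim {:E})) := j (vbasis {:E})`_l.
have bE x : exists g : 'I_(\dim {:E}) -> G, x = \sum_l in_alg E (g l) * (vbasis {:E})`_l.
  exists (coord (vbasis {:E}) ^~ x); rewrite {1}(coord_vbasis (memvf x)).
  by apply: eq_bigr => l _; rewrite mulr_algl.
(* A maximal subfamily of the image of the basis that is independent over the closure of [G].
   Indices are selected instead of vectors, so that independence makes the selection injective and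
   bounds its size. *)
have [n [e [nE nmax]]] : exists n (e : 'I_n -> 'I_(\dim {:E})), lin_indep k (b \o e) /\
    forall x, ~ lin_indep k (fun o : option 'I_n => if o is Some l then b (e l) else b x).
  have [||I [f [[g [gf hf]] fmax]]] := @max_family Ew (fun I f => exists g : I -> 'I_(\dim {:E}),
      f = b \o g /\ lin_indep k f) (\dim {:E}).
  - by move=> f; exists (of_void _); split=> [|g _ []//]; apply/funext => -[].
  - move=> I f [g [-> hg]]; rewrite -[leqRHS]card_ord; apply: (@leq_card _ _ g) => l l' ll.
    apply: contrapT => /eqP nll.
    have := hg (fun o => if o == l then 1 else if o == l' then -1 else 0).
    have l'l : l' != l by rewrite eq_sym.
    rewrite (bigD1 l)//= (bigD1 l')//= !eqxx (negbTE l'l) big1 => [|o /andP[ol ol']].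
      rewrite rmorph1 rmorphN1 ll mul1r mulN1r addr0 subrr => /(_ erefl l)/eqP.
      by rewrite eqxx oner_eq0.
    by rewrite (negbTE ol) (negbTE ol') rmorph0 mul0r.
  exists #|I|, (g \o enum_val); split.
    move=> h hh l; have := hf (h \o enum_rank) _ (enum_val l); rewrite /= enum_valK; apply.
    rewrite -[RHS]hh (reindex (fun l : 'I_#|I| => enum_val l)); last by apply: onW_bij; exact: enum_val_bij.
    by apply: eq_bigr => o _; rewrite /= enum_valK gf.
  move=> x hx; apply: fmax; exists (b x), (fun o => if o is Some l then g l else x); split.
    by apply/funext => -[l|]; rewrite ?gf.
  move=> h hh [l|].
    have := hx (fun o => if o is Some l then h (Some (enum_val l)) else h None) _ (Some (enum_rank l)).
    rewrite enum_rankK; apply; rewrite -[RHS]hh !sum_option; congr (_ + _).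
    rewrite (reindex enum_rank); last by apply: onW_bij; exact: enum_rank_bij.
    by apply: eq_bigr => o _; rewrite /= enum_rankK gf.
  have := hx (fun o => if o is Some l then h (Some (enum_val l)) else h None) _ None; apply.
  rewrite -[RHS]hh !sum_option; congr (_ + _).
  rewrite (reindex enum_rank); last by apply: onW_bij; exact: enum_rank_bij.
  by apply: eq_bigr => o _; rewrite /= enum_rankK gf.
have bspan x : exists g, b x = \sum_l k (g l) * b (e l).
  apply: contrapT => nx; apply: (nmax x) => g; rewrite sum_option => hg.
  have gN : g None = 0.
    apply: contrapT => /eqP gN; apply: nx; exists (fun l => - (g (Some l) / g None)).
    have kN : k (g None) != 0 by rewrite fmorph_eq0.
    apply: (mulfI kN); move/eqP: hg; rewrite addrC addr_eq0 => /eqP ->.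
    rewrite mulr_sumr -sumrN; apply: eq_bigr => l _.
    by rewrite rmorphN mulNr mulrN mulrA -rmorphM mulrCA divff ?mulr1.
  move: hg; rewrite gN rmorph0 mul0r addr0 => /nE h [l|]//; exact: h.
have wk a : ww (k a) = (ww \o k) a by [].
(* The span is closed, by completeness of the closure of [G], and contains the dense image of
   [E]. *)
have span x : exists g, x = \sum_l k (g l) * (b \o e) l.
  apply: (lin_indep_closed vvabs wwabs wk (completion_complete Ci') nE) => r r0.
  have [y hy] := completion_dense Cj x r0.
  suff [g hg] : exists g, j y = \sum_l k (g l) * (b \o e) l by exists g; rewrite -hg.
  have [h ->] := bE y; have [c hc] := choice bspan.
  exists (fun l => \sum_x i' (h x) * c x l).
  transitivity (\sum_x \sum_l k (i' (h x) * c x l) * b (e l)).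
    rewrite rmorph_sum; apply: eq_bigr => x0 _; rewrite rmorphM -[j _`_ _]/(b x0) hc mulr_sumr.
    by apply: eq_bigr => l _; rewrite rmorphM ki mulrA.
  rewrite exchange_big; apply: eq_bigr => l _ /=.
  by rewrite rmorph_sum mulr_suml.
(* So the completion is finite over the closure of [G]; its absolute value is transported to the
   copy [Y] along the inverse of [f]. *)
have [Y [f [fk fsurj]]] := exists_fieldext nE span.
have finj : injective f by exact: fmorph_inj.
have [f' f'K fK'] : exists2 f' : Y -> Ew, (forall y, f (f' y) = y) & (forall x, f' (f x) = x).
  have [f' hf'] := choice fsurj; exists f' => // x; apply: finj; exact: hf'.
have f'0 : f' 0 = 0 by rewrite -(rmorph0 f) fK'.
have f'M x y : f' (x * y) = f' x * f' y  by apply: finj; rewrite rmorphM !f'K.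
have f'D x y : f' (x + y) = f' x + f' y by apply: finj; rewrite rmorphD !f'K.
have f'B x y : f' (x - y) = f' x - f' y by apply: finj; rewrite rmorphB !f'K.
exists (\dim {:Y}), Gv, (ww \o k), i', Y, (ww \o f'), (f \o j); split=> //.
- split.
  + split.
    * by move=> x; exact: (abs_ge0 wwabs).
    * move=> x; rewrite /= (abs_eq0 wwabs); split=> [h|->]; last exact: f'0.
      by rewrite -(f'K x) [f' x]h rmorph0.
    * by move=> x y; rewrite /= f'M (absM wwabs).
    * by move=> x y; rewrite /= f'D (abs_ultra wwabs).
    * have [a a0 a1] := abs_nontrivial wabs; exists (f (j a)); first by rewrite !fmorph_eq0.
      by rewrite /= fK' jw.
  + by move=> x; rewrite /= fK' jw.
  + move=> y e0 he0; have [a ha] := completion_dense Cj (f' y) he0; exists a.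
    by rewrite /= f'B fK'.
  + move=> u hu; have [|l hl] := completion_complete Cj (u := f' \o u).
      by move=> r /hu[N hN]; exists N => m p m1 m2; rewrite /= -f'B; exact: hN.
    exists (f l) => r /hl[N hN]; exists N => m /hN.
    by rewrite /= f'B fK'.
- by move=> a; rewrite -fk -[LHS]/(ww (f' _)) fK'.
- by move=> a; rewrite -fk ki.
Qed.

Section LocalDegree.
Variables (R : realType) (G : fieldType) (E : fieldExtType G) (M : set (G -> R)).
Hypothesis Mabs : forall v, M v -> nontrivial_nonarch_abs v.

Lemma local_degreeP (w : E -> R) :
  places_above M w -> is_local_degree w (local_degree w).
Proof.
move=> [wabs wv]; rewrite /local_degree; case: xgetP => // h.
by have [n hn] := exists_local_degree wabs (Mabs wv); case: (h n).
Qed.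

Lemma local_degree_gt0 (w : E -> R) : places_above M w -> (0 < local_degree w)%N.
Proof.
by move=> /local_degreeP[Gv [vv [i [Ew [ww [j [_ _ _ _ ->]]]]]]]; exact: adim_gt0.
Qed.

End LocalDegree.

(** * Residue counting at closed points *)

Lemma expr_le (R : realType) (x y : R) n : 0 <= x -> x <= y -> x ^+ n <= y ^+ n.
Proof. by move=> x0 xy; rewrite lerXn2r// nnegrE// (le_trans x0). Qed.

(** Serves to remove multiplicative constants from estimates that are compatible with powers: if M >
    X, then (X/M)^k falls below 1/C. *)
Lemma le_of_pow_le (R : realType) (M X C : R) : 0 <= M -> 0 < X -> 0 < C ->
  (forall k : nat, M ^+ k <= C * X ^+ k) -> M <= X.
Proof.
move=> M0 X0 C0 h; rewrite leNgt; apply/negP => XM.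
have Mp : 0 < M by rewrite (lt_trans X0).
have [||N hN] := @exprn_lt _ (X / M) C^-1 (divr_ge0 (ltW X0) M0).
- by rewrite ltr_pdivrMr// mul1r.
- by rewrite invr_gt0.
have := hN N (leqnn N); rewrite expr_div_n ltr_pdivrMr ?exprn_gt0// mulrC.
by rewrite ltr_pdivlMr// mulrC ltNge h.
Qed.

Section BallIndex.
Variables (R : realType) (E : fieldType) (w : E -> R).
Hypothesis wabs : nontrivial_nonarch_abs w.

Definition ball_set (r : R) : set E := [set x | w x <= r].

Lemma ball_subgroup r : 0 <= r -> subgroup (ball_set r).
Proof.
move=> r0; split; first by rewrite /ball_set /= (abs0 wabs).
by move=> x y; exact: (absB_le wabs).
Qed.

Lemma scaled_ball y r : y != 0 -> scaled y (ball_set r) = ball_set (w y * r).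
Proof.
move=> y0; have wy : 0 < w y by exact: abs_gt0.
apply/seteqP; split=> [_ [x xr <-]|x xr].
  by rewrite /ball_set /= (absM wabs) ler_wpM2l// ltW.
by apply/(scaledP _ _ y0); rewrite /ball_set /= mulrC (abs_div wabs) ler_pdivrMr// mulrC.
Qed.

(** The order of O_w / y O_w: the ball of radius |y| is [y] times the unit ball. *)
Definition abs_index (y : E) (k : nat) := index_eq (ball_set 1) (ball_set (w y)) k.

Lemma abs_index_gt0 y k : abs_index y k -> (0 < k)%N.
Proof. by apply: index_gt0; exists 0; rewrite /ball_set /= (abs0 wabs). Qed.

Lemma abs_indexM y z k l : y != 0 -> z != 0 -> w y <= 1 -> w z <= 1 ->
  abs_index y k -> abs_index z l -> abs_index (y * z) (k * l).
Proof.
move=> y0 z0 y1 z1 hy hz; apply: indexM hy _ => //; try by apply: ball_subgroup => //; exact: (abs_ge0 wabs).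
- by move=> x /le_trans; apply.
- by move=> x /le_trans; apply; rewrite (absM wabs) ler_piMr// (abs_ge0 wabs).
by have := index_scaled y0 hz; rewrite !scaled_ball// mulr1 -(absM wabs).
Qed.

Lemma abs_index1 : abs_index 1 1.
Proof.
exists unit, (fun=> 0); split; rewrite ?card_unit// /ball_set /= (abs1 wabs).
  by split=> [_|[] []//]; rewrite /ball_set /= (abs0 wabs).
by move=> x x1; exists tt; rewrite /= subr0.
Qed.

Lemma abs_indexX y k n : y != 0 -> w y <= 1 -> abs_index y k -> abs_index (y ^+ n) (k ^ n).
Proof.
move=> y0 y1 hy; elim: n => [|n ih]; first exact: abs_index1.
rewrite exprS expnS; apply: abs_indexM => //; first exact: expf_neq0.
by rewrite (absX wabs) exprn_ile1// (abs_ge0 wabs).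
Qed.

Lemma abs_index_anti y z k l : w y <= w z -> abs_index y k -> abs_index z l -> (l <= k)%N.
Proof.
move=> yz hy hz; apply: (index_le (h := idfun) _ _ _ hz hy) => //.
  by apply: ball_subgroup; exact: (abs_ge0 wabs).
by move=> x x' _ _ h; apply: le_trans yz.
Qed.

Lemma abs_index_eq y z k : w y = w z -> abs_index y k -> abs_index z k.
Proof. by rewrite /abs_index => ->. Qed.

Lemma abs_index_uniq y k l : abs_index y k -> abs_index y l -> k = l.
Proof. by apply: index_uniq; apply: ball_subgroup; exact: (abs_ge0 wabs). Qed.

Lemma abs_index_exists y n :
  (forall (I : finType) (f : I -> E), separated (ball_set 1) (ball_set (w y)) f -> (#|I| <= n)%N) ->
  exists2 k, (k <= n)%N & abs_index y k.
Proof. by apply: index_exists; apply: ball_subgroup; exact: (abs_ge0 wabs). Qed.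

Lemma separated_le_abs_index y k (I : finType) (f : I -> E) : abs_index y k ->
  separated (ball_set 1) (ball_set (w y)) f -> (#|I| <= k)%N.
Proof. by move=> hk hf; apply: separated_le hf hk; apply: ball_subgroup; exact: (abs_ge0 wabs). Qed.

Lemma abs_index_ball a b k : a != 0 -> b != 0 -> abs_index (b / a) k ->
  index_eq (ball_set (w a)) (ball_set (w b)) k.
Proof.
move=> a0 b0 /(index_scaled a0); rewrite !scaled_ball// mulr1 -(absM wabs).
by rewrite mulrC divfK.
Qed.

End BallIndex.

Section CurvePlace.
Variables (R : realType) (K : fieldType) (v : K -> R).
Hypothesis vplace : curve_places v.

Lemma curve_place_abs : nontrivial_nonarch_abs v.
Proof. by case: vplace. Qed.

Let vabs := curve_place_abs.

Lemma curve_place_residue : exists (N : nat) (pi : K),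
  [/\ (1 < N)%N, v pi = N%:R^-1, pi != 0, abs_index v pi N &
    forall x, x != 0 -> v x <= 1 -> exists k : nat, v x = v pi ^+ k].
Proof.
case: vplace => _ [N [pi [rN vpi vals]]].
have vals' x : x != 0 -> v x <= 1 -> 0 < v pi -> v pi <= 1 -> v pi != 1 -> exists k : nat, v x = v pi ^+ k.
  move=> x0 x1 p0 p1 pn1; have [[k|k] hk] := vals x x0; first by exists k.
  exists 0%N; rewrite expr0; apply/eqP; rewrite eq_le x1/= hk NegzE -exprnN.
  by rewrite invf_ge1 ?exprn_gt0// exprn_ile1// ltW.
have hN : index_eq (ball_set v 1) [set x | v x < 1] N.
  have /card_set_bijP[g [g1 g2 g3]] : (`I_N #= residue_field v)%card by rewrite card_eq_sym.
  have hf (i : 'I_N) : exists x, v x <= 1 /\ g i = [set y | v (y - x) < 1].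
    by have /= [x x1 <-] := g1 i (ltn_ord i); exists x.
  have [f fP] := choice hf; exists 'I_N, f; split; first by rewrite card_ord.
    split=> [i|i j fij]; first exact: (fP i).1.
    apply: val_inj; apply: g2; rewrite ?inE/=; try exact: ltn_ord.
    rewrite (fP i).2 (fP j).2; apply/seteqP; split=> y /= hy.
      by have := absD_lt vabs hy fij; rewrite subrKA.
    by have := absB_lt vabs hy fij; rewrite opprB subrKA.
  move=> x x1; have /= [|k kN gk] := g3 [set y | v (y - x) < 1]; first by exists x.
  exists (Ordinal kN); have [_ gE] := fP (Ordinal kN).
  have : g k x by rewrite gk /= subrr (abs0 vabs) ltr01.
  by rewrite gE.
have N1 : (1 < N)%N.
  (* [N] is not 0 because the unit ball contains 0, and not 1 because the values, being powers of
     1/N, would all be trivial. *)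
  case: N rN vpi hN => [|[|N]]// _ vpi hN.
    by have := index_gt0 (ex_intro _ 0 _) hN; rewrite /ball_set /= (abs0 vabs) => /(_ ler01).
  have [x x0 x1] := abs_nontrivial vabs; have [k xk] := vals x x0.
  by move: x1; rewrite xk vpi invr1 exp1rz eqxx.
have p0 : 0 < v pi by rewrite vpi invr_gt0 ltr0n ltnW.
have p1 : v pi < 1 by rewrite vpi invf_lt1 ?ltr1n// ltr0n ltnW.
have pi0 : pi != 0 by exact: (abs_neq0 vabs).
exists N, pi; split=> //; last by move=> x x0 x1; apply: vals' => //; rewrite ?lt_eqF// ltW.
rewrite /abs_index; suff -> : ball_set v (v pi) = [set x | v x < 1] by [].
apply/seteqP; split=> x /= hx; first exact: le_lt_trans hx p1.
have [->|x0] := eqVneq x 0; first by rewrite /ball_set /= (abs0 vabs) ltW.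
have [k xk] := vals' x x0 (ltW hx) p0 (ltW p1) (negbT (lt_eqF p1)).
rewrite /ball_set /= xk; case: k xk => [|k] xk; first by rewrite xk expr0 ltxx in hx.
by rewrite exprS ler_piMr ?exprn_ile1// ltW.
Qed.

Lemma curve_place_index y : y != 0 -> v y <= 1 ->
  exists2 k, abs_index v y k & k%:R = (v y)^-1.
Proof.
have [N [pi [N1 vpi pi0 hpi vals]]] := curve_place_residue.
move=> y0 y1; have [l yl] := vals y y0 y1; exists (N ^ l)%N.
  apply: (@abs_index_eq _ _ v (pi ^+ l)); first by rewrite (absX vabs).
  apply: abs_indexX => //; rewrite vpi invf_le1 ?ler1n ?ltr0n; exact: ltnW.
by rewrite yl vpi exprVn invrK natrX.
Qed.

End CurvePlace.

(** * Residue counting above a closed point *)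

Section LocalIndex.
Variables (R : realType) (K : fieldType) (E : fieldExtType K) (w : E -> R) (n : nat).
Hypothesis wabs : nontrivial_nonarch_abs w.
Hypothesis vplace : curve_places (below w).
Hypothesis wn : is_local_degree w n.

Let v := below w.
Let vabs : nontrivial_nonarch_abs v := curve_place_abs vplace.

Let vball a b : a != 0 -> b != 0 -> v b <= v a ->
  exists2 k, index_eq (ball_set v (v a)) (ball_set v (v b)) k & k%:R = v a / v b.
Proof.
move=> a0 b0 ba; have va : 0 < v a by exact: abs_gt0.
have [||k hk kE] := @curve_place_index _ _ v vplace (b / a).
- by rewrite mulf_neq0 ?invr_eq0.
- by rewrite (abs_div vabs) ler_pdivrMr// mul1r.
by exists k; [exact: abs_index_ball|rewrite kE (abs_div vabs) invf_div].
Qed.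

(** In the coordinates of [local_basis] the quotient by [g] looks like [n] copies of the quotient of
    the valuation ring of [v] by [g]. The unit ball of [w] and the corresponding box of coordinates
    agree up to scaling by [a], which costs a factor |a|^2 in each coordinate, independently of
    [g]. *)
Let squeeze_ground : exists2 C : R, 0 < C & forall g, g != 0 -> v g <= 1 ->
  exists2 k, abs_index w (in_alg E g) k &
    k%:R <= C * ((v g)^-1 ^+ n) /\ (v g)^-1 ^+ n <= C * k%:R.
Proof.
have [c [d [y [c0 d0 hd hy]]]] := local_basis wn.
have hc (g : 'I_n -> K) l : c * v (g l) <= w (\sum_l in_alg E (g l) * y l).
  by apply: hd => l'; rewrite subrr (abs0 wabs).
have [C C0 hC] := abs_lincomb_le (k := in_alg E) vabs wabs (fun=> erefl) y.
have [a [a0 a1 ac aC]] : exists a, [/\ a != 0, 1 <= v a, c^-1 <= v a & C <= v a].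
  have [a ha] := exists_abs_gt vabs (Num.max 1 (Num.max c^-1 C)); exists a.
  move: ha; rewrite !gt_max => /and3P[h1 h2 h3]; rewrite !ltW//; split=> //.
  by apply: (abs_neq0 vabs); rewrite (lt_trans _ h1).
have va : 0 < v a by exact: abs_gt0.
have vaV : v a^-1 <= C^-1 by rewrite (absV vabs) lef_pV2 ?posrE.
have Ca1 : C * v a^-1 <= 1 by rewrite -ler_pdivlMl// mulr1.
have va2 : 1 <= v a * v a by rewrite -[leLHS]mulr1 ler_pM.
exists ((v a * v a) ^+ n); first by rewrite exprn_gt0// mulr_gt0.
move=> g g0 g1; have vg : 0 < v g by exact: abs_gt0.
have wg : w (in_alg E g) = v g by [].
have b10 : a^-1 * g != 0 by rewrite mulf_neq0 ?invr_eq0.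
have b1a : v (a^-1 * g) <= v a.
  have aV1 : (v a)^-1 <= 1 by rewrite invf_le1.
  by rewrite (absM vabs) (absV vabs) (le_trans _ a1)// mulr_ile1 ?invr_ge0// ltW.
have [k1 [I1 [F1 [I1k [F1a F1s] F1c]]] k1E] := vball a0 b10 b1a.
have wsumB (h h' : 'I_n -> K) : \sum_l in_alg E (h l - h' l) * y l =
    \sum_l in_alg E (h l) * y l - \sum_l in_alg E (h' l) * y l.
  by rewrite -sumrB; apply: eq_bigr => l _; rewrite rmorphB mulrBl.
have upper (I : finType) (f : I -> E) :
    separated (ball_set w 1) (ball_set w (w (in_alg E g))) f -> (#|I| <= k1 ^ n)%N.
  move=> [f1 fs]; have [h hh] := choice (fun i => hy (f i) _ vg).
  have hva i l : ball_set v (v a) (h i l).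
    apply: le_trans ac; rewrite -[leRHS]mulr1 ler_pdivlMl//.
    apply: le_trans (hc _ l) _; rewrite -[X in w X](subKr (f i)).
    by apply: (absB_le wabs); [exact: f1|rewrite ltW// (lt_le_trans (hh i))].
  have [t ht] := choice (fun p : I * 'I_n => F1c _ (hva p.1 p.2)).
  pose t' i := [ffun l => t (i, l)].
  have -> : (k1 ^ n = #|{ffun 'I_n -> I1}|)%N by rewrite card_ffun card_ord I1k.
  apply: (@leq_card _ _ t') => i i' /ffunP tt; apply: fs.
  pose S i0 := \sum_l in_alg E (h i0 l) * y l.
  have -> : f i - f i' = (f i - S i) - (f i' - S i') + (S i - S i') by ring.
  apply: (absD_le wabs); first by apply: (absB_le wabs); rewrite ltW//; exact: hh.
  rewrite -wsumB (@le_trans _ _ (C * (v (a^-1 * g))))//.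
    apply: hC => [l|]; last exact: (abs_ge0 vabs).
    have := absB_le vabs (ht (i, l)) (ht (i', l)).
    by have := tt l; rewrite !ffunE => ->; rewrite opprB subrKA.
  by rewrite (absM vabs) mulrA ler_piMl// ltW.
have [k kle hk] := abs_index_exists wabs upper; exists k => //.
have k0 := abs_index_gt0 wabs hk.
have vgn : 0 < (v g)^-1 ^+ n by rewrite exprn_gt0// invr_gt0.
split.
  apply: (@le_trans _ _ (k1 ^ n)%:R); first by rewrite ler_nat.
  by rewrite natrX k1E (absM vabs) (absV vabs) -exprMn_comm ?invfM ?invrK ?mulrA//; exact: mulrC.
(* If the ball of radius |a g| is not inside that of radius 1/|a|, then 1/|g| < |a|^2 and the
   trivial bound k >= 1 is enough. *)
have [le|lt] := leP (v (a * g)) (v a^-1); last first.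
  apply: (@le_trans _ _ ((v a * v a) ^+ n)); last by rewrite ler_peMr ?ler1n ?exprn_ge0 ?mulr_ge0 ?ltW.
  apply: expr_le; first by rewrite invr_ge0 ltW.
  move: lt; rewrite (absM vabs) (absV vabs) -[ltLHS]mul1r ltr_pdivrMr// mulrAC => /ltW h.
  by rewrite -[leLHS]mul1r ler_pdivrMr.
have aV0 : a^-1 != 0 by rewrite invr_eq0.
have [k2 [I2 [F2 [I2k [F2a F2s] F2c]]] k2E] := vball aV0 (mulf_neq0 a0 g0) le.
have : (k2 ^ n <= k)%N.
  have -> : (k2 ^ n = #|{ffun 'I_n -> I2}|)%N by rewrite card_ffun card_ord I2k.
  apply: (@separated_le_abs_index _ _ _ wabs _ _ _ (fun h : {ffun 'I_n -> I2} => \sum_l in_alg E (F2 (h l)) * y l) hk).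
  split=> [h|h h'].
    apply: (le_trans (hC _ (v a^-1) _ _)) => [l||]; [exact: F2a|exact: (abs_ge0 vabs)|].
    exact: Ca1.
  rewrite -wsumB => hw; apply/ffunP => l; apply: F2s.
  have := le_trans (hc _ l) hw; rewrite -ler_pdivlMl// => /le_trans; apply.
  by rewrite [leRHS](absM vabs) ler_wpM2r// ltW.
rewrite -(ler_nat R) natrX k2E (absM vabs) (absV vabs) => kk.
apply: le_trans (ler_wpM2l _ kk); last by rewrite exprn_ge0// mulr_ge0// ltW.
rewrite -exprMn_comm; last exact: mulrC.
rewrite le_eqVlt; apply/orP; left; apply/eqP; congr (_ ^+ _).
by field; rewrite !gt_eqF.
Qed.

(* Comparing the powers of [y] with those of a fixed element of [K] turns the
   estimate [squeeze_ground] into an equality. *)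
Lemma local_index y : y != 0 -> w y <= 1 ->
  exists2 k, abs_index w y k & k%:R = (w y)^-1 ^+ n.
Proof.
have [C C0 hC] := squeeze_ground.
have ground g : g != 0 -> v g <= 1 -> exists2 k, abs_index w (in_alg E g) k & k%:R = (v g)^-1 ^+ n.
  move=> g0 g1; have [k hk _] := hC g g0 g1; exists k => //.
  have vg : 0 < v g by exact: abs_gt0.
  have X0 : 0 < (v g)^-1 ^+ n by rewrite exprn_gt0// invr_gt0.
  have k0 : 0 < k%:R :> R by rewrite ltr0n (abs_index_gt0 wabs hk).
  have iX l : k%:R ^+ l <= C * ((v g)^-1 ^+ n) ^+ l /\ ((v g)^-1 ^+ n) ^+ l <= C * k%:R ^+ l.
    have [||k' hk'] := hC (g ^+ l); first exact: expf_neq0.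
      by rewrite (absX vabs) exprn_ile1// (abs_ge0 vabs).
    have gE : in_alg E g != 0 by rewrite fmorph_eq0.
    have := abs_indexX wabs l gE g1 hk; rewrite -rmorphXn => /(abs_index_uniq wabs hk') ->.
    by rewrite natrX (absX vabs) -exprVn -!exprM mulnC.
  apply/eqP; rewrite eq_le; apply/andP; split.
    exact: (le_of_pow_le (ler0n _ _) X0 C0 (fun l => (iX l).1)).
  exact: (le_of_pow_le (ltW X0) k0 C0 (fun l => (iX l).2)).
move=> y0 y1; have wy : 0 < w y by exact: abs_gt0.
have [p p0 p1] := exists_abs_lt1 vabs; have vp : 0 < v p by exact: abs_gt0.
have pE0 : in_alg E p != 0 by rewrite fmorph_eq0.
have [kp hkp kpE] := ground p p0 (ltW p1).
have kp0 : 0 < kp%:R :> R by rewrite ltr0n (abs_index_gt0 wabs hkp).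
(* Finiteness at [y]: for [N] large the quotient by [y] is a quotient of the one by p^N. *)
have [k hk] : exists k, abs_index w y k.
  have [N hN] := exprn_lt (ltW vp) p1 wy.
  have hX := abs_indexX wabs N pE0 (ltW p1) hkp.
  have sub : ball_set w (w (in_alg E p ^+ N)) `<=` ball_set w (w y).
    by move=> x /le_trans; apply; rewrite (absX wabs) ltW// hN.
  have [||k _ hk] := index_coarse _ _ sub hX; last by exists k.
    by apply: (ball_subgroup wabs); exact: (abs_ge0 wabs).
  by apply: (ball_subgroup wabs); exact: (abs_ge0 wabs).
exists k => //; have k0 : 0 < k%:R :> R by rewrite ltr0n (abs_index_gt0 wabs hk).
have X0 : 0 < (w y)^-1 ^+ n by rewrite exprn_gt0// invr_gt0.
have iX l : k%:R ^+ l <= kp%:R * ((w y)^-1 ^+ n) ^+ l /\ ((w y)^-1 ^+ n) ^+ l <= kp%:R * k%:R ^+ l.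
  have hkl := abs_indexX wabs l y0 y1 hk.
  (* As |y^l| lies between consecutive powers of |p|, the index k^l lies between kp^e and kp^(e+1);
     the error factor [kp] does not depend on [l]. *)
  have [e /andP[e1 e2]] : exists e : nat, v p ^+ e.+1 < w y ^+ l <= v p ^+ e.
    have yl : 0 < w y ^+ l by rewrite exprn_gt0.
    have [N hN] := exprn_lt (ltW vp) p1 yl.
    have ex : exists N, v p ^+ N < w y ^+ l by exists N; exact: hN.
    case: (ex_minnP ex) => -[|m] hm mmin.
      by exfalso; move: hm; rewrite expr0 ltNge exprn_ile1// ltW.
    exists m; rewrite hm/= leNgt; apply/negP => /mmin; by rewrite ltnn.
  have wp : w (in_alg E p) = v p by [].
  have lo : (kp ^ e <= k ^ l)%N.
    apply: (abs_index_anti wabs _ hkl (abs_indexX wabs e pE0 (ltW p1) hkp)).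
    by rewrite !(absX wabs).
  have hi : (k ^ l <= kp ^ e.+1)%N.
    apply: (abs_index_anti wabs _ (abs_indexX wabs e.+1 pE0 (ltW p1) hkp) hkl).
    by rewrite !(absX wabs) ltW.
  move: lo hi; rewrite -!(ler_nat R) !natrX => lo hi; split.
    apply: (le_trans hi); rewrite exprS ler_wpM2l// kpE -!exprM mulnC [leRHS](_ : _ = (w y)^-1 ^+ l ^+ n); last by rewrite -exprM mulnC.
    rewrite exprM; apply: expr_le; first by rewrite exprn_ge0// invr_ge0 ltW.
    by rewrite !exprVn lef_pV2// posrE exprn_gt0.
  apply: (@le_trans _ _ (kp%:R ^+ e.+1)).
    rewrite kpE -!exprM mulnC [leRHS](_ : _ = (v p)^-1 ^+ e.+1 ^+ n); last by rewrite -exprM mulnC.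
    rewrite exprM; apply: expr_le; first by rewrite exprn_ge0// invr_ge0 ltW.
    by rewrite !exprVn lef_pV2 ?posrE ?exprn_gt0// ltW.
  by rewrite exprS ler_wpM2l// ltW.
apply/eqP; rewrite eq_le; apply/andP; split.
  exact: (le_of_pow_le (ler0n _ _) X0 kp0 (fun l => (iX l).1)).
exact: (le_of_pow_le (ltW X0) k0 kp0 (fun l => (iX l).2)).
Qed.

End LocalIndex.

(** * Valuation rings of function fields *)

Section FunctionField.
Variables (F : finFieldType) (E : fieldType) (c : {rmorphism F -> E}).

Definition peval (s : E) (p : {poly F}) : E := (map_poly c p).[s].

Lemma pevalD s p r : peval s (p + r) = peval s p + peval s r.
Proof. by rewrite /peval rmorphD hornerD. Qed.
Lemma pevalB s p r : peval s (p - r) = peval s p - peval s r.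
Proof. by rewrite /peval rmorphB hornerD hornerN. Qed.
Lemma pevalM s p r : peval s (p * r) = peval s p * peval s r.
Proof. by rewrite /peval rmorphM hornerM. Qed.
Lemma peval0 s : peval s 0 = 0. Proof. by rewrite /peval rmorph0 horner0. Qed.
Lemma peval1 s : peval s 1 = 1. Proof. by rewrite /peval rmorph1 hornerC. Qed.
Lemma pevalX s : peval s 'X = s. Proof. by rewrite /peval map_polyX hornerX. Qed.
Lemma pevalC s a : peval s a%:P = c a. Proof. by rewrite /peval map_polyC hornerC. Qed.
Lemma peval_exp s p n : peval s (p ^+ n) = peval s p ^+ n.
Proof. by rewrite /peval rmorphXn horner_exp. Qed.
Lemma peval_prod s (I : Type) (r : seq I) (P : pred I) (p : I -> {poly F}) :
  peval s (\prod_(i <- r | P i) p i) = \prod_(i <- r | P i) peval s (p i).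
Proof. exact: (big_morph _ (pevalM s) (peval1 s)). Qed.
Lemma peval_sum s (I : Type) (r : seq I) (P : pred I) (p : I -> {poly F}) :
  peval s (\sum_(i <- r | P i) p i) = \sum_(i <- r | P i) peval s (p i).
Proof. exact: (big_morph _ (pevalD s) (peval0 s)). Qed.

Lemma poly_split0 (p : {poly F}) : exists p' : {poly F},
  p = p' * 'X + (p`_0)%:P /\ forall m, p'`_m = p`_m.+1.
Proof.
exists (\poly_(i < size p) p`_i.+1); split=> [|m]; last first.
  by rewrite coef_poly; case: ltnP => // h; rewrite nth_default// leqW.
apply/polyP => -[|i]; rewrite coefD coefMX coefC /= ?add0r// addr0 coef_poly.
by case: ltnP => // h; rewrite nth_default// leqW.
Qed.

Definition transcendental (s : E) := forall p, peval s p = 0 -> p = 0.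

Definition poly_indep (s : E) (I : finType) (f : I -> E) :=
  forall p : I -> {poly F}, \sum_i peval s (p i) * f i = 0 -> forall i, p i = 0.

(** For transcendental [s] this says that [E] is finite over F(s); independence over F[s] avoids
    fractions. *)
Definition finite_rank (s : E) :=
  exists N, forall (I : finType) (f : I -> E), poly_indep s f -> (#|I| <= N)%N.

(** * Boundedness of the rank over F[s] *)

Section RankBound.
Variables (t : E) (n : nat) (b : 'I_n -> E).
Hypothesis bspan : forall x, exists (g : {poly F}) (f : 'I_n -> {poly F}),
  peval t g != 0 /\ peval t g * x = \sum_i peval t (f i) * b i.

Let clear_denominators (I : finType) (x : I -> E) :
  exists (g : {poly F}) (f : I -> 'I_n -> {poly F}),
    peval t g != 0 /\ forall i, peval t g * x i = \sum_j peval t (f i j) * b j.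
Proof.
have [g hg] := choice (fun i => bspan (x i)); have [f hf] := choice hg.
exists (\prod_i g i), (fun i j => \prod_(i' | i' != i) g i' * f i j); split.
  by rewrite peval_prod; apply/prodf_neq0 => i _; exact: (hf i).1.
move=> i; rewrite (bigD1 i)//= pevalM mulrAC (hf i).2 mulrC mulr_sumr.
by apply: eq_bigr => j _; rewrite pevalM mulrA.
Qed.

Let span_le (d : nat) (x : E) := exists f : 'I_n -> {poly F},
  (forall i, (size (f i) <= d)%N) /\ x = \sum_i peval t (f i) * b i.

Let span_leD d x y : span_le d x -> span_le d y -> span_le d (x + y).
Proof.
move=> [f [hf ->]] [g [hg ->]]; exists (fun i => f i + g i); split=> [i|].
  by rewrite (leq_trans (size_polyD _ _))// geq_max hf hg.
by rewrite -big_split; apply: eq_bigr => i _; rewrite pevalD mulrDl.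
Qed.

Let span_le0 d : span_le d 0.
Proof.
exists (fun=> 0); split=> [i|]; first by rewrite size_poly0.
by rewrite big1// => i _; rewrite peval0 mul0r.
Qed.

Let span_leM d e (g : {poly F}) x : (size g <= e)%N -> span_le d x -> span_le (e + d) (peval t g * x).
Proof.
move=> ge [f [hf ->]]; exists (fun i => g * f i); split=> [i|].
  rewrite (leq_trans (size_polyMleq _ _))// (leq_trans (leq_pred _))// leq_add//.
by rewrite mulr_sumr; apply: eq_bigr => i _; rewrite pevalM mulrA.
Qed.

(* Counting: multiplication by [s] raises the degrees of coordinates by a
   bounded amount, so a family of [k] elements independent over [F[s]] yields
   [q ^ (k J)] elements with coordinates of degree at most [D J + O(1)]. *)
Lemma finite_rank_of_span s : finite_rank s.
Proof.
have [G [h [G0 hG]]] := clear_denominators (fun i => s * b i).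
pose D := (size G + \sum_i \sum_j size (h i j))%N.
have hD i j : (size (h i j) <= D)%N.
  by rewrite /D (bigD1 i)//= (bigD1 j)//= -!addnA addnCA leq_addr.
have GD : (size G <= D)%N by exact: leq_addr.
have smul d x : span_le d x -> span_le (D + d) (peval t G * s * x).
  move=> [f [hf ->]]; exists (fun j => \sum_i f i * h i j); split=> [j|].
    apply: (leq_trans (size_sum _ _ _)); apply/bigmax_leqP => i _.
    by rewrite (leq_trans (size_polyMleq _ _))// (leq_trans (leq_pred _))// addnC leq_add.
  rewrite mulr_sumr (eq_bigr (fun i => \sum_j peval t (f i * h i j) * b j)) => [|i _].
    rewrite exchange_big; apply: eq_bigr => j _ /=.
    by rewrite peval_sum mulr_suml.
  rewrite mulrCA -mulrA hG mulr_sumr; apply: eq_bigr => j _.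
  by rewrite pevalM mulrA.
exists (n * D)%N => I f findep; rewrite leqNgt; apply/negP => big.
have [g0 [f0 [g00 hf0]]] := clear_denominators f.
(* J > n d0 makes (n D + 1) J exceed n (J D + d0), the dimension of the space that receives the
   coordinates. *)
pose d0 := (\sum_i \sum_j size (f0 i j))%N; pose J := (n * d0).+1.
have pow i e j : (j <= e)%N -> span_le (e * D + d0) (peval t G ^+ e * s ^+ j * (peval t g0 * f i)).
  elim: e j => [|e ih] j.
    rewrite leqn0 => /eqP ->; rewrite mul0n !expr0 !mul1r; exists (f0 i); split=> [l|//].
    by rewrite add0n /d0 (bigD1 i)//= (bigD1 l)//= -!addnA leq_addr.
  rewrite mulSn -addnA; case: j => [_|j je].
    have := span_leM GD (ih 0%N isT); rewrite expr0 mulr1 exprS mulr1.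
    by rewrite mulrA.
  have := smul _ _ (ih j je); congr span_le; rewrite !exprS; ring.
have tot (A : 'M[F]_(#|I|, J)) : span_le (J * D + d0)
    (peval t G ^+ J * (peval t g0 * \sum_i peval s (rVpoly (row (enum_rank i) A)) * f i)).
  rewrite mulr_sumr mulr_sumr; elim/big_ind: _ => //; first exact: span_leD.
  move=> i _; rewrite /peval -/(peval t _) -/(peval t _) horner_coef.
  rewrite mulr_suml mulr_sumr mulr_sumr; elim/big_ind: _ => //; first exact: span_leD.
  move=> j _; rewrite coef_map /=.
  have jJ : (j <= J)%N.
    by rewrite (leq_trans (ltnW (ltn_ord j)))// size_map_poly size_poly.
  have [fj [fj1 fj2]] := pow i J j jJ.
  exists (fun l => (rVpoly (row (enum_rank i) A))`_j *: fj l); split=> [l|].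
    exact: leq_trans (size_scale_leq _ _) (fj1 l).
  rewrite (eq_bigr (fun l => c (rVpoly (row (enum_rank i) A))`_j * (peval t (fj l) * b l))) => [|l _].
    by rewrite -mulr_sumr -fj2; ring.
  by rewrite -mul_polyC pevalM pevalC mulrA.
have [C hC] := choice tot.
pose Phi (A : 'M[F]_(#|I|, J)) : 'M[F]_(n, J * D + d0) := \matrix_i poly_rV (C A i).
have Phi_inj : injective Phi.
  move=> A B AB; have CE i : C A i = C B i.
    have := congr1 (fun M => rVpoly (row i M)) AB; rewrite /Phi !rowK !poly_rV_K//.
      exact: (hC B).1.
    exact: (hC A).1.
  have : peval t G ^+ J * (peval t g0 * \sum_i peval s (rVpoly (row (enum_rank i) A)) * f i) =
         peval t G ^+ J * (peval t g0 * \sum_i peval s (rVpoly (row (enum_rank i) B)) * f i).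
    by rewrite (hC A).2 (hC B).2; apply: eq_bigr => i _; rewrite CE.
  move=> /(mulfI (expf_neq0 J G0)) /(mulfI g00) /eqP; rewrite -subr_eq0 => /eqP AB0.
  apply/row_matrixP => r; apply: (can_inj (@rVpolyK _ _)); apply/eqP; rewrite -subr_eq0.
  have := findep (fun i => rVpoly (row (enum_rank i) A) - rVpoly (row (enum_rank i) B)) _ (enum_val r).
  rewrite enum_valK => -> //; rewrite -[RHS]AB0 -sumrB.
  by apply: eq_bigr => i _; rewrite pevalB mulrBl.
have := leq_card Phi Phi_inj; rewrite !card_mx leq_exp2l; last exact: finRing_gt1.
rewrite leqNgt => /negP; apply.
rewrite mulnDr (@leq_trans ((n * D).+1 * J))//.
  by rewrite mulSn mulnCA mulnC addnC ltn_add2r.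
by rewrite leq_mul2r big orbT.
Qed.

End RankBound.

Section PolyModule.
Variables (s : E) (X : set E).
Hypothesis s0 : s != 0.
Hypothesis sX : subgroup X.
Hypothesis FX : forall a x, X x -> X (c a * x).
Hypothesis mulX : forall x, X x -> X (s * x).

Lemma peval_mem p x : X x -> X (peval s p * x).
Proof.
move=> Xx; rewrite /peval horner_coef mulr_suml; apply: subgroup_sum => // i _.
rewrite coef_map -mulrA; apply: FX; elim: (i : nat) => [|k ih]; first by rewrite mul1r.
by rewrite exprS -mulrA; exact: mulX.
Qed.

Lemma scaled_sub : scaled s X `<=` X.
Proof. by move=> _ [x Xx <-]; exact: mulX. Qed.

(** A relation over F[s], read modulo s X, kills the constant terms of its coefficients; dividing by
    [s] gives a relation between the shifted polynomials, and so on. *)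
Lemma indep_mod_poly_indep (I : finType) (f : I -> E) :
  (forall i, X (f i)) -> indep_mod c (scaled s X) f -> poly_indep s f.
Proof.
move=> Xf hf.
have coef0_eq0 (p : I -> {poly F}) : \sum_i peval s (p i) * f i = 0 -> forall i, (p i)`_0 = 0.
  move=> hp; have [p' hp'] := choice (fun i => poly_split0 (p i)).
  apply: hf; exists (- \sum_i peval s (p' i) * f i).
    by apply: subgroupN => //; apply: subgroup_sum => // i _; exact: peval_mem.
  apply/eqP; rewrite mulrN eq_sym -addr_eq0 -[eqbRHS]hp mulr_sumr -big_split.
  apply/eqP/eq_bigr => i _; rewrite [in RHS](hp' i).1 pevalD pevalM pevalX pevalC /=.
  by rewrite mulrDl addrC mulrA [s * _]mulrC.
move=> p hp i; apply/polyP => m; rewrite coef0.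
elim: m p hp i => [|m ih] p hp; first exact: coef0_eq0.
move=> i; have [p' hp'] := choice (fun i => poly_split0 (p i)).
rewrite -(hp' i).2; apply: ih i; apply: (mulfI s0); rewrite mulr0 -[RHS]hp mulr_sumr.
apply: eq_bigr => i _; rewrite [in RHS](hp' i).1 (coef0_eq0 p hp) addr0.
by rewrite pevalM pevalX mulrA [s * _]mulrC.
Qed.

Lemma index_poly_module : finite_rank s -> exists (I : finType) (f : I -> E),
  poly_indep s f /\ index_eq X (scaled s X) (#|F| ^ #|I|).
Proof.
move=> [N hN]; have sS := scaled_subgroup s sX.
have [||I [f [Xf hf hidx]]] := @index_finspace F E c X (scaled s X) N sX sS scaled_sub FX.
- move=> a _ [x Xx <-]; exists (c a * x); first exact: FX.
  by rewrite mulrCA.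
- by move=> I f Xf hf; apply: (hN _ f); exact: indep_mod_poly_indep.
by exists I, f; split=> //; exact: indep_mod_poly_indep.
Qed.

End PolyModule.

Lemma finite_rank_algebraic s x : transcendental s -> finite_rank s ->
  exists N (p : 'I_N -> {poly F}), \sum_i peval s (p i) * x ^+ i = 0 /\ exists i, p i != 0.
Proof.
move=> ts [N hN]; apply: contrapT => h.
have : (#|'I_N.+1| <= N)%N; last by rewrite card_ord ltnn.
apply: (hN _ (fun i : 'I_N.+1 => x ^+ i)) => p hp i; apply: contrapT => /eqP pi.
by apply: h; exists N.+1, p; split=> //; exists i.
Qed.

End FunctionField.

(** * Valuation rings with finite quotients *)

Section ValuationRing.
Variables (R : realType) (E : fieldType) (O : set E).

(** [vr_finite] stands for the conditions of rank one and discreteness: the absolute value is read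
    off the orders of the quotients O / yO, which also gives it the normalization of closed
    points. *)
Record val_ring : Prop := {
  vr1 : O 1;
  vrB : forall x y, O x -> O y -> O (x - y);
  vrM : forall x y, O x -> O y -> O (x * y);
  vr_total : forall x, O x \/ O x^-1;
  vr_proper : exists x, ~ O x;
  vr_finite : forall y, O y -> y != 0 -> exists k, index_eq O (scaled y O) k }.

Hypothesis HO : val_ring.

Lemma vr0 : O 0. Proof. by rewrite -(subrr 1); apply: (vrB HO); exact: (vr1 HO). Qed.

Lemma vr_subgroup : subgroup O. Proof. by split; [exact: vr0|exact: (vrB HO)]. Qed.

Lemma vrD x y : O x -> O y -> O (x + y).
Proof. exact: subgroupD vr_subgroup. Qed.

Let scaledO y : subgroup (scaled y O). Proof. exact: scaled_subgroup vr_subgroup. Qed.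

Let scaled_subO y : O y -> scaled y O `<=` O.
Proof. by move=> Oy _ [x Ox <-]; exact: (vrM HO). Qed.

Definition vr_index (y : E) : nat := xget 0%N (index_eq O (scaled y O)).

Lemma vr_indexP y : O y -> y != 0 -> index_eq O (scaled y O) (vr_index y).
Proof.
by move=> Oy y0; rewrite /vr_index; case: xgetP => // h; have [k hk] := vr_finite HO Oy y0; case: (h k).
Qed.

Lemma vr_index_gt0 y : O y -> y != 0 -> (0 < vr_index y)%N.
Proof. by move=> Oy y0; apply: index_gt0 (vr_indexP Oy y0); exists 0; exact: vr0. Qed.

Lemma vr_indexM y z : O y -> O z -> y != 0 -> z != 0 ->
  vr_index (y * z) = (vr_index y * vr_index z)%N.
Proof.
move=> Oy Oz y0 z0; have yz0 := mulf_neq0 y0 z0.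
apply: (index_uniq (scaledO (y * z)) (vr_indexP (vrM HO Oy Oz) yz0)).
apply: indexM (vr_indexP Oy y0) _ => //; first exact: vr_subgroup.
- exact: scaled_subO.
- by rewrite -scaledM => _ [x /(scaled_subO Oz) Ox <-]; exists x.
by rewrite -scaledM; apply: index_scaled => //; exact: vr_indexP.
Qed.

Lemma vr_index_unit y : O y -> y != 0 -> vr_index y = 1%N -> O y^-1.
Proof.
move=> Oy y0 y1; have := vr_indexP Oy y0; rewrite y1 => -[I [f [I1 _ fc]]].
have [i hi] := fc _ (vr1 HO); have [j hj] := fc _ vr0.
have ij : i = j by have /fintype_le1P/(_ i j) : (#|I| <= 1)%N by rewrite I1.
have := (scaledO y).2 _ _ hi hj; rewrite ij opprB subrKA subr0 => -[z Oz yz].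
by rewrite (_ : y^-1 = z)//; apply: (mulfI y0); rewrite divff// yz.
Qed.

Definition vr_abs (x : E) : R :=
  if x == 0 then 0 else if `[< O x >] then (vr_index x)%:R^-1 else (vr_index x^-1)%:R.

Lemma vr_absE a b : O a -> O b -> a != 0 -> b != 0 ->
  vr_abs (a / b) = (vr_index b)%:R / (vr_index a)%:R.
Proof.
move=> Oa Ob a0 b0; have ab0 : a / b != 0 by rewrite mulf_neq0 ?invr_eq0.
have ia : (vr_index a)%:R != 0 :> R by rewrite pnatr_eq0 -lt0n vr_index_gt0.
have ib : (vr_index b)%:R != 0 :> R by rewrite pnatr_eq0 -lt0n vr_index_gt0.
rewrite /vr_abs (negbTE ab0); case: asboolP => Oab.
  have aE : vr_index a = (vr_index (a / b) * vr_index b)%N by rewrite -vr_indexM// divfK.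
  by rewrite aE natrM invfM mulrCA divff// mulr1.
have Oba : O (a / b)^-1 by case: (vr_total HO (a / b)).
have baE : b = (a / b)^-1 * a by rewrite invf_div divfK.
by rewrite [in RHS]baE vr_indexM ?invr_eq0// natrM mulfK.
Qed.

Lemma vr_abs_in x : O x -> x != 0 -> vr_abs x = (vr_index x)%:R^-1.
Proof. by move=> Ox x0; rewrite /vr_abs (negbTE x0); case: asboolP. Qed.

Lemma vr_fracP x : x != 0 -> exists a b, [/\ O a, O b, a != 0, b != 0 & x = a / b].
Proof.
move=> x0; case: (vr_total HO x) => Ox.
  by exists x, 1; split; rewrite ?oner_neq0 ?divr1//; exact: (vr1 HO).
by exists 1, x^-1; split; rewrite ?oner_neq0 ?invr_eq0 ?invrK ?mul1r//; exact: (vr1 HO).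
Qed.

Lemma vr_abs_le1 x : vr_abs x <= 1 <-> O x.
Proof.
have [->|x0] := eqVneq x 0; first by rewrite /vr_abs eqxx; split=> // _; exact: vr0.
rewrite /vr_abs (negbTE x0); case: asboolP => Ox; split=> //.
  by rewrite invf_le1 ?ltr0n ?ler1n ?vr_index_gt0.
have Ox' : O x^-1 by case: (vr_total HO x).
rewrite lern1 => h; have i1 : vr_index x^-1 = 1%N.
  by apply/eqP; rewrite eqn_leq h vr_index_gt0// invr_eq0.
by rewrite -(invrK x); apply: vr_index_unit; rewrite ?invr_eq0.
Qed.

Lemma vr_abs_gt0 x : x != 0 -> 0 < vr_abs x.
Proof.
move=> /vr_fracP[a [b [Oa Ob a0 b0 ->]]].
by rewrite vr_absE// divr_gt0// ltr0n vr_index_gt0.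
Qed.

Lemma vr_absM x y : vr_abs (x * y) = vr_abs x * vr_abs y.
Proof.
have [->|x0] := eqVneq x 0; first by rewrite mul0r /vr_abs eqxx mul0r.
have [->|y0] := eqVneq y 0; first by rewrite mulr0 /vr_abs eqxx mulr0.
have [a [b [Oa Ob a0 b0 ->]]] := vr_fracP x0.
have [a' [b' [Oa' Ob' a0' b0' ->]]] := vr_fracP y0.
rewrite mulf_div !vr_absE ?mulf_neq0//; try exact: (vrM HO).
by rewrite !vr_indexM// !natrM mulf_div.
Qed.

Lemma vr_abs_is_abs : nontrivial_nonarch_abs vr_abs.
Proof.
have a0 : vr_abs 0 = 0 by rewrite /vr_abs eqxx.
have age0 x : 0 <= vr_abs x by have [->|/vr_abs_gt0/ltW//] := eqVneq x 0; rewrite a0.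
have ult x y : x != 0 -> O (y / x) -> vr_abs (x + y) <= vr_abs x.
  move=> x0 Oyx; have -> : x + y = x * (1 + y / x) by rewrite mulrDr mulr1 mulrC divfK.
  rewrite vr_absM ler_piMr//; apply/vr_abs_le1; apply: vrD => //; exact: (vr1 HO).
split=> //.
- move=> x; split=> [h|->//]; apply/eqP/negPn/negP => /vr_abs_gt0.
  by rewrite h ltxx.
- exact: vr_absM.
- move=> x y; rewrite le_max.
  have [->|x0] := eqVneq x 0; first by rewrite add0r lexx orbT.
  have [->|y0] := eqVneq y 0; first by rewrite addr0 lexx.
  case: (vr_total HO (y / x)) => h; first by rewrite ult.
  by rewrite addrC (ult y x) ?orbT//; move: h; rewrite invf_div.
- have [x Ox] := vr_proper HO; exists x; first by apply: contra_notN Ox => /eqP ->; exact: vr0.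
  by apply: contra_notN Ox => /eqP h; apply/vr_abs_le1; rewrite h.
Qed.

Let vabs := vr_abs_is_abs.

(** Indices are natural numbers, so a least one above 1 exists, and it belongs to the largest
    absolute value below 1. *)
Lemma vr_uniformizer : exists pi, [/\ O pi, pi != 0, (1 < vr_index pi)%N &
  forall x, vr_abs x < 1 -> vr_abs x <= vr_abs pi].
Proof.
have ex : exists k, `[< exists y, [/\ O y, y != 0, (1 < vr_index y)%N & vr_index y = k] >].
  have [x x0 x1] := exists_abs_lt1 vabs.
  have Ox : O x by apply/vr_abs_le1; exact: ltW.
  exists (vr_index x); apply/asboolP; exists x; split=> //.
  rewrite ltn_neqAle vr_index_gt0// andbT eq_sym; apply/eqP => i1.
  by move: x1; rewrite vr_abs_in// i1 invr1 ltxx.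
case: (ex_minnP ex) => k /asboolP[pi [Opi pi0 i1 <-]] kmin; exists pi; split=> // x x1.
have [->|x0] := eqVneq x 0; first by rewrite (abs0 vabs) (abs_ge0 vabs).
have Ox : O x by apply/vr_abs_le1; exact: ltW.
have x1' : (1 < vr_index x)%N.
  rewrite ltn_neqAle vr_index_gt0// andbT eq_sym; apply/eqP => ix.
  by move: x1; rewrite vr_abs_in// ix invr1 ltxx.
rewrite !vr_abs_in// lef_pV2 ?posrE ?ltr0n ?vr_index_gt0// ler_nat.
by apply: kmin; apply/asboolP; exists x.
Qed.

Lemma vr_abs_powers : exists pi, [/\ O pi, pi != 0, (1 < vr_index pi)%N,
  forall x, vr_abs x < 1 -> vr_abs x <= vr_abs pi &
  forall x, x != 0 -> exists k : int, vr_abs x = vr_abs pi ^ k].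
Proof.
have [pi [Opi pi0 i1 pimax]] := vr_uniformizer; exists pi; split=> // x x0.
have p0 : 0 < vr_abs pi by exact: vr_abs_gt0.
have c1 : 1 < (vr_abs pi)^-1 by rewrite vr_abs_in// invrK ltr1n.
(* Multiplication by pi^m brings |x| into the interval from 1 to 1/|pi|, the latter excluded. Were
   the result above 1, its inverse would have absolute value strictly between |pi| and 1. *)
have [m /andP[m1 m2]] := exp_sandwich c1 (vr_abs_gt0 x0).
exists (- m); rewrite -exprz_inv; set d := (vr_abs pi)^-1 in c1 m1 m2 *.
have d0 : 0 < d by rewrite (lt_trans _ c1).
have xm : vr_abs (x * pi ^ m) = vr_abs x / d ^ m.
  by rewrite (absM vabs) (absXz vabs) /d exprz_inv -invr_expz invrK.
have dm : 0 < d ^ m by exact: exprz_gt0.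
have ge1 : 1 <= vr_abs (x * pi ^ m) by rewrite xm ler_pdivlMr// mul1r.
have ltd : vr_abs (x * pi ^ m) < d.
  by rewrite xm ltr_pdivrMr// -{1}(expr1z d) -expfzDr ?gt_eqF// addrC.
suff : vr_abs (x * pi ^ m) = 1.
  by rewrite xm => /(congr1 ( *%R^~ (d ^ m))); rewrite divfK ?gt_eqF// mul1r.
apply/eqP; rewrite eq_le ge1 andbT leNgt; apply/negP => gt1.
have gt0 : 0 < vr_abs (x * pi ^ m) by rewrite (lt_trans _ gt1).
have := pimax (x * pi ^ m)^-1; rewrite (absV vabs) invf_lt1// => /(_ gt1).
by apply/negP; rewrite -ltNge -[ltLHS]invrK ltf_pV2 ?posrE.
Qed.

Lemma vr_curve_place : curve_places vr_abs.
Proof.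
have [pi [Opi pi0 i1 pimax vals]] := vr_abs_powers.
split; first exact: vabs.
exists (vr_index pi), pi; split=> //; last by rewrite vr_abs_in.
have [I [f [IN [Of sf] fc]]] := vr_indexP Opi pi0.
have lt1P x : vr_abs x < 1 <-> scaled pi O x.
  rewrite scaledP//; have p0 := vr_abs_gt0 pi0; split=> [/pimax h|/vr_abs_le1].
    by apply/vr_abs_le1; rewrite mulrC (abs_div vabs) ler_pdivrMr// mul1r.
  rewrite mulrC (abs_div vabs) ler_pdivrMr// mul1r => /le_lt_trans; apply.
  by rewrite vr_abs_in// invf_lt1 ?ltr1n// ltr0n ltnW.
have i0 : I by have /card_gt0P/sigW[i0 _] : (0 < #|I|)%N by rewrite IN ltnW.
pose g k := f (nth i0 (enum I) k); rewrite card_eq_sym.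
apply/card_set_bijP; exists (fun k => [set y | vr_abs (y - g k) < 1]); split.
- by move=> k _; exists (g k) => //=; apply/vr_abs_le1; exact: Of.
- move=> k l; rewrite !inE /= -IN cardE => kN lN kl.
  have : [set y | vr_abs (y - g l) < 1] (g k).
    by rewrite -kl /= subrr (abs0 vabs) ltr01.
  move=> /= /lt1P /sf /eqP; rewrite nth_uniq ?enum_uniq//.
  by move=> /eqP.
- move=> _ [x /vr_abs_le1 Ox <-]; have [i hi] := fc _ Ox.
  exists (index i (enum I)); first by rewrite /= -IN cardE index_mem mem_enum.
  have gE : g (index i (enum I)) = f i by rewrite /g nth_index// mem_enum.
  have h1 : vr_abs (x - f i) < 1 by exact/lt1P.
  rewrite gE; apply/seteqP; split=> y /= hy.
    by have := absB_lt vabs hy h1; rewrite opprB subrKA.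
  by have := absD_lt vabs hy h1; rewrite subrKA.
Qed.

End ValuationRing.

Lemma integral_over_base (K : fieldType) (E : fieldExtType K) (x : E) :
  exists p : {poly E}, [/\ p \is monic, root p x & forall i, exists a, p`_i = in_alg E a].
Proof.
exists (minPoly 1 x); split; [exact: monic_minPoly|exact: root_minPoly|move=> i].
have /polyOverP/(_ i)/vlineP[a ha] := minPolyOver 1 x.
by exists a; rewrite ha in_algE.
Qed.

(** Every element of [E] is integral over [K], so an absolute value bounded by 1 on [K] would be
    bounded by 1 on [E]. *)
Lemma abs_below_nontrivial (R : realType) (K : fieldType) (E : fieldExtType K) (w : E -> R) :
  nontrivial_nonarch_abs w -> exists a, 1 < below w a.
Proof.
move=> wabs; apply: contrapT => nl; have [x x1] := exists_abs_gt1 wabs.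
have [p [pm px pa]] := integral_over_base x.
have := abs_root_le1 wabs pm _ px; rewrite leNgt x1 => h.
suff : false by []; apply: h => i; have [a ->] := pa i.
by rewrite leNgt; apply/negP => a1; apply: nl; exists a.
Qed.

Section PlaceOfValRing.
Variables (R : realType) (K : fieldType) (E : fieldExtType K) (O : set E).
Hypothesis HO : val_ring O.

Let OK : set K := [set a | O (in_alg E a)].
Let v := @vr_abs R E O.
Let vabs : nontrivial_nonarch_abs v := vr_abs_is_abs R HO.

Let OKE a : OK a = O (in_alg E a). Proof. by []. Qed.

Lemma val_ring_restrict : val_ring OK.
Proof.
split.
- by rewrite !OKE rmorph1; exact: (vr1 HO).
- by move=> x y; rewrite !OKE rmorphB; exact: (vrB HO).
- by move=> x y; rewrite !OKE rmorphM; exact: (vrM HO).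
- by move=> x; rewrite !OKE fmorphV; exact: (vr_total HO).
- have [a a1] := abs_below_nontrivial vabs; exists a => /(vr_abs_le1 R HO).
  by rewrite leNgt => /negP; apply.
- move=> y Oy y0; have Ey0 : in_alg E y != 0 by rewrite fmorph_eq0.
  have [k hk] := vr_finite HO Oy Ey0.
  have sE := scaled_subgroup (in_alg E y) (vr_subgroup HO).
  have [||l _ hl] := @index_exists _ OK (scaled y OK) k.
  + apply: scaled_subgroup; split; first by rewrite !OKE rmorph0; exact: vr0.
    by move=> a b; rewrite !OKE rmorphB; exact: (vrB HO).
  + move=> I f [Of sf]; apply: (separated_le (f := in_alg E \o f) sE _ hk).
    split=> [i|i j]; first exact: Of.
    rewrite -[_ - _]/(in_alg E (f i) - in_alg E (f j)) -rmorphB => /(scaledP _ _ Ey0).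
    by rewrite -fmorphV -rmorphM => h; apply: sf; apply/(scaledP _ _ y0).
  by exists l.
Qed.

Let u := @vr_abs R K OK.
Let uabs : nontrivial_nonarch_abs u := vr_abs_is_abs R val_ring_restrict.

(** The absolute value normalized on [E] restricts to a power of the one normalized on [K], whereas
    a place above a closed point must restrict to the latter exactly; an exponent corrects this. *)
Lemma place_of_val_ring : exists w : E -> R,
  places_above (@curve_places R K) w /\ forall x, w x <= 1 <-> O x.
Proof.
have [pi [Opi pi0 i1 pimax vals]] := vr_abs_powers R val_ring_restrict.
have uP a : u a <= 1 <-> v (in_alg E a) <= 1.
  by rewrite (vr_abs_le1 R val_ring_restrict) (vr_abs_le1 R HO).
have u0 : 0 < u pi by exact: abs_gt0.
have u1 : u pi < 1 by rewrite /u vr_abs_in// invf_lt1 ?ltr1n// ltr0n ltnW.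
have v0 : 0 < v (in_alg E pi) by rewrite abs_gt0// fmorph_eq0.
have v1 : v (in_alg E pi) < 1.
  rewrite ltNge; apply/negP => v1; have : u pi^-1 <= 1.
    by apply/uP; rewrite fmorphV (absV vabs) invf_le1.
  by rewrite (absV uabs) invf_le1// leNgt u1.
have lu : ln (u pi) < 0 by rewrite ln_lt0 // u0.
have lv : ln (v (in_alg E pi)) < 0 by rewrite ln_lt0 // v0.
(* [mu] adjusts the value at a uniformizer of the valuation ring of [K]; every nonzero element of
   [K] is a power of it times a unit. *)
pose mu := ln (u pi) / ln (v (in_alg E pi)).
have mu0 : 0 < mu by rewrite /mu -divrNN divr_gt0 // oppr_gt0.
pose w x := v x `^ mu.
have wpi : w (in_alg E pi) = u pi.
  rewrite /w /powR gt_eqF// /mu divfK ?lt_eqF// lnK//.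
have wu a : w (in_alg E a) = u a.
  have [->|a0] := eqVneq a 0; first by rewrite rmorph0 /w !abs0// powR0// gt_eqF.
  have [k uk] := vals a a0; rewrite -/u in uk.
  have ea : u (a / pi ^ k) = 1 by rewrite (abs_div uabs) (absXz uabs) uk divff// expfz_neq0// gt_eqF.
  have va : v (in_alg E (a / pi ^ k)) = 1.
    have n0 : a / pi ^ k != 0 by rewrite mulf_neq0 ?invr_eq0 ?expfz_neq0.
    apply/eqP; rewrite eq_le; apply/andP; split; first by apply/uP; rewrite ea.
    have : v (in_alg E (a / pi ^ k)^-1) <= 1 by apply/uP; rewrite (absV uabs) ea invr1.
    by rewrite fmorphV (absV vabs) invf_le1// abs_gt0// fmorph_eq0.
  have -> : in_alg E a = in_alg E (a / pi ^ k) * in_alg E pi ^ k.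
    by rewrite -fmorphXz -rmorphM divfK// expfz_neq0.
  rewrite /w (absM vabs) va mul1r (absXz vabs) -powR_intmul ?ltW// powRAC -/(w _).
  by rewrite wpi powR_intmul ?ltW.
have p1 : 1 `^ mu = 1 :> R by rewrite powR1.
have w1 x : w x <= 1 <-> O x.
  rewrite -(vr_abs_le1 R HO) -/v; split=> h.
    rewrite leNgt; apply/negP => vx; move: h; rewrite leNgt => /negP; apply.
    by rewrite -p1 /w gt0_ltr_powR// nnegrE// ltW// (lt_trans _ vx).
  rewrite -p1 /w; apply: ge0_ler_powR => //; first exact: ltW.
    by rewrite nnegrE (abs_ge0 vabs).
  by rewrite nnegrE.
exists w; split=> //; split; last first.
  have -> : below w = u by apply/funext => a; exact: wu.
  exact: vr_curve_place val_ring_restrict.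
split.
- by move=> x; exact: powR_ge0.
- move=> x; split=> [/eqP|->]; last by rewrite /w (abs0 vabs) powR0// gt_eqF.
  by rewrite /w powR_eq0 (gt_eqF mu0) /= andbT => /eqP/(abs_eq0 vabs).
- by move=> x y; rewrite /w (absM vabs) powRM// (abs_ge0 vabs).
- move=> x y; have mono a b : v a <= v b -> w a <= w b.
    by move=> ab; apply: ge0_ler_powR => //; rewrite ?nnegrE ?(abs_ge0 vabs)// ltW.
  rewrite le_max; apply/orP; have /orP[h|h] : (v (x + y) <= v x) || (v (x + y) <= v y).
  + by rewrite -le_max; exact: (abs_ultra vabs).
  + by left; exact: mono.
  + by right; exact: mono.
- exists (in_alg E pi); first by rewrite fmorph_eq0.
  by rewrite wpi lt_eqF.
Qed.

End PlaceOfValRing.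

(** * Maximal subrings in which a given element is not invertible *)

Section Chevalley.
Variables (F : finFieldType) (E : fieldType) (c : {rmorphism F -> E}) (s : E).
Hypothesis ts : transcendental c s.
Hypothesis frs : finite_rank c s.

Let good (A : set E) := [/\ A 1, (forall x y, A x -> A y -> A (x - y)),
  (forall x y, A x -> A y -> A (x * y)), (forall a, A (c a)) &
  A s /\ forall x, A x -> s * x != 1].

Let s_neq0 : s != 0.
Proof.
apply/eqP => s0; have := ts (p := 'X); rewrite pevalX => /(_ s0)/eqP.
by rewrite polyX_eq0.
Qed.

Let good_base : good [set x | exists p, x = peval c s p].
Proof.
split.
- by exists 1; rewrite peval1.
- by move=> _ _ [p ->] [r ->]; exists (p - r); rewrite pevalB.
- by move=> _ _ [p ->] [r ->]; exists (p * r); rewrite pevalM.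
- by move=> a; exists a%:P; rewrite pevalC.
- split; first by exists 'X; rewrite pevalX.
  move=> _ [p ->]; apply/eqP => h; have /ts/eqP : peval c s ('X * p - 1) = 0.
    by rewrite pevalB pevalM pevalX peval1 h subrr.
  rewrite subr_eq0 => /eqP/(congr1 (fun p : {poly F} => p`_0)).
  by rewrite coefXM coefC eqxx => /eqP; rewrite eq_sym oner_eq0.
Qed.

Let maximal : exists A, good A /\ forall B, good B -> A `<=` B -> B = A.
Proof.
have [|A [PA Amax]] := @Zorn_bigcup E [set A | A = set0 \/ good A].
  move=> C CP Ctot; have [[X CX gX]|nX] := pselect (exists2 X, C X & good X); last first.
    left; apply/seteqP; split=> // x [X CX Xx]; case: (CP X CX) => [X0|gX].
      by rewrite X0 in Xx.
    by exfalso; apply: nX; exists X.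
  right.
  have common x y : (\bigcup_(Y in C) Y) x -> (\bigcup_(Y in C) Y) y ->
      exists Y, [/\ C Y, good Y, Y x & Y y].
    move=> [Y CY Yx] [Z CZ Zy]; case: (Ctot Y Z CY CZ) => h.
      exists Z; split=> //; last exact: h.
      by case: (CP Z CZ) => // Z0; rewrite Z0 in Zy.
    exists Y; split=> //; last exact: h.
    by case: (CP Y CY) => // Y0; rewrite Y0 in Yx.
  have [X1 XB XM XF [Xs Xn]] := gX; split.
  - by exists X.
  - move=> x y hx hy; have [Y [CY [_ YB _ _ _] Yx Yy]] := common x y hx hy.
    by exists Y => //; exact: YB.
  - move=> x y hx hy; have [Y [CY [_ _ YM _ _] Yx Yy]] := common x y hx hy.
    by exists Y => //; exact: YM.
  - by move=> a; exists X.
  - split; first by exists X.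
    by move=> x hx; have [Y [CY [_ _ _ _ [_ Yn]] Yx _]] := common x x hx hx; exact: Yn.
case: PA => [A0|gA].
  exfalso; apply: (Amax [set x | exists p, x = peval c s p]); last by right.
  rewrite A0; split=> // h; have : set0 (1 : E) by apply: h; exists 1; rewrite peval1.
  by [].
exists A; split=> // B gB AB; apply: contrapT => BA; apply: (Amax B); last by right.
by split=> // BA'; apply: BA; apply/seteqP; split.
Qed.

Section Maximal.
Variable A : set E.
Hypothesis gA : good A.
Hypothesis Amax : forall B, good B -> A `<=` B -> B = A.

Let A1 : A 1. Proof. by case: gA. Qed.
Let AB x y : A x -> A y -> A (x - y). Proof. by case: gA => _ h _ _ _; exact: h. Qed.
Let AM x y : A x -> A y -> A (x * y). Proof. by case: gA => _ _ h _ _; exact: h. Qed.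
Let AF a : A (c a). Proof. by case: gA => _ _ _ h _; exact: h. Qed.
Let As : A s. Proof. by case: gA => _ _ _ _ []. Qed.
Let An x : A x -> s * x != 1. Proof. by case: gA => _ _ _ _ [_ h]; exact: h. Qed.
Let A0 : A 0. Proof. by rewrite -(subrr 1); exact: AB. Qed.
Let Asub : subgroup A. Proof. by []. Qed.
Let AD x y : A x -> A y -> A (x + y). Proof. exact: subgroupD Asub. Qed.
Let AX x n : A x -> A (x ^+ n).
Proof. by move=> Ax; elim: n => [|n ih]; rewrite ?expr0// exprS; exact: AM. Qed.

Let adjoin x : set E := [set y | exists p : {poly E}, (forall i, A p`_i) /\ y = p.[x]].

Let adjoin_coefM (p r : {poly E}) i : (forall i, A p`_i) -> (forall i, A r`_i) -> A (p * r)`_i.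
Proof.
move=> hp hr; rewrite coefM; apply: subgroup_sum => // j _; exact: AM.
Qed.

(** The ring A[x] fails to be [good] only if [s] becomes invertible in it; otherwise maximality
    makes it equal to [A]. *)
Let adjoin_max x : A x \/ exists p : {poly E}, (forall i, A p`_i) /\ s * p.[x] = 1.
Proof.
have [h|h] := pselect (exists p : {poly E}, (forall i, A p`_i) /\ s * p.[x] = 1); [by right|left].
have AC a : A a -> forall i, A (a%:P)`_i by move=> Aa i; rewrite coefC; case: ifP.
suff <- : adjoin x = A.
  by exists 'X; rewrite hornerX; split=> // i; rewrite coefX; case: (i == 1%N).
apply: Amax.
  split.
  - by exists 1; rewrite hornerC; split=> //; exact: AC.
  - move=> _ _ [p [hp ->]] [r [hr ->]]; exists (p - r); rewrite hornerD hornerN; split=> // i.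
    by rewrite coefB; exact: AB.
  - move=> _ _ [p [hp ->]] [r [hr ->]]; exists (p * r); rewrite hornerM; split=> // i.
    exact: adjoin_coefM.
  - by move=> a; exists (c a)%:P; rewrite hornerC; split=> //; exact: AC.
  - split; first by exists s%:P; rewrite hornerC; split=> //; exact: AC.
    by move=> _ [p [hp ->]]; apply/eqP => h1; apply: h; exists p.
by move=> a Aa; exists a%:P; rewrite hornerC; split=> //; exact: AC.
Qed.

Let A_local x : A x -> A (1 - s * x)^-1.
Proof.
move=> Ax; set u := 1 - s * x; have Au : A u by apply: AB => //; exact: AM.
have u0 : u != 0.
  apply: contraTneq (An Ax) => /eqP; rewrite subr_eq0 => /eqP <-.
  by rewrite eqxx.
case: (adjoin_max u^-1) => // -[p [hp hs]]; exfalso.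
(* [1 = s p(1/u)] gives [u^n = s a] with [a] in [A]; and [u^n] is [1] modulo [s A]. *)
have [a [Aa ua]] : exists a, A a /\ u ^+ size p = s * a.
  exists (\sum_(i < size p) p`_i * u ^+ (size p - i)); split.
    by apply: subgroup_sum => // i _; apply: AM => //; exact: AX.
  rewrite -[LHS]mul1r -hs horner_coef -mulrA; congr (_ * _); rewrite mulr_suml.
  apply: eq_bigr => i _; rewrite -mulrA; congr (_ * _).
  by rewrite exprVn mulrC -expfB_cond// ?subnn// (negbTE u0) add0n ltnW.
have [b [Ab ub]] : exists b, A b /\ u ^+ size p = 1 - s * b.
  elim: (size p) => [|n [b [Ab ub]]]; first by exists 0; rewrite mulr0 subr0.
  exists (x + b - s * x * b); split.
    by apply: AB; [exact: AD|apply: AM => //; exact: AM].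
  by rewrite exprS ub /u; ring.
have := An (AD Aa Ab); rewrite mulrDr -ua ub subrK eqxx.
by [].
Qed.
Let peval_A p : A (peval c s p).
Proof.
rewrite /peval horner_coef; apply: subgroup_sum => // i _.
by rewrite coef_map; apply: AM; [exact: AF|exact: AX].
Qed.

(* The leading power of [x] in the relation [s p(x) = 1] is eliminated by
   means of the relation [s r(1/x) = 1], whose constant term is a unit away
   from [1]. *)
Let reduce x (p r : {poly E}) : x != 0 -> (forall i, A p`_i) -> (forall i, A r`_i) ->
  s * p.[x] = 1 -> s * r.[x^-1] = 1 -> (0 < size r <= size p)%N ->
  exists p' : {poly E}, [/\ forall i, A p'`_i, s * p'.[x] = 1 & (size p' < size p)%N].
Proof.
move=> x0 hp hr sp sr; case Er: (size r) => [//|m]; case Ep: (size p) => [//|n] /= mn.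
set u := 1 - s * r`_0; have Au : A u^-1 by exact: A_local.
have u0 : u != 0 by rewrite subr_eq0 eq_sym An.
have ux : x ^+ n = s * u^-1 * \sum_(j < m) r`_j.+1 * x ^+ (n - j.+1).
  have : u = s * \sum_(j < m) r`_j.+1 * x^-1 ^+ j.+1.
    rewrite /u -sr horner_coef Er big_ord_recl expr0 mulr1 mulrDr addrC addKr.
    by congr (_ * _); apply: eq_bigr.
  move=> /(congr1 (fun z => u^-1 * z * x ^+ n)); rewrite mulVf// mul1r => ->.
  rewrite [s * u^-1]mulrC -!mulrA; congr (_ * (_ * _)); rewrite mulr_suml.
  apply: eq_bigr => j _; rewrite -mulrA; congr (_ * _); rewrite exprVn.
  by rewrite mulrC -expfB_cond// (negbTE x0) add0n (leq_trans (ltn_ord j)).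
pose t : {poly E} := \sum_(j < m) (p`_n * s * u^-1 * r`_j.+1) *: 'X^(n - j.+1).
pose p1 : {poly E} := \sum_(i < n) p`_i *: 'X^i.
have small (q : nat) (g : E) : (q < n)%N -> (size (g *: 'X^q : {poly E}) <= n)%N.
  by move=> qn; rewrite (leq_trans (size_scale_leq _ _))// size_polyXn.
have Amono (q : nat) (g : E) i : A g -> A (g *: 'X^q : {poly E})`_i.
  by move=> Ag; rewrite coefZ coefXn; case: (i == q); rewrite ?mulr1 ?mulr0.
exists (p1 + t); split.
- move=> i; rewrite coefD; apply: AD; rewrite coef_sum; apply: subgroup_sum => // j _.
    exact: Amono.
  by apply: Amono; apply: AM => //; apply: AM => //; apply: AM.
- rewrite -[RHS]sp; congr (_ * _); rewrite [in RHS]horner_coef Ep big_ord_recr /= hornerD.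
  congr (_ + _); first by rewrite horner_sum; apply: eq_bigr => i _; rewrite hornerZ hornerXn.
  rewrite ux horner_sum mulr_sumr mulr_sumr; apply: eq_bigr => j _.
  by rewrite hornerZ hornerXn !mulrA.
- rewrite ltnS (leq_trans (size_polyD _ _))// geq_max; apply/andP; split.
    by apply: (leq_trans (size_sum _ _ _)); apply/bigmax_leqP => i _; exact: small.
  apply: (leq_trans (size_sum _ _ _)); apply/bigmax_leqP => i _; apply: small.
  by rewrite ltn_subrL /= (leq_ltn_trans (leq0n i))// (leq_trans (ltn_ord i)).
Qed.

(** Descent on the sum of the sizes: the longer relation is shortened by means of the other, the
    roles of x and 1/x being symmetric. *)
Let no_common x (p r : {poly E}) : x != 0 -> (forall i, A p`_i) -> (forall i, A r`_i) ->
  s * p.[x] = 1 -> s * r.[x^-1] = 1 -> False.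
Proof.
have [N] := ubnP (size p + size r)%N; elim: N x p r => // N ih x p r hN x0 hp hr sp sr.
have size_gt0 (g : {poly E}) z : s * g.[z] = 1 -> (0 < size g)%N.
  move=> h; rewrite lt0n size_poly_eq0; apply/eqP => g0.
  by move: h; rewrite g0 horner0 mulr0 => /eqP; rewrite eq_sym oner_eq0.
have [rp|pr] := leqP (size r) (size p).
  have [|p' [hp' sp' lt]] := reduce x0 hp hr sp sr; first by rewrite (size_gt0 _ _ sr).
  by apply: (ih x p' r) => //; move: hN lt; rewrite ltnS; lia.
have x0' : x^-1 != 0 by rewrite invr_eq0.
rewrite -(invrK x) in sp.
have [|r' [hr' sr' lt]] := reduce x0' hr hp sr sp; first by rewrite (size_gt0 _ _ sp) ltnW.
by rewrite invrK in sp; apply: (ih x p r') => //; move: hN lt; rewrite ltnS; lia.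
Qed.

Let A_total x : A x \/ A x^-1.
Proof.
have [->|x0] := eqVneq x 0; first by left.
case: (adjoin_max x) => [|[p [hp sp]]]; first by left.
case: (adjoin_max x^-1) => [|[r [hr sr]]]; first by right.
by exfalso; exact: no_common sp sr.
Qed.

(** Take an algebraic relation for 1/y over F[s] with top coefficient s^e g(s), where g has nonzero
    constant term. Then g(s) is a unit of [A] by [A_local], and multiplying the relation by a power
    of [y] leaves s^e g(s) / y as a combination of elements of [A]. *)
Let A_archimedean y : A y -> y != 0 -> exists m, A (s ^+ m / y).
Proof.
move=> Ay y0; have [N [p [hp [i0 pi0]]]] := finite_rank_algebraic y^-1 ts frs.
have ex : exists k, `[< exists i : 'I_N, p i != 0 /\ val i = k >].
  by exists i0; apply/asboolP; exists i0.
have bd k : `[< exists i : 'I_N, p i != 0 /\ val i = k >] -> (k <= N)%N.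
  by move=> /asboolP[i [_ <-]]; exact/ltnW/ltn_ord.
case: (ex_maxnP ex bd) => k /asboolP[i [pi ik]] kmax.
have ptop (j : 'I_N) : (i < j)%N -> p j = 0.
  move=> ij; apply/eqP/negPn/negP => pj; have := kmax j; rewrite -ik leqNgt ij => h.
  by have : false by apply: h; apply/asboolP; exists j.
have [e [g [ge g0]]] : exists e (g : {poly F}), p i = 'X^e * g /\ g`_0 != 0.
  move: (p i) pi => f; have [n] := ubnP (size f); elim: n f => // n ih f fn f0.
  have [f00|f00] := eqVneq (f`_0) 0; last by exists 0%N, f; rewrite expr0 mul1r.
  have [f' [fE _]] := poly_split0 f; rewrite f00 addr0 in fE.
  have f'0 : f' != 0 by apply: contra_neq f0 => h; rewrite fE h mul0r.
  have [|e [g [hg g0]]] := ih f' _ f'0; first by move: fn; rewrite fE size_mulX.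
  by exists e.+1, g; split=> //; rewrite fE hg exprS; ring.
have gu : A (peval c s g)^-1.
  have [g' [gE _]] := poly_split0 g.
  have -> : (peval c s g)^-1 = (c (g`_0))^-1 * (1 - s * (- (c (g`_0))^-1 * peval c s g'))^-1.
    have c0 : c (g`_0) != 0 by rewrite fmorph_eq0.
    rewrite -invfM; congr (_^-1); rewrite {1}gE pevalD pevalM pevalX pevalC.
    by field.
  have AcV a : A (c a)^-1 by rewrite -(fmorphV c); exact: AF.
  apply: AM => //; apply: A_local; apply: AM => //.
  by rewrite -[X in A X]sub0r; exact: AB.
have gn0 : peval c s g != 0.
  by apply/eqP => /ts gz; move: g0; rewrite gz coef0 eqxx.
exists e; rewrite -[_ / y](mulKf gn0); apply: AM => //.
case Ei: (val i) => [|n].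
  exfalso; move: hp; rewrite (bigD1 i)//= big1 ?addr0 => [|j ji]; last first.
    by rewrite ptop ?peval0 ?mul0r// Ei lt0n -Ei; apply: contra ji => /eqP/val_inj ->.
  by rewrite Ei expr0 mulr1 => /ts/eqP; rewrite (negbTE pi).
have -> : peval c s g * (s ^+ e / y) =
    - \sum_(j | j != i) peval c s (p j) * (y^-1 ^+ j * y ^+ n).
  apply/eqP; rewrite -addr_eq0; apply/eqP.
  transitivity (y ^+ n * \sum_j peval c s (p j) * y^-1 ^+ j); last by rewrite hp mulr0.
  rewrite [in RHS](bigD1 i)//= mulrDr mulr_sumr; congr (_ + _); last first.
    by apply: eq_bigr => j _; rewrite [LHS]mulrA mulrC.
  rewrite ge pevalM peval_exp pevalX Ei exprS.
  have -> : y ^+ n * (s ^+ e * peval c s g * (y^-1 * y^-1 ^+ n)) =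
    peval c s g * (s ^+ e / y) * (y ^+ n * y^-1 ^+ n) by ring.
  by rewrite -exprMn divff// expr1n mulr1.
apply: subgroupN => //; apply: subgroup_sum => // j ji.
have [ij|ij] := ltnP i j; first by rewrite ptop// peval0 mul0r.
apply: AM => //.
have jn : (j <= n)%N.
  by rewrite -ltnS -Ei ltn_neqAle ij andbT; apply: contra ji => /eqP/val_inj ->.
by rewrite exprVn mulrC -expfB_cond ?(negbTE y0) ?add0n//; exact: AX.
Qed.

Let A_finite_s m : exists k, index_eq A (scaled (s ^+ m) A) k.
Proof.
have [I [f [_ h1]]] := index_poly_module s_neq0 Asub (fun a x => AM (AF a)) (fun x => AM As) frs.
elim: m => [|m [k hk]].
  exists 1%N, unit, (fun=> 0); split; rewrite ?card_unit//; first by split=> [//|[] []].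
  by move=> x Ax; exists tt; exists x; rewrite // expr0 mul1r subr0.
exists (k * #|F| ^ #|I|)%N; apply: indexM hk _ => //; try exact: scaled_subgroup.
- by move=> _ [x Ax <-]; apply: AM => //; exact: AX.
- move=> _ [x Ax <-]; exists (s * x); first exact: AM.
  by rewrite exprSr mulrA.
by rewrite exprSr -scaledM; apply: index_scaled => //; exact: expf_neq0.
Qed.

(** As [y] divides some s^m in [A], the quotient by [y] is a quotient of the finite A / s^m A. *)
Lemma maximal_val_ring : val_ring A /\ A s /\ ~ A s^-1.
Proof.
have sV : ~ A s^-1 by move=> /An; rewrite divff ?eqxx.
split; last by split.
split=> //; first by exists s^-1.
move=> y Ay y0; have [m hm] := A_archimedean Ay y0; have [k hk] := A_finite_s m.
have sub : scaled (s ^+ m) A `<=` scaled y A.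
  move=> _ [x Ax <-]; exists (s ^+ m / y * x); first exact: AM.
  by rewrite mulrA mulrCA divff// mulr1.
have [l _ hl] := index_coarse (scaled_subgroup y Asub) (scaled_subgroup _ Asub) sub hk.
by exists l.
Qed.

End Maximal.

Lemma exists_val_ring : exists A, val_ring A /\ A s /\ ~ A s^-1.
Proof. by have [A [gA Amax]] := maximal; exists A; exact: maximal_val_ring. Qed.

End Chevalley.

(** * The product formula *)

Section ZeroPoleDegrees.
Variables (R : realType) (F : finFieldType) (E : fieldType) (c : {rmorphism F -> E}).

(** The elements integral at all [w i] form a module [X] over F[y], and X / yX has order a power of
    #|F| controlled by an independent family. Weak approximation lifts any choice of residues modulo
    [y] at the [w i] to [X]. *)
Lemma zero_degree_le (y : E) (I : finType) (w : I -> E -> R) (k : I -> nat) :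
  y != 0 -> finite_rank c y ->
  (forall i, nontrivial_nonarch_abs (w i)) ->
  (forall i j, i != j -> exists a, w i a < 1 /\ 1 < w j a) ->
  (forall i a, w i (c a) <= 1) -> (forall i, w i y <= 1) ->
  (forall i, abs_index (w i) y (k i)) ->
  exists (J : finType) (f : J -> E), poly_indep c y f /\ (\prod_i k i <= #|F| ^ #|J|)%N.
Proof.
move=> y0 fr wabs wsep wF wy hk; pose X : set E := [set x | forall i, w i x <= 1].
have sX : subgroup X.
  split=> [i|x z Xx Xz i]; first by rewrite (abs0 (wabs i)).
  by apply: (absB_le (wabs i)).
have FX a x : X x -> X (c a * x).
  by move=> Xx i; rewrite (absM (wabs i)) mulr_ile1 ?(abs_ge0 (wabs i)).
have yX x : X x -> X (y * x).
  by move=> Xx i; rewrite (absM (wabs i)) mulr_ile1 ?(abs_ge0 (wabs i)).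
have [J [f [findep hidx]]] := index_poly_module y0 sX FX yX fr.
exists J, f; split=> //.
pose T i : finType := projT1 (cid (hk i)).
pose GP i (g : T i -> E) := [/\ #|T i| = k i, separated (ball_set (w i) 1) (ball_set (w i) (w i y)) g
    & forall x, ball_set (w i) 1 x -> exists j, ball_set (w i) (w i y) (x - g j)].
have gex i : exists g, GP i g := projT2 (cid (hk i)).
pose g i := projT1 (cid (gex i)); have gP i : GP i (g i) := projT2 (cid (gex i)).
have e0 : 0 < \big[Num.min/1]_i w i y.
  elim/big_ind: _ => // [x z|i _]; last exact: abs_gt0.
  by rewrite lt_min => -> ->.
have ei i : \big[Num.min/1]_i w i y <= w i y by rewrite (bigD1 i)//= ge_min lexx.
have [h hh] := choice (fun a : {dffun forall i, T i} =>
  weak_approximation wabs wsep (fun i => g i (a i)) e0).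
have sy := scaled_subgroup y sX.
have hsep : separated X (scaled y X) h.
  split=> [a i|a a' /(scaledP _ _ y0) aa'].
    rewrite -(subrK (g i (a i)) (h a)); apply: (absD_le (wabs i)).
      by rewrite ltW// (lt_le_trans (hh a i))// (le_trans (ei i)).
    by have [_ [g1 _] _] := gP i; exact: g1.
  apply/ffunP => i; have [_ [_ gs] _] := gP i; apply: gs; rewrite /ball_set /=.
  have -> : g i (a i) - g i (a' i) = (h a - h a') - ((h a - g i (a i)) - (h a' - g i (a' i))).
    by ring.
  apply: (absB_le (wabs i)).
    have := aa' i; rewrite mulrC (abs_div (wabs i)) ler_pdivrMr ?mul1r//.
    exact: abs_gt0.
  apply: (absB_le (wabs i)); rewrite ltW// (lt_le_trans _ (ei i))//; exact: hh.
have := separated_le sy hsep hidx; rewrite card_dep_ffun.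
rewrite (_ : foldr _ _ _ = (\prod_i k i)%N)// foldrE big_map big_enum.
by apply: eq_bigr => i _; have [] := gP i.
Qed.

(* The combinations [sum_j P_j(y) b_j] with [size P_j <= D] are separated, up
   to a bounded number of elements without poles, by their polar parts. *)
Lemma le_pole_degree (W : set (E -> R)) (y : E) (J : finType) (b : J -> E)
    (I : finType) (w : I -> E -> R) (n : I -> nat) (w0 : E -> R) (p : E) (N : nat) :
  (forall v, W v -> nontrivial_nonarch_abs v) ->
  (forall v a, W v -> v (c a) <= 1) ->
  poly_indep c y b ->
  (forall i, W (w i)) ->
  (forall v, W v -> (exists i, v = w i) \/ (v y <= 1 /\ forall j, v (b j) <= 1)) ->
  (forall i z, z != 0 -> w i z <= 1 -> exists2 k, abs_index (w i) z k & k%:R = (w i z)^-1 ^+ n i) ->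
  W w0 -> w0 p < 1 -> abs_index w0 p N ->
  (forall z, (forall v, W v -> v z <= 1) -> w0 z < 1 -> z = 0) ->
  #|F|%:R ^+ #|J| <= \prod_i Num.max 1 (w i y) ^+ n i.
Proof.
move=> Wabs WF bindep wW Wgood hk W0 p1 hp L0.
have wabs i := Wabs _ (wW i); have w0abs := Wabs _ W0.
have zP i : exists z, 1 <= w i z /\ forall j, w i (b j) <= w i z.
  have [z hz] := exists_abs_gt (wabs i) (1 + \sum_j w i (b j)).
  have s0 : 0 <= \sum_j w i (b j) by rewrite sumr_ge0// => j _; exact: (abs_ge0 (wabs i)).
  exists z; split=> [|j]; first by rewrite ltW// (le_lt_trans _ hz)// lerDl.
  rewrite ltW// (le_lt_trans _ hz)// (bigD1 j)//= addrCA lerDl addr_ge0//.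
  by rewrite sumr_ge0// => l _; exact: (abs_ge0 (wabs i)).
have [z hz] := choice zP.
(* The [z i] absorb the poles of the [b j], and [N] counts the residues modulo [p] at [w0]; neither
   depends on [D]. Writing [N.+1] makes [C] positive at once. *)
pose C : R := N.+1%:R * \prod_i w i (z i) ^+ n i.
have C0 : 0 < C.
  rewrite mulr_gt0// prodr_gt0// => i _; rewrite exprn_gt0//.
  by rewrite (lt_le_trans _ (hz i).1).
have m1 i : 1 <= Num.max 1 (w i y) by rewrite le_max lexx.
have X0 : 0 < \prod_i Num.max 1 (w i y) ^+ n i.
  by rewrite prodr_gt0// => i _; rewrite exprn_gt0// (lt_le_trans _ (m1 i)).
apply: (le_of_pow_le _ X0 C0) => [|D]; first by rewrite exprn_ge0.
(* Bounds every combination at [w i], so that the class modulo the unit ball takes at most |u i|^(n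
   i) values. *)
pose u i := if 1 < w i y then z i * y ^+ D else z i.
have wu i : w i (u i) = w i (z i) * Num.max 1 (w i y) ^+ D.
  rewrite /u maxElt; case: ifP => _; last by rewrite expr1n mulr1.
  by rewrite (absM (wabs i)) (absX (wabs i)).
have u1 i : 1 <= w i (u i) by rewrite wu mulr_ege1 ?exprn_ege1//; exact: (hz i).1.
have u0 i : u i != 0 by apply: (abs_neq0 (wabs i)); rewrite (lt_le_trans _ (u1 i)).
pose x (A : 'M[F]_(#|J|, D)) := \sum_j peval c y (rVpoly (row (enum_rank j) A)) * b j.
have peval_le (v : E -> R) (f : {poly F}) e : W v -> v y <= e -> 1 <= e -> (size f <= D)%N ->
    v (peval c y f) <= e ^+ D.
  move=> Wv ve e1 fD; have va := Wabs _ Wv; rewrite /peval horner_coef.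
  apply: (abs_sum_le va) => [|i _]; first by rewrite exprn_ge0// (le_trans ler01).
  rewrite (absM va) coef_map (absX va) -[leRHS]mul1r ler_pM ?exprn_ge0 ?(abs_ge0 va)//.
    exact: WF.
  have iD : (i <= D)%N by rewrite (leq_trans (ltnW (ltn_ord i)))// size_map_poly.
  apply: (@le_trans _ _ (e ^+ i)); first by apply: expr_le => //; exact: (abs_ge0 va).
  exact: ler_weXn2l.
have xu i A : ball_set (w i) (w i (u i)) (x A).
  rewrite /ball_set /= wu; apply: (abs_sum_le (wabs i)) => [|j _].
    by rewrite mulr_ge0 ?(abs_ge0 (wabs i))// exprn_ge0// (le_trans ler01).
  rewrite (absM (wabs i)) mulrC ler_pM ?(abs_ge0 (wabs i))//; first exact: (hz i).2.
  apply: peval_le => //; last by rewrite size_poly.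
  by rewrite le_max lexx orbT.
have xgood v A : W v -> v y <= 1 -> (forall j, v (b j) <= 1) -> v (x A) <= 1.
  move=> Wv vy vb; have va := Wabs _ Wv; apply: (abs_sum_le va) => // j _.
  rewrite (absM va) mulr_ile1 ?(abs_ge0 va)//.
  by rewrite -(expr1n _ D); apply: peval_le => //; rewrite size_poly.
have x_inj A B : x A = x B -> A = B.
  move=> /eqP; rewrite -subr_eq0 => /eqP xAB.
  apply/row_matrixP => r; apply: (can_inj (@rVpolyK _ _)); apply/eqP; rewrite -subr_eq0.
  have := bindep (fun j => rVpoly (row (enum_rank j) A) - rVpoly (row (enum_rank j) B)) _ (enum_val r).
  rewrite enum_valK => -> //; rewrite -[RHS]xAB -sumrB.
  by apply: eq_bigr => i _; rewrite pevalB mulrBl.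
have kP i : exists (T : finType) (g : T -> E), #|T|%:R = w i (u i) ^+ n i /\
    forall a, ball_set (w i) (w i (u i)) a -> exists t, ball_set (w i) 1 (a - g t).
  have [||k hki kE] := hk i (u i)^-1; first by rewrite invr_eq0.
    by rewrite (absV (wabs i)) invf_le1// (lt_le_trans _ (u1 i)).
  have := abs_index_ball (b := 1) (wabs i) (u0 i) (oner_neq0 _).
  rewrite mul1r => /(_ _ hki) [T [g [Tk _ gc]]]; exists T, g; split.
    by rewrite Tk kE (absV (wabs i)) invrK.
  by move=> a /gc[t]; rewrite (abs1 (wabs i)) => ht; exists t.
pose T i : finType := projT1 (cid (kP i)).
pose GP i (g : T i -> E) := #|T i|%:R = w i (u i) ^+ n i /\
    forall a, ball_set (w i) (w i (u i)) a -> exists t, ball_set (w i) 1 (a - g t).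
have gex i : exists g, GP i g := projT2 (cid (kP i)).
pose g i := projT1 (cid (gex i)); have gP i : GP i (g i) := projT2 (cid (gex i)).
have clsP A i : exists t : T i, ball_set (w i) 1 (x A - g i t) by exact: (gP i).2 (xu i A).
pose cls (A : 'M[F]_(#|J|, D)) : {dffun forall i, T i} := [ffun i => projT1 (cid (clsP A i))].
have cls_eq A B : cls A = cls B -> forall v, W v -> v (x A - x B) <= 1.
  move=> AB v Wv; have va := Wabs _ Wv.
  have [[i ->]|[vy vb]] := Wgood v Wv; last by apply: (absB_le va); exact: xgood.
  have := projT2 (cid (clsP A i)); have := projT2 (cid (clsP B i)).
  have := congr1 (fun a : {dffun forall i, T i} => a i) AB; rewrite !ffunE => ->.
  by move=> h1 h2; have := absB_le (wabs i) h2 h1; rewrite opprB subrKA.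
pose rep (a : {dffun forall i, T i}) := if [pick A | cls A == a] is Some A then A else 0.
have repP A : cls (rep (cls A)) = cls A.
  by rewrite /rep; case: pickP => [B /eqP//|/(_ A)]; rewrite eqxx.
have [T0 [g0 [T0N _ g0c]]] := hp.
have resP A : exists t : T0, ball_set w0 (w0 p) (x A - x (rep (cls A)) - g0 t).
  by apply: g0c; apply: cls_eq => //; rewrite repP.
have [res hres] := choice resP.
(* Combinations with the same polar parts differ by an element without poles. If their differences
   from a common representative also agree modulo [p] at [w0], that element vanishes at [w0] and is
   0 by [L0]. *)
have inj : injective (fun A => (cls A, res A)).
  move=> A B [AB rAB]; apply: x_inj; apply/eqP; rewrite -subr_eq0; apply/eqP; apply: L0.
    exact: cls_eq.
  have := hres A; have := hres B; rewrite -rAB AB => h1 h2.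
  have := absB_le w0abs h2 h1; rewrite opprB subrKA opprB subrKA => h.
  exact: le_lt_trans p1.
have := leq_card _ inj; rewrite card_mx card_prod T0N card_dep_ffun -(ler_nat R).
rewrite !natrX !natrM exprM => /le_trans; apply.
have -> : (foldr muln 1%N [seq #|T i| | i : I])%:R = \prod_i w i (u i) ^+ n i.
  rewrite foldrE big_map big_enum natr_prod; apply: eq_bigr => i _; exact: (gP i).1.
have -> : \prod_i w i (u i) ^+ n i =
    \prod_i w i (z i) ^+ n i * (\prod_i Num.max 1 (w i y) ^+ n i) ^+ D.
  rewrite -prodrXl -big_split; apply: eq_bigr => i _ /=.
  by rewrite wu exprMn -!exprM mulnC.
rewrite mulrC mulrA ler_wpM2r ?exprn_ge0 ?(ltW X0)//.
rewrite ler_wpM2r ?ler_nat//.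
by rewrite prodr_ge0// => i _; rewrite exprn_ge0// (abs_ge0 (wabs i)).
Qed.

End ZeroPoleDegrees.

(** * Independence of distinct places *)

Section CurvePlaceSeparate.
Variables (R : realType) (K : fieldType).

(** Without a separating element the two unit balls coincide, and the unit ball determines a
    normalized absolute value through [curve_place_index]. *)
Lemma curve_place_separate (v v' : K -> R) :
  curve_places v -> curve_places v' -> v <> v' -> exists a, v a < 1 /\ 1 < v' a.
Proof.
move=> hv hv' vv; apply: contrapT => nsep; apply: vv.
have vabs := curve_place_abs hv; have v'abs := curve_place_abs hv'.
have lt1 a : v a < 1 -> v' a <= 1.
  by move=> a1; rewrite leNgt; apply/negP => a1'; apply: nsep; exists a.
have le1 a : v a <= 1 -> v' a <= 1.
  move=> a1; have [z z0 z1] := exists_abs_lt1 vabs.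
  have z0' : 0 < v' z by exact: abs_gt0.
  (* With |z|_v < 1 every a^k z has |a^k z|_v < 1, so |a|_v'^k is bounded by 1/|z|_v' for all
     [k]. *)
  apply: (le_of_pow_le (C := (v' z)^-1)) => //; first exact: (abs_ge0 v'abs).
    by rewrite invr_gt0.
  move=> k; rewrite expr1n mulr1 -[leRHS]mul1r ler_pdivlMr// -(absX v'abs) -(absM v'abs).
  apply: lt1; rewrite (absM vabs) (absX vabs) (le_lt_trans _ z1)// ler_piMl ?(abs_ge0 vabs)//.
  by rewrite exprn_ile1// (abs_ge0 vabs).
have le1' a : v' a <= 1 -> v a <= 1.
  move=> a1'; rewrite leNgt; apply/negP => a1.
  have a0 : a != 0 by apply: (abs_neq0 vabs); rewrite (lt_trans _ a1).
  have a1'' : v' a = 1.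
    apply/eqP; rewrite eq_le a1'/=.
    have : v' a^-1 <= 1 by apply: lt1; rewrite (absV vabs) invf_lt1// (lt_trans _ a1).
    by rewrite (absV v'abs) invf_le1// abs_gt0.
  have [b b1] := exists_abs_gt1 v'abs.
  have b0 : 0 < v b by apply: abs_gt0 => //; apply: (abs_neq0 v'abs); rewrite (lt_trans _ b1).
  have va0 : 0 <= (v a)^-1 by rewrite invr_ge0 (abs_ge0 vabs).
  have va1 : (v a)^-1 < 1 by rewrite invf_lt1// (lt_trans _ a1).
  have vbV : 0 < (v b)^-1 by rewrite invr_gt0.
  have [N hN] := exprn_lt va0 va1 vbV.
  (* Dividing by powers of [a] makes [b] small for [v] without changing its size for [v'], where |b|
     > 1. *)
  have : v' (a^-1 ^+ N * b) <= 1.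
    apply: lt1; rewrite (absM vabs) (absX vabs) (absV vabs).
    by have := hN N (leqnn N); rewrite -[X in _ < X -> _]mul1r ltr_pdivlMr.
  by rewrite (absM v'abs) (absX v'abs) (absV v'abs) a1'' invr1 expr1n mul1r leNgt b1.
have bE : ball_set v 1 = ball_set v' 1 by apply/seteqP; split=> x; [exact: le1|exact: le1'].
have key y : y != 0 -> v y <= 1 -> v y = v' y.
  move=> y0 y1; have [k hk kE] := curve_place_index hv y0 y1.
  have [k' hk' kE'] := curve_place_index hv' y0 (le1 _ y1).
  apply: invr_inj; rewrite -kE -kE'; congr (_%:R).
  have e : ball_set v (v y) = ball_set v' (v' y).
    by rewrite -[v y]mulr1 -[v' y]mulr1 -!scaled_ball// bE.
  apply: (index_uniq _ hk); first by apply: (ball_subgroup vabs); exact: (abs_ge0 vabs).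
  by rewrite /abs_index bE e.
apply/funext => y; have [->|y0] := eqVneq y 0; first by rewrite (abs0 vabs) (abs0 v'abs).
have [/key h|y1] := leP (v y) 1; first exact: h.
apply: invr_inj; rewrite -(absV vabs) -(absV v'abs); apply: key; rewrite ?invr_eq0//.
by rewrite (absV vabs) invf_le1 ?ltW// (lt_trans _ y1).
Qed.

Lemma above_separate (E : fieldExtType K) (w w' : E -> R) :
  places_above (@curve_places R K) w -> places_above (@curve_places R K) w' ->
  w <> w' -> exists a, w a < 1 /\ 1 < w' a.
Proof.
move=> [wabs wv] [w'abs wv'] ww; have [e|ne] := pselect (below w = below w').
  have [z z1] := exists_abs_gt1 (curve_place_abs wv).
  apply: (@abs_separate _ _ w w' _ _ (in_alg E z)) => //.
  exact: (congr1 (fun f => f z) e).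
by have [a [a1 a1']] := curve_place_separate wv wv' ne; exists (in_alg E a).
Qed.

End CurvePlaceSeparate.

Section Constants.
Variables (R : realType) (F : finFieldType) (E : fieldType) (c : {rmorphism F -> E}).

Lemma abs_const_le (w : E -> R) a : nontrivial_nonarch_abs w -> w (c a) <= 1.
Proof.
move=> wabs; rewrite leNgt; apply/negP => a1.
have : w (c a) ^+ 1 < w (c a) ^+ #|F| by rewrite ltr_eXn2l// finRing_gt1.
by rewrite -!(absX wabs) -!rmorphXn expf_card expr1 ltxx.
Qed.

(** The polynomial with reversed coefficients vanishes at [z]. *)
Lemma transcendentalV (z : E) : z != 0 -> transcendental c z -> transcendental c z^-1.
Proof.
move=> z0 tz p pz; pose r : {poly F} := \poly_(i < size p) p`_((size p).-1 - i).
have /tz r0 : peval c z r = 0.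
  transitivity (z ^+ (size p).-1 * peval c z^-1 p); last by rewrite pz mulr0.
  have sr : (size (map_poly c r) <= size p)%N by rewrite size_map_poly size_poly.
  have sp : (size (map_poly c p) <= size p)%N by rewrite size_map_poly.
  rewrite /peval (horner_coef_wide _ sr) (horner_coef_wide _ sp) mulr_sumr.
  rewrite (reindex_inj rev_ord_inj).
  apply: eq_bigr => i _ /=; rewrite !coef_map coef_poly.
  have ip := ltn_ord i; have -> : (size p - i.+1 < size p)%N by rewrite ltn_subrL/= (leq_ltn_trans _ ip).
  have -> : ((size p).-1 - (size p - i.+1) = i)%N by lia.
  rewrite [RHS]mulrCA; congr (_ * _).
  have -> : (size p).-1 = (size p - i.+1 + i)%N by lia.
  by rewrite exprD exprVn -mulrA divff ?mulr1// expf_neq0.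
apply/polyP => i; rewrite coef0; have [ip|ip] := leqP (size p) i; first by rewrite nth_default.
have := congr1 (fun f : {poly F} => f`_((size p).-1 - i)) r0; rewrite coef0 coef_poly.
have -> : ((size p).-1 - i < size p)%N by lia.
by rewrite subKn //; lia.
Qed.

Lemma abs_algebraic (w : E -> R) z : nontrivial_nonarch_abs w -> z != 0 ->
  ~ transcendental c z -> w z = 1.
Proof.
move=> wabs z0 tz.
have key y : ~ transcendental c y -> w y <= 1.
  move=> ty; have [p [py p0]] : exists p, peval c y p = 0 /\ p != 0.
    by apply: contrapT => np; apply: ty => p py; apply: contrapT => /eqP p0; apply: np; exists p.
  apply: (abs_root_le1 wabs (p := map_poly c ((lead_coef p)^-1 *: p))).
  - by rewrite monicE lead_coef_map lead_coefZ mulVf ?rmorph1// lead_coef_eq0.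
  - by move=> i; rewrite coef_map; exact: abs_const_le.
  - by apply/rootP; rewrite linearZ /= hornerZ -/(peval c y p) py mulr0.
apply/eqP; rewrite eq_le key//=.
have : w z^-1 <= 1.
  by apply: key => tz'; apply: tz; rewrite -(invrK z); apply: transcendentalV; rewrite ?invr_eq0.
by rewrite (absV wabs) invf_le1// abs_gt0.
Qed.

End Constants.

Lemma finite_set_of_bounded (T : Type) (X : set T) (N : nat) :
  (forall (I : finType) (f : I -> T), injective f -> (forall i, X (f i)) -> (#|I| <= N)%N) ->
  finite_set X.
Proof.
move=> h; have [||I [f [[finj fX] fmax]]] :=
    @max_family T (fun I f => injective f /\ forall i, X (f i)) N.
- by move=> f; split=> [[]|[]].
- by move=> I f [finj fX]; exact: h finj fX.
suff -> : X = f @` [set: I] by apply: finite_image; exact: finite_finset.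
apply/seteqP; split=> [x Xx|_ [i _ <-]]; last exact: fX.
apply: contrapT => nx; apply: fmax; exists x; split; last by case.
move=> [i|] [j|] // e; first by rewrite (finj _ _ e).
- by exfalso; apply: nx; exists i.
- by exfalso; apply: nx; exists j.
Qed.

(** * Zeros, poles and the product formula on a finite extension of K *)

Section FunctionFieldPlaces.
Variables (R : realType) (F : finFieldType) (K : fieldType) (cK : {rmorphism F -> K}).
Hypothesis HK : curve_function_field cK.
Variable E : fieldExtType K.

Definition const_ext : {rmorphism F -> E} := in_alg E \o cK.
Local Notation c := const_ext.
Local Notation W := (places_above (E := E) (@curve_places R K)).

(** The products of the generators [b] of [K] over F(t) with a basis of [E] over [K] span [E] over
    F(t), so the bound at t is transferred to every [s] by [finite_rank_of_span]. *)
Lemma curve_finite_rank s : finite_rank c s.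
Proof.
have [[t [_ [n [b hb]]]] _] := HK.
pose I : finType := ('I_n * 'I_(\dim {:E}))%type.
pose B (i : I) := in_alg E (b i.1) * (vbasis {:E})`_i.2.
apply: (@finite_rank_of_span F E c (in_alg E t) #|I| (fun k => B (enum_val k))) => x.
have pevalE (f : {poly F}) : peval c (in_alg E t) f = in_alg E (map_poly cK f).[t].
  by rewrite /peval /c map_poly_comp horner_map.
have den (a : K) : exists (g : {poly F}) (f : 'I_n -> {poly F}),
    (map_poly cK g).[t] != 0 /\ (map_poly cK g).[t] * a = \sum_i (map_poly cK (f i)).[t] * b i.
  have [co [hco ->]] := hb a.
  have /choice[gf hgf] : forall i, exists gf : {poly F} * {poly F}, (map_poly cK gf.1).[t] != 0 /\
      (map_poly cK gf.1).[t] * co i = (map_poly cK gf.2).[t].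
    (* A vanishing denominator gives the quotient the value 0, which is written as 0/1. *)
    move=> i; have [f [g e]] := hco i; have [g0|g0] := eqVneq (map_poly cK g).[t] 0.
      by exists (1, 0); rewrite /= rmorph1 rmorph0 hornerC horner0 oner_neq0 e g0 invr0 !mulr0.
    by exists (g, f); rewrite /= e mulrC divfK.
  exists (\prod_i (gf i).1), (fun i => \prod_(j | j != i) (gf j).1 * (gf i).2); split.
    by rewrite rmorph_prod horner_prod; apply/prodf_neq0 => i _; exact: (hgf i).1.
  rewrite mulr_sumr; apply: eq_bigr => i _; rewrite (bigD1 i)//= !rmorphM !hornerM.
  by rewrite mulrA -(hgf i).2; ring.
have [gg hgg] := choice (fun j => den (coord (vbasis {:E}) j x)); have [f hf] := choice hgg.
exists (\prod_j gg j), (fun k => \prod_(j | j != (enum_val k).2) gg j * f (enum_val k).2 (enum_val k).1).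
split.
  rewrite pevalE fmorph_eq0 rmorph_prod horner_prod; apply/prodf_neq0 => j _; exact: (hf j).1.
have -> : \sum_(i < #|I|) peval c (in_alg E t)
   (\prod_(j | j != (enum_val i).2) gg j * f (enum_val i).2 (enum_val i).1) * B (enum_val i) =
   \sum_(i : I) peval c (in_alg E t) (\prod_(j | j != i.2) gg j * f i.2 i.1) * B i.
  by rewrite -(big_enum_val (A := I) (fun i => peval c (in_alg E t) (\prod_(j | j != i.2) gg j * f i.2 i.1) * B i)).
rewrite -(pair_bigA _ (fun i j => peval c (in_alg E t) (\prod_(j' | j' != j) gg j' * f j i) * B (i, j))) /=.
rewrite exchange_big {1}(coord_vbasis (memvf x)) mulr_sumr; apply: eq_bigr => j _ /=.
transitivity (in_alg E ((map_poly cK (gg j)).[t] * coord (vbasis {:E}) j x) *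
    (peval c (in_alg E t) (\prod_(j' | j' != j) gg j') * (vbasis {:E})`_j)).
  rewrite [in RHS]rmorphM (bigD1 j)//= pevalM pevalE.
  by rewrite -(mulr_algl _ ((vbasis {:E})`_j)) mulrACA.
rewrite (hf j).2 rmorph_sum mulr_suml; apply: eq_bigr => i _.
rewrite [in LHS]rmorphM pevalM (pevalE (f j i)) mulrACA.
by congr (_ * _); rewrite mulrC.
Qed.

Lemma above_const_le w a : W w -> w (c a) <= 1.
Proof. by move=> [wabs _]; exact: abs_const_le. Qed.

Lemma exists_zero_place z : transcendental c z -> exists2 w, W w & w z < 1.
Proof.
move=> tz; have [A [hA [Az AzV]]] := exists_val_ring tz (curve_finite_rank z).
have [w [Ww wA]] := place_of_val_ring R hA; exists w => //.
have wabs := Ww.1; rewrite ltNge; apply/negP => z1; apply: AzV; apply/wA.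
by rewrite (absV wabs) invf_le1// (lt_le_trans _ z1).
Qed.

Lemma above_local_degree w : W w -> is_local_degree w (local_degree w).
Proof. by apply: local_degreeP => v; exact: curve_place_abs. Qed.

Lemma above_index w y : W w -> y != 0 -> w y <= 1 ->
  exists2 k, abs_index w y k & k%:R = (w y)^-1 ^+ local_degree w.
Proof.
by move=> Ww; have [wabs wv] := Ww; apply: local_index => //; exact: above_local_degree.
Qed.

Lemma transcendental_neq0 y : transcendental c y -> y != 0.
Proof.
move=> ty; apply/eqP => y0; have := ty 'X; rewrite pevalX => /(_ y0)/eqP.
by rewrite polyX_eq0.
Qed.

Lemma places_separate (I : Type) (w : I -> E -> R) : injective w -> (forall i, W (w i)) ->
  forall i j, i <> j -> exists a, w i a < 1 /\ 1 < w j a.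
Proof. by move=> winj wW i j ij; apply: above_separate => // /winj. Qed.

Lemma place_zeros_le y (I : finType) (w : I -> E -> R) : transcendental c y ->
  injective w -> (forall i, W (w i)) -> (forall i, w i y <= 1) ->
  exists (J : finType) (f : J -> E), poly_indep c y f /\
    \prod_i (w i y)^-1 ^+ local_degree (w i) <= #|F|%:R ^+ #|J|.
Proof.
move=> ty winj wW wy; have y0 := transcendental_neq0 ty.
have /choice[k hk] : forall i, exists k, abs_index (w i) y k /\ k%:R = (w i y)^-1 ^+ local_degree (w i).
  by move=> i; have [k ? ?] := above_index (wW i) y0 (wy i); exists k.
have [|||||J [f [hf hle]]] := @zero_degree_le R F E c y I w k y0 (curve_finite_rank y).
- by move=> i; exact: (wW i).1.
- by move=> i j /eqP; exact: places_separate.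
- by move=> i a; exact: above_const_le.
- exact: wy.
- by move=> i; exact: (hk i).1.
exists J, f; split=> //; rewrite -natrX.
rewrite (eq_bigr (fun i => (k i)%:R)) => [|i _]; last by rewrite (hk i).2.
by rewrite -natr_prod ler_nat.
Qed.

(** Each zero contributes an integer factor at least 2 to a product that is bounded independently of
    the chosen zeros. *)
Lemma finite_zeros y : transcendental c y -> finite_set [set w | W w /\ w y < 1].
Proof.
move=> ty; have [N hN] := curve_finite_rank y; have y0 := transcendental_neq0 ty.
apply: (@finite_set_of_bounded _ _ (#|F| ^ N)%N) => I w winj hw.
have [J [f [hf]]] := place_zeros_le ty winj (fun i => (hw i).1) (fun i => ltW (hw i).2).
have q1 : (1 < #|F|)%N by exact: finRing_gt1.
rewrite -(ler_nat R) natrX => le; apply: (@le_trans _ _ (#|F|%:R ^+ #|J|)); last first.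
  by rewrite ler_weXn2l ?ler1n ?(ltnW q1)//; exact: hN hf.
apply: le_trans le; apply: (@le_trans _ _ (2 ^+ #|I|)).
  by rewrite -natrX ler_nat ltnW// ltn_expl.
rewrite -prodr_const; apply: ler_prod => i _; rewrite ler0n /=.
have [k hk kE] := above_index (hw i).1 y0 (ltW (hw i).2).
rewrite -kE ler_nat -(ltr_nat R) kE exprn_egt1 ?invf_gt1 ?(hw i).2//.
  by rewrite -lt0n; apply: local_degree_gt0 (hw i).1 => v; exact: curve_place_abs.
by apply: abs_gt0 => //; exact: (hw i).1.1.
Qed.

Lemma finite_poles y : finite_set [set w | W w /\ 1 < w y].
Proof.
have [->|y0] := eqVneq y 0.
  rewrite (_ : mkset _ = set0)//; apply/seteqP; split=> // w [[wabs _]].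
  by rewrite (abs0 wabs) ltr10.
have [ty|ny] := pselect (transcendental c y); last first.
  rewrite (_ : mkset _ = set0)//; apply/seteqP; split=> // w [[wabs _]].
  by rewrite (abs_algebraic wabs y0 ny) ltxx.
apply: sub_finite_set (finite_zeros (transcendentalV y0 ty)) => w [Ww wy]; split=> //.
by rewrite (absV Ww.1) invf_lt1// (lt_trans _ wy).
Qed.

Lemma finite_support y : y != 0 -> finite_set [set w | W w /\ w y != 1].
Proof.
move=> y0; apply: (@sub_finite_set _ _ ([set w | W w /\ 1 < w y] `|` [set w | W w /\ 1 < w y^-1])).
  move=> w [Ww]; rewrite neq_lt => /orP[wy|wy]; last by left.
  by right; split=> //; rewrite (absV Ww.1) invf_gt1// abs_gt0//; exact: Ww.1.
by rewrite finite_setU; split; exact: finite_poles.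
Qed.

Lemma ln_prod (I : Type) (s : seq I) (P : pred I) (f : I -> R) : (forall i, P i -> 0 < f i) ->
  ln (\prod_(i <- s | P i) f i) = \sum_(i <- s | P i) ln (f i).
Proof.
move=> f0; suff [] : 0 < \prod_(i <- s | P i) f i /\
  ln (\prod_(i <- s | P i) f i) = \sum_(i <- s | P i) ln (f i) by [].
elim/big_rec2: _ => [|i x y Pi [y0 <-]]; first by rewrite ln1.
by rewrite mulr_gt0 ?f0// lnM ?posrE ?f0.
Qed.

Lemma ln_exprn (x : R) n : 0 < x -> ln (x ^+ n) = n%:R * ln x.
Proof. by move=> x0; rewrite lnXn// mulr_natl. Qed.

Lemma zeros_le_poles y : transcendental c y ->
  0 <= \sum_(w \in W) (local_degree w)%:R * ln (w y).
Proof.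
move=> ty; have y0 := transcendental_neq0 ty.
pose n (w : E -> R) := local_degree w.
have f0 := finite_zeros ty; set S0 := [set w | W w /\ w y < 1] in f0.
have S0P (i : fset_set S0) : W (val i) /\ val i y < 1.
  by have := valP i; rewrite in_fset_set// inE.
have [J [f [hf hJ]]] := place_zeros_le (w := fun i : fset_set S0 => val i) ty val_inj
  (fun i => (S0P i).1) (fun i => ltW (S0P i).2).
(* The poles of the [f j] are included so that the combinations are integral elsewhere; those that
   are not poles of [y] contribute a factor 1. *)
pose Bad := [set w | W w /\ 1 < w y] `|` \bigcup_(j in [set: J]) [set w | W w /\ 1 < w (f j)].
have fB : finite_set Bad.
  rewrite finite_setU; split; first exact: finite_poles.
  by apply: bigcup_finite => [|j _]; [exact: finite_finset|exact: finite_poles].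
have BP (i : fset_set Bad) : W (val i).
  by have := valP i; rewrite in_fset_set// inE => -[[]//|[j _ []]].
have [w0 W0 w0y] := exists_zero_place ty.
have [N hN _] := above_index W0 y0 (ltW w0y).
have hA : #|F|%:R ^+ #|J| <= \prod_(i : fset_set Bad) Num.max 1 (val i y) ^+ n (val i).
  apply: (@le_pole_degree R F E c W y J f (fset_set Bad) (fun i => val i) (fun i => n (val i)) w0 y N) => //.
  - by move=> v [].
  - by move=> v a; exact: above_const_le.
  - move=> v Wv; have [vB|nB] := pselect (Bad v).
      have vin : v \in fset_set Bad by rewrite in_fset_set// inE.
      by left; exists [` vin]%fset.
    right; split=> [|j]; rewrite leNgt; apply/negP => lt; apply: nB; first by left.
    by right; exists j.
  - by move=> i z; exact: above_index.
  (* A nonzero element with a zero is transcendental, and its inverse then vanishes somewhere, which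
     is a pole of the element. *)
  - move=> z zW z1; apply: contrapT => /eqP z0.
    have tz : transcendental c z.
      by apply: contrapT => nz; move: z1; rewrite (abs_algebraic W0.1 z0 nz) ltxx.
    have [w1 W1] := exists_zero_place (transcendentalV z0 tz).
    have wz := abs_gt0 W1.1 z0.
    by rewrite (absV W1.1) invf_lt1// ltNge zW.
have q0 : 0 < #|F|%:R :> R by rewrite ltr0n ltnW// finRing_gt1.
have m1 w : 1 <= Num.max 1 (w y) :> R by rewrite le_max lexx.
have m0 (w : E -> R) : 0 < Num.max 1 (w y) by rewrite (lt_le_trans _ (m1 w)).
have wpos w : W w -> 0 < w y by move=> [wabs _]; exact: abs_gt0.
have lnle := le_trans hJ hA.
have P1 : 0 < \prod_(i : fset_set S0) (val i y)^-1 ^+ n (val i).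
  by rewrite prodr_gt0// => i _; rewrite exprn_gt0// invr_gt0 wpos//; exact: (S0P i).1.
have P2 : 0 < \prod_(i : fset_set Bad) Num.max 1 (val i y) ^+ n (val i).
  by rewrite prodr_gt0// => i _; rewrite exprn_gt0.
move: lnle; rewrite -ler_ln// !ln_prod => [||i _]; last 2 first.
- by move=> i _; rewrite exprn_gt0.
- by rewrite exprn_gt0// invr_gt0 wpos//; exact: (S0P i).1.
rewrite (eq_bigr (fun i : fset_set S0 => - ((n (val i))%:R * ln (val i y)))) => [|i _]; last first.
  have wp := wpos _ (S0P i).1.
  by rewrite ln_exprn ?invr_gt0// lnV ?posrE// mulrN.
rewrite [in leRHS](eq_bigr (fun i : fset_set Bad => (n (val i))%:R * ln (Num.max 1 (val i y)))) => [|i _]; last first.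
  by rewrite ln_exprn.
rewrite sumrN -subr_ge0 opprK addrC.
rewrite -(big_seq_fsetE _ (fset_set S0) predT (fun w => (n w)%:R * ln (w y))) /=.
rewrite -(big_seq_fsetE _ (fset_set Bad) predT (fun w => (n w)%:R * ln (Num.max 1 (w y)))) /=.
rewrite -!fsbig_finite// => /le_trans; apply.
have fS := finite_support y0; set S := [set w | W w /\ w y != 1] in fS.
rewrite le_eqVlt; apply/orP; left; apply/eqP.
have -> : \sum_(i \in S0) (n i)%:R * ln (i y) = \sum_(w \in S) (n w)%:R * ln (Num.min 1 (w y)).
  rewrite -(fsbig_widen S0 S) => [|w [Ww wy]|w [[Ww wy] nw]].
  - by apply: eq_fsbigr => w; rewrite inE => -[Ww wy]; rewrite min_r// ltW.
  - by split=> //; rewrite lt_eqF.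
  - rewrite /= min_l ?ln1 ?mulr0// leNgt; apply/negP => lt; exact: nw.
have -> : \sum_(i \in Bad) (n i)%:R * ln (Num.max 1 (i y)) = \sum_(w \in S) (n w)%:R * ln (Num.max 1 (w y)).
  transitivity (\sum_(w \in W) (n w)%:R * ln (Num.max 1 (w y))).
    apply: fsbig_widen => [w [[]//|[j _ []]//]|w [Ww nB]] /=.
    by rewrite max_l ?ln1 ?mulr0// leNgt; apply/negP => lt; apply: nB; left.
  apply/esym/fsbig_widen => [w []//|w [Ww nS]] /=.
  have -> : w y = 1 by apply: contrapT => /eqP h; apply: nS.
  by rewrite max_l ?ln1 ?mulr0.
rewrite -fsbig_split// -(fsbig_widen S W) => [|w []//|w [Ww nS] /=]; last first.
  have -> : w y = 1 by apply: contrapT => /eqP h; apply: nS.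
  by rewrite ln1 mulr0.
apply: eq_fsbigr => w; rewrite inE => -[Ww wy] /=.
rewrite -mulrDr; congr (_ * _); have [le|gt] := leP (w y) 1.
  by rewrite ln1 addr0.
by rewrite ln1 add0r.
Qed.

Lemma above_product_formula y : y != 0 ->
  \sum_(w \in W) (local_degree w)%:R * ln (w y) = 0.
Proof.
move=> y0; have [ty|ny] := pselect (transcendental c y); last first.
  rewrite fsbig1// => w [wabs _].
  by rewrite (abs_algebraic wabs y0 ny) ln1 mulr0.
apply/eqP; rewrite eq_le zeros_le_poles// andbT.
have := zeros_le_poles (transcendentalV y0 ty).
rewrite -oppr_le0 => h; apply: le_trans h; rewrite le_eqVlt; apply/orP; left; apply/eqP.
have fS := finite_support y0; set S := [set w | W w /\ w y != 1] in fS.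
have w1 w : W w -> ~ S w -> w y = 1.
  by move=> Ww nS; apply: contrapT => /eqP h; apply: nS.
rewrite -(fsbig_widen S W) => [|w []//|w [Ww nS]]; last by rewrite /= (w1 w)// ln1 mulr0.
rewrite -(fsbig_widen S W) => [|w []//|w [Ww nS]]; last first.
  by rewrite /= (absV Ww.1) (w1 w)// invr1 ln1 mulr0.
rewrite !fsbig_finite// -sumrN; rewrite big_seq [RHS]big_seq; apply: eq_bigr => w.
rewrite in_fset_set// inE => -[Ww _]; rewrite (absV Ww.1) lnV ?mulrN ?opprK//.
by rewrite posrE abs_gt0//; exact: Ww.1.
Qed.

End FunctionFieldPlaces.

(** * Additive polynomials and Drinfeld modules *)

Lemma coef_poly_XaY (L : comNzRingType) (p : {poly L}) i j :
  (poly_XaY p)`_j`_i = p`_(j + i) *+ 'C(j + i, j).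
Proof.
have -> : poly_XaY p = \sum_(k < size p) (p^`N(k))%:P * 'X^k.
  rewrite /poly_XaY /comp_poly addrC nderiv_taylor; last exact: mulrC.
  have sz : size (map_poly polyC p^:P) = size p.
    by rewrite !size_map_inj_poly//; exact: polyC_inj.
  rewrite sz; apply: eq_bigr => k _; congr (_ * _).
  by rewrite !nderivn_map horner_map -[X in X.[_]]/(_^:P) -/(comp_poly _ _) comp_polyXr.
rewrite coef_sum -coef_nderivn; have [jp|jp] := ltnP j (size p).
  rewrite (bigD1 (Ordinal jp))//= coefCM coefXn eqxx mulr1 big1 ?addr0// => k kj.
  rewrite coefCM coefXn (_ : (j == k :> nat) = false) ?mulr0//.
  by apply/negbTE; apply: contra kj => /eqP e; apply/eqP/val_inj.
rewrite big1 => [|k _]; last first.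
  by rewrite coefCM coefXn gtn_eqF ?mulr0// (leq_trans (ltn_ord k)).
by rewrite coef0 coef_nderivn nth_default ?mul0rn// (leq_trans jp)// leq_addr.
Qed.

Lemma additive_poly_coef (L : fieldType) (p : {poly L}) i j : additive_poly p ->
  (0 < i)%N -> (0 < j)%N -> p`_(j + i) *+ 'C(j + i, j) = 0.
Proof.
move=> hp i0 j0; rewrite -coef_poly_XaY hp coefD coef_map !coefC /=.
by rewrite (gtn_eqF j0) addr0 coefC (gtn_eqF i0).
Qed.

(** Additivity makes the binomial coefficients C(k, i) with 0 < i < k vanish in [L]. If k were Q m
    with Q its [l]-part and m > 1, then C(k, Q) would equal m in [L], which is nonzero. *)
Lemma additive_support (L : fieldType) (p : {poly L}) (l k : nat) : l \in [pchar L] ->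
  additive_poly p -> (0 < k)%N -> p`_k != 0 -> exists e, k = (l ^ e)%N.
Proof.
move=> hl hp k0 pk; have l_pr := pcharf_prime hl.
have binE i : (0 < i < k)%N -> ('C(k, i))%:R = 0 :> L.
  move=> /andP[i0 ik]; have h : p`_k *+ 'C(k, i) = 0.
    by have := additive_poly_coef (i := k - i) (j := i) hp; rewrite subn_gt0 subnKC ?(ltnW ik)//; exact.
  by move/eqP: h; rewrite -(mulr_natr p`_k) mulf_eq0 (negbTE pk) => /eqP.
have kE := partnC l k0; set Q := (k`_l)%N in kE; set m := (k`_l^')%N in kE.
exists (logn l k); rewrite -p_part; apply/eqP; rewrite eqn_leq.
rewrite [(_ <= k)%N]dvdn_leq ?dvdn_part// andbT leqNgt; apply/negP => Qk.
have Q0 : (0 < Q)%N by exact: part_gt0.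
have coefQ (d n : nat) : (0 < d)%N -> ((('X^d + 1) ^+ n : {poly L})`_Q =
    if (d %| Q)%N then ('C(n, Q %/ d))%:R else 0).
  move=> d0; have -> : ('X^d + 1) ^+ n = (\sum_(i < n.+1) 'X^i *+ 'C(n, i)) \Po ('X^d : {poly L}).
    rewrite exprD1n rmorph_sum; apply: eq_bigr => i _.
    by rewrite rmorphMn /= comp_Xn_poly.
  rewrite coef_comp_poly_Xn//; case: ifP => // _; rewrite coef_sum.
  rewrite (eq_bigr (fun i : 'I_n.+1 => if (i == Q %/ d :> nat)%N then ('C(n, Q %/ d))%:R else 0)).
    rewrite -big_mkcond /=; case: (ltnP (Q %/ d) n.+1) => h.
      by rewrite (big_pred1 (Ordinal h)).
    rewrite bin_small// big_pred0 => [//|i]; apply/negbTE.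
    by rewrite neq_ltn (leq_trans (ltn_ord i)).
  by move=> i _; rewrite coefMn coefXn eq_sym; case: eqP => [->//|_]; rewrite mul0rn.
(* [(X + 1) ^ k = (X ^ Q + 1) ^ m], whose coefficient of index [Q] is [m]. *)
have : (('X^1 + 1 : {poly L}) ^+ k)`_Q = m%:R.
  rewrite -kE exprM exprDn_pchar; last first.
    apply: sub_in_pnat (part_pnat l k) => x _ /eqP ->.
    exact: (rmorph_pchar (polyC : {rmorphism L -> {poly L}})).
  by rewrite expr1 expr1n coefQ// dvdnn divnn Q0 bin1.
rewrite coefQ// dvd1n divn1 binE ?Q0// => /esym m0.
have : (l %| m)%N by rewrite (dvdn_pcharf hl) m0.
by have := part_pnat (negn l) k; rewrite -/m p'natE// => /negP.
Qed.

(** Reduce [e] modulo f, where #|F| = l^f. A nonzero remainder t would give X^(l^t) - X more roots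
    than its degree. *)
Lemma fin_field_pow_card (F : finFieldType) (l e : nat) : l \in [pchar F] ->
  (forall a : F, a ^+ (l ^ e) = a) -> exists j, (l ^ e = #|F| ^ j)%N.
Proof.
move=> hl; have l_pr := pcharf_prime hl.
have [f cF] : exists f, #|F| = (l ^ f)%N.
  by eexists; exact: (card_pprimeChar hl).
have f0 : (0 < f)%N.
  by rewrite lt0n; apply/eqP => f0; have := finRing_gt1 F; rewrite cF f0.
have powq (a : F) n : a ^+ (#|F| ^ n) = a.
  by elim: n => [|n ih]; rewrite ?expr1// expnS mulnC exprM ih expf_card.
move=> ha; exists (e %/ f)%N; rewrite cF -expnM; congr (_ ^ _)%N.
rewrite {1}(divn_eq e f) mulnC; suff -> : (e %% f = 0)%N by rewrite addn0.
apply/eqP; rewrite -leqn0 leqNgt; apply/negP => t0; set t := (e %% f)%N in t0.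
have hat (a : F) : a ^+ (l ^ t) = a.
  by rewrite -[RHS]ha [in RHS](divn_eq e f) expnD exprM mulnC expnM -cF powq.
pose P : {poly F} := 'X^(l ^ t) - 'X.
have lt1 : (1 < l ^ t)%N by rewrite -(exp1n t) ltn_exp2r// prime_gt1.
have sP : size P = (l ^ t).+1.
  by rewrite size_polyDl ?size_polyXn// size_polyN size_polyX ltnS.
have P0 : P != 0 by rewrite -size_poly_eq0 sP.
have := max_poly_roots (rs := enum F) P0.
rewrite enum_uniq -cardE sP => /(_ _ isT).
have -> : all (root P) (enum F).
  by apply/allP => a _; apply/rootP; rewrite hornerD hornerN hornerXn hornerX hat subrr.
move=> /(_ isT); rewrite ltnS leqNgt cF ltn_exp2l ?prime_gt1// /t ltn_mod f0.
by [].
Qed.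

Lemma coef_comp_scaleX (L : comNzRingType) (p : {poly L}) (s : L) k :
  (p \Po (s *: 'X))`_k = p`_k * s ^+ k.
Proof.
rewrite coef_comp_poly; have [kp|kp] := ltnP k (size p).
  rewrite (bigD1 (Ordinal kp))//= big1 ?addr0 => [|i ik].
    by rewrite exprZn coefZ coefXn eqxx mulr1.
  rewrite exprZn coefZ coefXn (_ : (k == i :> nat) = false) ?mulr0 ?mulr0//.
  by apply/negbTE; apply: contra ik => /eqP h; apply/eqP/val_inj.
rewrite (nth_default _ kp) mul0r big1// => i _; rewrite exprZn coefZ coefXn.
by rewrite gtn_eqF ?mulr0 ?mulr0// (leq_trans (ltn_ord i)).
Qed.

(** [fset_set] of an infinite set is empty, so a positive [norminf a] certifies that A/aA is
    finite. *)
Lemma norminf_index (A : idomainType) (a : A) : (0 < norminf a)%N ->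
  index_eq [set: A] [set a * z | z in [set: A]] (norminf a).
Proof.
rewrite /norminf; set cls := fun x : A => [set y : A | exists z, y = x + a * z].
have [fin|inf] := pselect (finite_set (range cls)); last first.
  by rewrite /fset_set; case: pselect => //; rewrite cardfs0.
move=> _; have hf (i : fset_set (range cls)) : exists x, val i = cls x.
  by have := valP i; rewrite in_fset_set// inE => -[x _ <-]; exists x.
have [f fP] := choice hf; exists (fset_set (range cls)), f; split.
- by rewrite cardfE.
- split=> // i j [z _ e]; apply: val_inj; rewrite !fP.
  have fij : f i = f j + a * z by rewrite e addrC subrK.
  apply/seteqP; split=> x [t ->]; rewrite /cls /=.
    by exists (z + t); rewrite fij; ring.
  by exists (t - z); rewrite fij; ring.
move=> x _; have xin : cls x \in fset_set (range cls) by rewrite in_fset_set// inE; exists x.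
exists [` xin]%fset; have := fP [` xin]%fset; rewrite /= => e.
have : cls (f [` xin]%fset) x by rewrite -e; exists 0; rewrite mulr0 addr0.
by move: (f _) => y [z xz]; exists z => //; rewrite xz addrC addKr.
Qed.

Section DrinfeldAlgebra.
Variables (F : finFieldType) (K : fieldType) (cK : {rmorphism F -> K}).
Variables (A : idomainType) (iA : {rmorphism A -> K}) (r : nat).
Hypothesis iA_inj : injective iA.
Hypothesis hF : forall a, range iA (cK a).
Hypothesis hK : forall x, algebraicOver cK x -> range cK x.
Hypothesis r0 : (0 < r)%N.

Local Notation q := #|F|.

(** What the local estimates use of a Drinfeld module, in a form that visibly passes to extensions
    of [L]. *)
Record q_module (L : fieldType) (iL : A -> L) (phi : A -> {poly L}) : Prop := {
  qm_size : forall a, a != 0 -> size (phi a) = (norminf a ^ r).+1;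
  qm1 : phi 1 = 'X;
  qm_comp : forall a b, phi (a * b) = phi a \Po phi b;
  qm_coef1 : forall a, (phi a)`_1 = iL a;
  qm_supp : forall a k, (phi a)`_k != 0 -> exists j, k = (q ^ j)%N }.

Lemma q_module_base_change (L L' : fieldType) (iL : A -> L) (phi : A -> {poly L})
    (f : {rmorphism L -> L'}) :
  q_module iL phi -> q_module (f \o iL) (base_change f phi).
Proof.
move=> h; split.
- by move=> a a0; rewrite size_map_poly (qm_size h).
- by rewrite /base_change (qm1 h) map_polyX.
- by move=> a b; rewrite /base_change (qm_comp h) map_comp_poly.
- by move=> a; rewrite coef_map (qm_coef1 h).
- by move=> a k; rewrite coef_map fmorph_eq0 => /(qm_supp h).
Qed.

Lemma q_gt1 : (1 < q)%N. Proof. exact: finRing_gt1. Qed.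

(** The constants lie in [A] by [hF], so A/aA is an [F]-space. *)
Lemma norminf_pow (a : A) : (0 < norminf a)%N -> a != 0 -> exists e, norminf a = (q ^ e)%N.
Proof.
move=> na a0; have [I [f [IN [_ sf] fc]]] := norminf_index na.
have hX : index_eq (range iA) (scaled (iA a) (range iA)) (norminf a).
  exists I, (iA \o f); split=> //.
    split=> [i|i j [_ [z _ <-] e]]; first by exists (f i).
    by apply: sf; exists z => //; apply: iA_inj; rewrite rmorphM rmorphB.
  by move=> _ [x _ <-]; have [i [z _ e]] := fc x Logic.I; exists i; exists (iA z);
     [exists z|rewrite -rmorphM e rmorphB].
have sX : subgroup (range iA).
  split; first by exists 0; rewrite ?rmorph0.
  by move=> _ _ [x _ <-] [y _ <-]; exists (x - y); rewrite ?rmorphB.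
have sY := scaled_subgroup (iA a) sX.
have YX : scaled (iA a) (range iA) `<=` range iA.
  by move=> _ [_ [x _ <-] <-]; exists (a * x); rewrite ?rmorphM.
have FX b x : range iA x -> range iA (cK b * x).
  by move=> [y _ <-]; have [z _ <-] := hF b; exists (z * y); rewrite ?rmorphM.
have FY b x : scaled (iA a) (range iA) x -> scaled (iA a) (range iA) (cK b * x).
  by move=> [y ry <-]; exists (cK b * y); [exact: FX|rewrite mulrCA].
have [|J [g [Xg ig hJ]]] := @index_finspace F K cK _ _ (norminf a) sX sY YX FX FY.
  move=> J g Xg ig; apply: (@leq_trans (q ^ #|J|)); first by rewrite ltnW// ltn_expl// q_gt1.
  rewrite -card_ffun.
  apply: (separated_le (f := fun h : {ffun J -> F} => \sum_j cK (h j) * g j) sY _ hX).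
  split=> [h|h h']; first by apply: subgroup_sum => // j _; exact: FX.
  rewrite -sumrB => hh; apply/ffunP => j; apply/eqP; rewrite -subr_eq0; apply/eqP.
  apply: (ig (fun j => h j - h' j)); move: hh; congr (scaled _ _).
  by apply: eq_bigr => l _; rewrite rmorphB mulrBl.
by exists #|J|; exact: index_uniq sY hX hJ.
Qed.

Section Module.
Variables (L : fieldType) (iL : {rmorphism A -> L}) (phi : A -> {poly L}).
Hypothesis iL_inj : injective iL.
Hypothesis Dphi : drinfeld_module q iL phi.
Hypothesis Rphi : drinfeld_rank phi r.

Let coef_low a i : (i < q)%N -> (phi a)`_i = (iL a *: 'X)`_i.
Proof.
move=> iq; apply/eqP; rewrite -subr_eq0 -coefB; have /dvdpP[d ->] := drinfeld_linear Dphi a.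
by rewrite coefMXn iq.
Qed.

Lemma drinfeld_coef0 a : (phi a)`_0 = 0.
Proof. by rewrite coef_low ?(ltnW q_gt1)// coefZ coefX mulr0. Qed.

Lemma drinfeld_coef1 a : (phi a)`_1 = iL a.
Proof. by rewrite coef_low ?q_gt1// coefZ coefX mulr1. Qed.

(** Finiteness of A/aA is read off the rank: an infinite quotient has [norminf a] = 0 and would give
    phi_a degree 0, but its linear coefficient is not 0. *)
Lemma norminf_gt0 (a : A) : a != 0 -> (0 < norminf a)%N.
Proof.
move=> a0; have : (1 < size (phi a))%N.
  rewrite ltnNge; apply/negP => h; have := drinfeld_coef1 a; rewrite nth_default//.
  by move=> /esym/eqP; rewrite -(rmorph0 iL) (inj_eq iL_inj) (negbTE a0).
rewrite (Rphi a0) ltnS lt0n expn_eq0 negb_and -lt0n => /orP[//|].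
by move: r0; rewrite lt0n => /negPf ->.
Qed.

Lemma norminf_const (a : A) : a != 0 -> constant_element cK iA a -> phi a = iL a *: 'X.
Proof.
move=> a0 [c _ ca]; have c0 : c != 0.
  by apply: contra_neq a0 => c0; apply: iA_inj; rewrite -ca c0 !rmorph0.
have [b _ bE] := hF c^-1.
have ab : a * b = 1 by apply: iA_inj; rewrite rmorphM -ca bE -rmorphM divff// !rmorph1.
have N1 : norminf a = 1%N.
  have [I [f [<- [_ sf] fc]]] := norminf_index (norminf_gt0 a0).
  apply/eqP; rewrite eqn_leq; apply/andP; split.
    apply/fintype_le1P => i j; apply: sf; exists (b * (f j - f i)) => //.
    by rewrite mulrA ab mul1r.
  by have [i _] := fc 0 Logic.I; apply/card_gt0P; exists i.
have sz : size (phi a) = 2 by rewrite (Rphi a0) N1 exp1n.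
apply/polyP => -[|[|i]]; [exact: coef_low (ltnW q_gt1)|exact: coef_low q_gt1|].
by rewrite nth_default ?sz// coefZ coefX mulr0.
Qed.

Lemma norminf_gt1 (S : A) : ~ constant_element cK iA S -> S != 0 /\ (1 < norminf S)%N.
Proof.
move=> Snc; have S0 : S != 0.
  by apply: contra_notN Snc => /eqP ->; exists 0 => //; rewrite !rmorph0.
split=> //; rewrite ltn_neqAle norminf_gt0// andbT eq_sym; apply/eqP => N1; apply: Snc.
have phiS : phi S = iL S *: 'X.
  apply/polyP => -[|[|i]]; [exact: coef_low (ltnW q_gt1)|exact: coef_low q_gt1|].
  by rewrite nth_default ?(Rphi S0) ?N1 ?exp1n// coefZ coefX mulr0.
(* [phi_S] commutes with [phi_a], so a coefficient of index [k > 1] of [phi_a]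
   makes [S] a root of unity of order dividing [k - 1]. *)
have [a na] := drinfeld_nontrivial Dphi.
have [k k1 ka] : exists2 k, (1 < k)%N & (phi a)`_k != 0.
  apply: contrapT => nk; move/eqP: na; apply; apply/polyP => -[|[|k]].
  - by rewrite coef_low ?(ltnW q_gt1).
  - by rewrite coef_low ?q_gt1.
  rewrite coefZ coefX mulr0; apply/eqP/negPn/negP => h; apply: nk.
  by exists k.+2.
have comm : phi S \Po phi a = phi a \Po phi S by rewrite -!(drinfeldM Dphi) mulrC.
have : (iL S ^+ k.-1) = 1.
  have := congr1 (fun p : {poly L} => p`_k) comm.
  rewrite phiS comp_polyZ comp_polyX coefZ.
  rewrite coef_comp_scaleX.
  rewrite mulrC => /(mulfI ka) e; have iS0 : iL S != 0.
    by rewrite -(rmorph0 iL) (inj_eq iL_inj).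
  by apply: (mulfI iS0); rewrite mulr1 -exprS prednK// ltnW.
rewrite -rmorphXn -(rmorph1 iL) => /iL_inj Sk.
have /hK[c _ cS] : algebraicOver cK (iA S).
  exists ('X^(k.-1) - 1).
    by rewrite -size_poly_eq0 size_polyDl ?size_polyXn// size_polyN size_poly1 ltnS -subn1 subn_gt0.
  by rewrite /root rmorphB /= map_polyXn rmorph1 hornerD hornerN hornerXn hornerC -rmorphXn Sk rmorph1 subrr.
by exists c.
Qed.

(** Additivity only gives a power of the characteristic. Commutation of phi_a with phi_b for a
    constant b gives b^k = b on [F], so the exponent is a power of [q]. *)
Lemma drinfeld_support a k : (phi a)`_k != 0 -> exists j, k = (q ^ j)%N.
Proof.
move=> ka; have k0 : (0 < k)%N.
  by rewrite lt0n; apply: contraNneq ka => ->; rewrite drinfeld_coef0.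
have [l l_pr lF] := finPcharP F.
have lL : l \in [pchar L].
  have : l \in [pchar K] := rmorph_pchar cK lF.
  rewrite !inE => /andP[_ /eqP lK]; rewrite l_pr /=; apply/eqP.
  have lA : l%:R = 0 :> A by apply: iA_inj; rewrite rmorph_nat lK rmorph0.
  by rewrite -(rmorph_nat iL) lA rmorph0.
have [e ke] := additive_support lL (drinfeld_additive Dphi a) k0 ka.
have [|j ej] := @fin_field_pow_card F l e lF; last by exists j; rewrite ke.
move=> c; have [->|c0] := eqVneq c 0; first by rewrite expr0n expn_eq0 -[l == 0%N]negbK -lt0n prime_gt0.
have [b _ bE] := hF c.
have b0 : b != 0 by apply: contra_neq c0 => b0; apply: (fmorph_inj cK); rewrite -bE b0 !rmorph0.
have phib : phi b = iL b *: 'X by apply: norminf_const => //; exists c.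
have comm : phi b \Po phi a = phi a \Po phi b by rewrite -!(drinfeldM Dphi) mulrC.
have : iL b ^+ k = iL b.
  have := congr1 (fun p : {poly L} => p`_k) comm.
  rewrite phib comp_polyZ comp_polyX coefZ.
  rewrite coef_comp_scaleX.
  by rewrite mulrC => /(mulfI ka).
rewrite -rmorphXn => /iL_inj bk; apply: (fmorph_inj cK).
by rewrite rmorphXn -bE -rmorphXn -ke bk.
Qed.

Lemma drinfeld_q_module : q_module iL phi.
Proof.
split; [exact: Rphi|exact: (drinfeld1 Dphi)|exact: (drinfeldM Dphi)|exact: drinfeld_coef1|exact: drinfeld_support].
Qed.

End Module.
End DrinfeldAlgebra.

(** * Local Green functions *)

Section Log.
Variables (R : realType) (q : nat).
Hypothesis q1 : (1 < q)%N.

Lemma lnq_gt0 : 0 < ln q%:R :> R. Proof. by rewrite ln_gt0// ltr1n. Qed.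

Lemma logpE (t : R) : 0 <= t -> logp q t = logq q (Num.max 1 t).
Proof.
move=> t0; rewrite /logp /logq; have [t1|t1] := leP t 1.
  rewrite ln1 mul0r max_l// pmulr_lle0 ?invr_gt0 ?lnq_gt0//.
  by have [->|tn] := eqVneq t 0; [rewrite ln0|exact: ln_le0].
by rewrite max_r// divr_ge0 ?(ltW lnq_gt0)// ln_ge0// ltW.
Qed.

Lemma logp_ge0 (t : R) : 0 <= logp q t. Proof. by rewrite /logp le_max lexx. Qed.

Lemma logq_le (t s : R) : 0 < t -> t <= s -> logq q t <= logq q s.
Proof.
move=> t0 ts; rewrite /logq ler_pM2r ?invr_gt0 ?lnq_gt0// ler_ln// posrE.
exact: lt_le_trans ts.
Qed.

Lemma logqM (t s : R) : 0 < t -> 0 < s -> logq q (t * s) = logq q t + logq q s.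
Proof. by move=> t0 s0; rewrite /logq lnM ?posrE// mulrDl. Qed.

Lemma logqX (t : R) n : 0 < t -> logq q (t ^+ n) = n%:R * logq q t.
Proof. by move=> t0; rewrite /logq ln_exprn// mulrA. Qed.

Lemma logq1 : logq q 1 = 0 :> R. Proof. by rewrite /logq ln1 mul0r. Qed.

Definition expq (y : R) : R := expR (y * ln q%:R).

Lemma expq_gt0 y : 0 < expq y. Proof. exact: expR_gt0. Qed.

Lemma expqK y : logq q (expq y) = y.
Proof. by rewrite /logq /expq expRK mulfK// gt_eqF// lnq_gt0. Qed.

Lemma logqK t : 0 < t -> expq (logq q t) = t.
Proof. by move=> t0; rewrite /logq /expq divfK ?lnK ?posrE// gt_eqF// lnq_gt0. Qed.

Lemma expq_le y z : y <= z -> expq y <= expq z.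
Proof. by move=> yz; rewrite ler_expR ler_wpM2r// ltW// lnq_gt0. Qed.

Lemma expq0 : expq 0 = 1. Proof. by rewrite /expq mul0r expR0. Qed.

Lemma expqD y z : expq (y + z) = expq y * expq z.
Proof. by rewrite /expq mulrDl expRD. Qed.

Lemma expqMn y n : expq (n%:R * y) = expq y ^+ n.
Proof. by rewrite /expq -mulrA expRM_natl. Qed.

Lemma expq_ge1 y : 0 <= y -> 1 <= expq y.
Proof. by move=> y0; rewrite -expq0 expq_le. Qed.

End Log.

Section GeometricLimit.
Variables (R : realType) (Q : R) (C : R) (a : nat -> R).
Hypothesis Q1 : 1 < Q.
Hypothesis ha : forall N, `|a N.+1 - Q * a N| <= C.

Let u N := (Q ^+ N)^-1 * a N.

Let Q0 : 0 < Q. Proof. exact: lt_trans Q1. Qed.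

Let Qz : Q != 0. Proof. by rewrite gt_eqF. Qed.
Let Qn0 N : Q ^+ N != 0. Proof. exact: expf_neq0. Qed.
Let Q10 : Q - 1 != 0. Proof. by rewrite subr_eq0 gt_eqF. Qed.

Let uS N : `|u N.+1 - u N| <= C / Q ^+ N.+1.
Proof.
have -> : u N.+1 - u N = (a N.+1 - Q * a N) / Q ^+ N.+1.
  by rewrite /u exprS; field; rewrite ?Qn0 ?Qz.
rewrite normrM normfV (ger0_norm (exprn_ge0 _ (ltW Q0))) ler_wpM2r//.
by rewrite invr_ge0 exprn_ge0// ltW.
Qed.

(** The sum of all C / Q^(N+1), so that d / Q^N is the tail from N on: u N + d / Q^N does not
    increase and u N - d / Q^N does not decrease. *)
Let d := C / (Q - 1).

Let dS N : d / Q ^+ N - d / Q ^+ N.+1 = C / Q ^+ N.+1.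
Proof.
by rewrite /d exprS; field; rewrite ?Qn0 ?Qz ?Q10.
Qed.

Lemma geometric_upper N : u N <= u 0 + d.
Proof.
have C0 : 0 <= C := le_trans (normr_ge0 _) (ha 0).
suff h : u N + d / Q ^+ N <= u 0 + d.
  apply: le_trans h; rewrite lerDl divr_ge0 ?exprn_ge0 ?(ltW Q0)//.
  by rewrite divr_ge0// subr_ge0 ltW.
elim: N => [|N ih]; first by rewrite expr0 divr1.
apply: le_trans ih; have := uS N; rewrite -dS ler_norml => /andP[_].
by lra.
Qed.

Lemma geometric_cvg : cvgn u.
Proof.
have -> : u = (fun N => u N - d / Q ^+ N) + (fun N => d / Q ^+ N).
  by apply/funext => N; rewrite !fctE subrK.
apply: is_cvgD.
  apply: nondecreasing_is_cvgn.
    apply/nondecreasing_seqP => N; have := uS N; rewrite -dS ler_norml => /andP[+ _].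
    by lra.
  exists (u 0 + d) => _ [N _ <-]; apply: le_trans (geometric_upper N).
  have C0 : 0 <= C := le_trans (normr_ge0 _) (ha 0).
  rewrite lerBlDr lerDl divr_ge0 ?exprn_ge0 ?(ltW Q0)//.
  by rewrite divr_ge0// subr_ge0 ltW.
apply: is_cvgMr; have -> : (fun N => (Q ^+ N)^-1) = (fun N => Q^-1 ^+ N).
  by apply/funext => N; rewrite exprVn.
apply/cvg_ex; exists 0; apply: cvg_expr.
by rewrite ger0_norm ?invr_ge0 ?(ltW Q0)// invf_lt1.
Qed.

End GeometricLimit.

Section PolyGrowth.
Variables (R : realType) (q : nat) (L : fieldType) (w : L -> R).
Hypothesis q1 : (1 < q)%N.
Hypothesis wabs : nontrivial_nonarch_abs w.

Let M (t : R) := Num.max 1 t.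
Let M1 t : 1 <= M t. Proof. by rewrite le_max lexx. Qed.
Let M0 t : 0 < M t. Proof. exact: lt_le_trans (M1 t). Qed.
Let Mt t : t <= M t. Proof. by rewrite le_max lexx orbT. Qed.

Lemma poly_growth (P : {poly L}) (Q : nat) : size P = Q.+1 -> (0 < Q)%N ->
  exists C : R, forall y, `|logp q (w P.[y]) - Q%:R * logp q (w y)| <= C.
Proof.
move=> sP Q0; pose B := 1 + \sum_(i < size P) w P`_i.
have B1 : 1 <= B by rewrite lerDl sumr_ge0// => i _; exact: (abs_ge0 wabs).
have wB i : w P`_i <= B.
  have [iP|iP] := ltnP i (size P); last by rewrite nth_default// (abs0 wabs) (le_trans ler01).
  rewrite /B (bigD1 (Ordinal iP))//= addrCA lerDl addr_ge0// sumr_ge0// => j _.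
  exact: (abs_ge0 wabs).
have B0 : 0 < B by rewrite (lt_le_trans _ B1).
have lead0 : 0 < w (lead_coef P).
  by rewrite abs_gt0// lead_coef_eq0 -size_poly_eq0 sP.
(* Beyond the radius [rho] the leading term dominates; below it |y|^Q is at most rho^Q. The factors
   of [B'] serve these two cases. *)
pose rho := M (B / w (lead_coef P)); pose B' := M (w (lead_coef P))^-1 * rho ^+ Q.
have rho1 : 1 <= rho by exact: M1.
have B'1 : 1 <= B' by rewrite mulr_ege1// exprn_ege1.
have up y : M (w P.[y]) <= B * M (w y) ^+ Q.
  rewrite ge_max mulr_ege1 ?exprn_ege1//=; apply: (abs_poly_le wabs) => i.
  have [iP|iP] := ltnP i (size P); last first.
    rewrite nth_default// (abs0 wabs) mul0r mulr_ge0 ?exprn_ge0 ?(ltW B0)//.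
    exact: le_trans (M1 _).
  rewrite ler_pM ?exprn_ge0 ?(abs_ge0 wabs)//.
  apply: (@le_trans _ _ (M (w y) ^+ i)); first by apply: expr_le => //; exact: (abs_ge0 wabs).
  by rewrite ler_weXn2l// -ltnS -sP.
have lo y : M (w y) ^+ Q <= B' * M (w P.[y]).
  have [yr|yr] := leP (w y) rho.
    apply: (@le_trans _ _ (rho ^+ Q)).
      by apply: expr_le; [exact: le_trans (M1 _)|rewrite ge_max rho1].
    rewrite /B' mulrAC ler_peMl ?exprn_ge0 ?(le_trans ler01)//.
    by rewrite mulr_ege1.
  have wy1 : 1 < w y by rewrite (le_lt_trans rho1).
  have wPy : w P.[y] = w (lead_coef P) * w y ^+ Q.
    rewrite horner_coef sP big_ord_recr /= addrC.
    have lE : P`_Q = lead_coef P by rewrite lead_coefE sP.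
    rewrite lE (absD_eq wabs) (absM wabs) (absX wabs)//.
    apply: (abs_sum_lt wabs) => [|i _]; first by rewrite mulr_gt0 ?exprn_gt0// (lt_trans _ wy1).
    rewrite (absM wabs) (absX wabs) (@le_lt_trans _ _ (B * w y ^+ Q.-1))//.
      rewrite ler_pM ?exprn_ge0 ?(abs_ge0 wabs)// ler_weXn2l ?(ltW wy1)//.
      by rewrite -ltnS prednK.
    rewrite -{2}(prednK Q0) exprS mulrA ltr_pM2r ?exprn_gt0 ?(lt_trans _ wy1)//.
    by rewrite -ltr_pdivrMl// mulrC (le_lt_trans _ yr)//; exact: Mt.
  have -> : M (w y) = w y by rewrite /M max_r// ltW.
  rewrite -[leLHS](mulKf (lt0r_neq0 lead0)) -wPy ler_pM ?invr_ge0 ?(abs_ge0 wabs) ?(ltW lead0)//.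
  apply: (le_trans (Mt _)); rewrite /B' ler_peMr ?(le_trans ler01)//.
  exact: exprn_ege1.
exists (Num.max (logq q B) (logq q B')) => y.
rewrite !(logpE q1) ?(abs_ge0 wabs)// -/(M _) -/(M _) -(logqX _ _ (M0 _)).
have MQ : 0 < M (w y) ^+ Q by rewrite exprn_gt0.
rewrite ler_norml lerBlDr lerNl opprB lerBlDr; apply/andP; split.
  apply: (@le_trans _ _ (logq q (B' * M (w P.[y])))); first exact: logq_le.
  by rewrite logqM// ?(lt_le_trans _ B'1)// lerD2r le_max lexx orbT.
apply: (@le_trans _ _ (logq q (B * M (w y) ^+ Q))); first exact: logq_le.
by rewrite logqM// lerD2r le_max lexx.
Qed.

End PolyGrowth.

Section Green.
Variables (R : realType) (F : finFieldType) (A : idomainType) (r : nat).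
Variables (L : fieldType) (iL : A -> L) (phi : A -> {poly L}) (w : L -> R).
Hypothesis r0 : (0 < r)%N.
Hypothesis wabs : nontrivial_nonarch_abs w.
Hypothesis Mphi : q_module F r iL phi.

Local Notation q := #|F|.
Let q1 : (1 < q)%N. Proof. exact: finRing_gt1. Qed.

Let nc (S : A) := S != 0 /\ (1 < norminf S)%N.
Let Q (S : A) : nat := (norminf S ^ r)%N.

Let Q_gt1 S : nc S -> (1 < Q S)%N.
Proof. by move=> [_ S1]; rewrite /Q -(exp1n r) ltn_exp2r. Qed.

Let QR_gt1 S : nc S -> 1 < (Q S)%:R :> R.
Proof. by move=> /Q_gt1; rewrite ltr1n. Qed.

Let ev (S : A) x := (phi S).[x].

Let evM S T x : ev (S * T) x = ev S (ev T x).
Proof. by rewrite /ev (qm_comp Mphi) horner_comp. Qed.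

Let ev1 x : ev 1 x = x. Proof. by rewrite /ev (qm1 Mphi) hornerX. Qed.

Let lp x := logp q (w x).

Let growth S : nc S -> exists C, forall y, `|lp (ev S y) - (Q S)%:R * lp y| <= C.
Proof.
move=> hS; apply: (poly_growth q1 wabs); first by rewrite (qm_size Mphi hS.1).
exact: ltnW (Q_gt1 hS).
Qed.

Let u S x N := ((Q S)%:R ^+ N)^-1 * lp (ev (S ^+ N) x).

Let greenE S x : local_green q r phi S w x = limn (u S x).
Proof.
rewrite /local_green; congr (limn _); apply/funext => N.
by rewrite /u /Q natrX exprM.
Qed.

Local Notation g S x := (local_green q r phi S w x).

Let geo S C x : nc S -> (forall y, `|lp (ev S y) - (Q S)%:R * lp y| <= C) ->
  forall N, `|lp (ev (S ^+ N.+1) x) - (Q S)%:R * lp (ev (S ^+ N) x)| <= C.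
Proof. by move=> hS hC N; rewrite exprS evM. Qed.

Let green_cvg S x : nc S -> u S x @ \oo --> g S x.
Proof.
move=> hS; have [C hC] := growth hS; rewrite greenE.
exact: (geometric_cvg (QR_gt1 hS) (geo x hS hC)).
Qed.

Lemma local_green_ge0 S x : nc S -> 0 <= g S x.
Proof.
move=> hS; apply: (cvgr_to_ge (@green_cvg S x hS)); apply: nearW => N.
by rewrite mulr_ge0 ?invr_ge0 ?exprn_ge0 ?ler0n ?logp_ge0.
Qed.

Let green_close S : nc S -> exists2 C, 0 <= C & forall x, `|g S x - lp x| <= C.
Proof.
move=> hS; have [C hC] := growth hS; have QS := QR_gt1 hS.
have C0 : 0 <= C := le_trans (normr_ge0 _) (hC 0).
exists (C / ((Q S)%:R - 1)) => [|x]; first by rewrite divr_ge0// subr_ge0 ltW.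
have u0 : u S x 0 = lp x by rewrite /u expr0 invr1 mul1r ev1.
have u0' : ((Q S)%:R ^+ 0)^-1 * - lp (ev (S ^+ 0) x) = - lp x by rewrite mulrN -/(u S x 0) u0.
rewrite ler_norml lerBDr lerBlDr; apply/andP; split; last first.
  apply: (cvgr_to_le  (@green_cvg S x hS)); apply: nearW => N.
  by rewrite addrC -u0; exact: (geometric_upper QS (geo x hS hC)).
have hN N : `|(- lp (ev (S ^+ N.+1) x)) - (Q S)%:R * (- lp (ev (S ^+ N) x))| <= C.
  by rewrite mulrN -opprD normrN; exact: (geo x hS hC).
apply: (cvgr_to_ge  (@green_cvg S x hS)); apply: nearW => N.
have := geometric_upper (a := fun N => - lp (ev (S ^+ N) x)) QS hN N.
by rewrite u0' mulrN -/(u S x N); lra.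
Qed.

Let cvg_pow (T : A) (C : R) : nc T -> (fun N => C / (Q T)%:R ^+ N) @ \oo --> (0 : R).
Proof.
move=> hT; have Q1 := QR_gt1 hT; rewrite -(mulr0 C).
apply: cvgM; first exact: cvg_cst.
have -> : (fun N => ((Q T)%:R ^+ N)^-1) = (fun N => ((Q T)%:R : R)^-1 ^+ N).
  by apply/funext => N; rewrite exprVn.
by apply: cvg_expr; rewrite ger0_norm ?invr_ge0// invf_lt1// (lt_trans _ Q1).
Qed.

Let eq_of_pow_le (T : A) (x y C : R) : nc T ->
  (forall N, `|x - y| <= C / (Q T)%:R ^+ N) -> x = y.
Proof.
move=> hT h; apply/eqP; rewrite -subr_eq0 -normr_eq0 eq_le normr_ge0 andbT.
by apply: (cvgr_to_ge (@cvg_pow T C hT)); apply: nearW => N; exact: h.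
Qed.

(** Since S^N and T commute, the growth estimate for phi_T applies to phi_(S^N)(x), and its error is
    divided by Q(S)^N. *)
Let green_functional S T x : nc S -> nc T -> g S (ev T x) = (Q T)%:R * g S x.
Proof.
move=> hS hT; have [C hC] := growth hT.
have QS0 N : 0 < (Q S)%:R ^+ N :> R by rewrite exprn_gt0// (lt_trans _ (QR_gt1 hS)).
apply/eqP; rewrite -subr_eq0 -normr_eq0 eq_le normr_ge0 andbT.
have c0 : (fun N => `|u S (ev T x) N - (Q T)%:R * u S x N|) @ \oo --> `|g S (ev T x) - (Q T)%:R * g S x|.
  apply: cvg_norm; apply: cvgB; first exact: green_cvg.
  by apply: cvgM; [exact: cvg_cst|exact: green_cvg].
apply: (ler_cvg_to c0 (@cvg_pow S C hS)); apply: nearW => N.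
rewrite /u -evM [_ ^+ _ * T]mulrC evM [X in _ - X]mulrCA -mulrBr normrM mulrC ler_pM ?normr_ge0//.
by rewrite ger0_norm// invr_ge0 ltW.
Qed.

(** Both functions stay at bounded distance from log^+ and are multiplied by Q(T) under phi_T;
    applying phi_(T^N) divides the distance by Q(T)^N. *)
Lemma local_green_indep S T x : nc S -> nc T -> g S x = g T x.
Proof.
move=> hS hT; have [C C0 hC] := green_close hS; have [C' C0' hC'] := green_close hT.
apply: (eq_of_pow_le (C := C + C') hT) => N.
have QT0 : 0 < (Q T)%:R ^+ N :> R by rewrite exprn_gt0// (lt_trans _ (QR_gt1 hT)).
have powg S' : nc S' -> g S' (ev (T ^+ N) x) = (Q T)%:R ^+ N * g S' x.
  move=> hS'; elim: N {QT0} => [|N ih]; first by rewrite !expr0 ev1 mul1r.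
  by rewrite exprS evM green_functional// ih exprS mulrA.
rewrite ler_pdivlMr// -[X in _ * X](ger0_norm (ltW QT0)) -normrM mulrBl.
rewrite ![_ * (Q T)%:R ^+ N]mulrC -!powg//.
rewrite -(subrKA (lp (ev (T ^+ N) x))) (le_trans (ler_normD _ _))// lerD//.
by rewrite distrC.
Qed.

Section Bounds.
Variables (T : A) (J : R).
Hypothesis hT : nc T.
Hypothesis hJ : forall j, (0 < j)%N -> (phi T)`_(q ^ j) != 0 ->
  logq q (w (phi T)`_(q ^ j)) <= ((q ^ j)%:R - 1) * J.

Let tau := Num.max 1 (w (iL T)).
Let tau1 : 1 <= tau. Proof. by rewrite le_max lexx. Qed.
Let tau0 : 0 < tau. Proof. exact: lt_le_trans tau1. Qed.

Let logp_tau : logp q (w (iL T)) = logq q tau.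
Proof. by rewrite logpE// (abs_ge0 wabs). Qed.

Let coef_le (J' : R) j : J <= J' -> (0 < j)%N ->
  w (phi T)`_(q ^ j) <= expq q J' ^+ (q ^ j).-1.
Proof.
move=> JJ j0; have [->|c0] := eqVneq (phi T)`_(q ^ j) 0.
  by rewrite (abs0 wabs) exprn_ge0// ltW// expq_gt0.
rewrite -[leLHS](logqK q1); last exact: abs_gt0.
rewrite -expqMn expq_le// (le_trans (hJ j0 c0))//.
have q0 : (0 < q ^ j)%N by rewrite expn_gt0 (ltnW q1).
rewrite -subn1 natrB// ler_wpM2l// subr_ge0 ler1n//.
Qed.

Lemma local_green_le x : g T x <= logp q (w x) + Num.max 0 J + logp q (w (iL T)).
Proof.
pose B := expq q (Num.max 0 J); have B1 : 1 <= B by rewrite expq_ge1// le_max lexx.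
have B0 : 0 < B by exact: expq_gt0.
pose h x := Num.max 1 (B * w x).
have h1 y : 1 <= h y by rewrite le_max lexx.
have h0 y : 0 < h y by exact: lt_le_trans (h1 y).
(* In the coordinate scaled by [B] all coefficients beyond the linear one are integral, so only the
   linear one, of size at most [tau], can enlarge the value. *)
have hstep y : h (ev T y) <= tau * h y ^+ Q T.
  rewrite ge_max; apply/andP; split; first by rewrite mulr_ege1// exprn_ege1.
  rewrite mulrC -ler_pdivlMr//; apply: (abs_poly_le wabs) => k.
  rewrite ler_pdivlMr//; have [k0|kn] := eqVneq (phi T)`_k 0.
    by rewrite k0 (abs0 wabs) !mul0r mulr_ge0 ?exprn_ge0 ?(ltW tau0) ?(ltW (h0 _)).
  have kQ : (k <= Q T)%N.
    rewrite leqNgt; apply/negP => lt; move: kn.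
    by rewrite nth_default ?eqxx// (qm_size Mphi hT.1).
  have [j kj] := qm_supp Mphi kn; case: j kj => [|j] kj.
    rewrite kj expn0 (qm_coef1 Mphi) expr1 -mulrA ler_pM ?mulr_ge0 ?(abs_ge0 wabs) ?(ltW B0)//.
      by rewrite le_max lexx orbT.
    rewrite mulrC (@le_trans _ _ (h y))//; first by rewrite le_max lexx orbT.
    by rewrite ler_eXnr// ltnW// Q_gt1.
  rewrite kj; apply: (@le_trans _ _ ((B * w y) ^+ (q ^ j.+1))).
    rewrite exprMn mulrAC ler_wpM2r ?exprn_ge0 ?(abs_ge0 wabs)//.
    have q0 : (0 < q ^ j.+1)%N by rewrite expn_gt0 (ltnW q1).
    rewrite -[X in _ <= B ^+ X](prednK q0) exprSr ler_wpM2r ?(ltW B0)//.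
    by apply: coef_le => //; rewrite le_max lexx orbT.
  apply: (@le_trans _ _ (h y ^+ (q ^ j.+1))).
    by apply: expr_le; [rewrite mulr_ge0 ?(abs_ge0 wabs) ?(ltW B0)|rewrite le_max lexx orbT].
  apply: (@le_trans _ _ (h y ^+ Q T)); first by rewrite ler_weXn2l// -kj.
  by rewrite ler_peMl// exprn_ge0// ltW.
(* The factor [tau] is carried along so that the estimate can be iterated: tau^2 <= tau^Q because Q
   >= 2. *)
have hN N : tau * h (ev (T ^+ N) x) <= (tau * h x) ^+ (Q T ^ N).
  elim: N => [|N ih]; first by rewrite expr0 ev1 expn0 expr1.
  rewrite exprS evM expnSr exprM; apply: le_trans (expr_le _ _ ih); last first.
    by rewrite mulr_ge0// ltW.
  apply: (@le_trans _ _ (tau * (tau * h (ev (T ^+ N) x) ^+ Q T))); first by rewrite ler_wpM2l// ltW.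
  rewrite exprMn mulrA ler_wpM2r ?exprn_ge0 ?(ltW (h0 _))// -expr2.
  by rewrite ler_weXn2l// Q_gt1.
have th0 : 0 < tau * h x by rewrite mulr_gt0.
have -> : logp q (w x) + Num.max 0 J + logp q (w (iL T)) =
    logq q (tau * (B * Num.max 1 (w x))).
  have M0 : 0 < Num.max 1 (w x) by rewrite lt_max ltr01.
  rewrite !logqM// ?mulr_gt0// /B expqK// logp_tau logpE ?(abs_ge0 wabs)//.
  by rewrite addrC; congr (_ + _); rewrite addrC.
apply: (@le_trans _ _ (logq q (tau * h x))); last first.
  apply: logq_le => //; rewrite ler_wpM2l ?(ltW tau0)// ge_max; apply/andP; split.
    by rewrite mulr_ege1// le_max lexx.
  by rewrite ler_wpM2l ?(ltW B0)// le_max lexx orbT.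
apply: (cvgr_to_le  (@green_cvg T x hT)); apply: nearW => N.
have QN0 : 0 < (Q T)%:R ^+ N :> R by rewrite exprn_gt0// (lt_trans _ (QR_gt1 hT)).
rewrite /u ler_pdivrMl// -natrX -logqX// /lp logpE ?(abs_ge0 wabs)//; apply: logq_le => //.
  by rewrite lt_max ltr01.
apply: le_trans (hN N); rewrite ge_max; apply/andP; split.
  by rewrite mulr_ege1.
apply: (@le_trans _ _ (h (ev (T ^+ N) x))); last by rewrite ler_peMl// ltW.
apply: (@le_trans _ _ (B * w (ev (T ^+ N) x))); last by rewrite le_max lexx orbT.
by rewrite ler_peMl// (abs_ge0 wabs).
Qed.

Variable c : R.
Hypothesis hc : c = - (logq q (w (lead_coef (phi T))) / ((Q T)%:R - 1)).
Hypothesis hJc : 0 <= J + c.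

Let a := expq q c.
Let D := expq q (J + c).

(** The scale a = q^c makes the leading coefficient a unit: this is the meaning of c. *)
Let lead_pow : w (lead_coef (phi T)) * a ^+ (Q T).-1 = 1.
Proof.
have l0 : lead_coef (phi T) != 0 by rewrite lead_coef_eq0 -size_poly_gt0 (qm_size Mphi hT.1).
rewrite -[w _](logqK q1) ?(abs_gt0 wabs)// -expqMn -expqD -[RHS](expq0 R q); congr expq.
have Qz : (Q T)%:R - 1 != 0 :> R by rewrite subr_eq0 gt_eqF// QR_gt1.
have -> : (Q T).-1%:R = (Q T)%:R - 1 :> R by rewrite -subn1 natrB// ltnW// Q_gt1.
by rewrite hc; field.
Qed.

(* Beyond the radius [a D tau] the leading monomial of [phi_T] dominates: in the
   variable [w y / a] the map is [z |-> z ^ Q], and [2 q^j - 1 < Q] for [q^j < Q]. *)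
Let far_step y z : w y = a * z -> D * tau < z -> w (ev T y) = a * z ^+ Q T.
Proof.
move=> wy zD; have a0 : 0 < a by exact: expq_gt0.
have D1 : 1 <= D by exact: expq_ge1.
have D0 : 0 < D by exact: expq_gt0.
have z1 : 1 < z by rewrite (le_lt_trans _ zD)// mulr_ege1.
have z0 : 0 < z by exact: lt_trans z1.
have zt : tau < z by rewrite (le_lt_trans _ zD)// ler_peMl// ltW.
have Dz : D < z by rewrite (le_lt_trans _ zD)// ler_peMr// ltW.
have sz := qm_size Mphi hT.1; rewrite -/(Q T) in sz.
have Q0 : (0 < Q T)%N by exact: ltnW (Q_gt1 hT).
have leadE : (phi T)`_(Q T) = lead_coef (phi T) by rewrite lead_coefE sz.
have wlead : w ((phi T)`_(Q T) * y ^+ Q T) = a * z ^+ Q T.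
  rewrite (absM wabs) (absX wabs) leadE wy exprMn mulrA -[in a ^+ _](prednK Q0) exprSr.
  by rewrite !mulrA lead_pow mul1r.
have Qe : exists e, Q T = (q ^ e)%N.
  by apply: (qm_supp Mphi (a := T)); rewrite leadE lead_coef_eq0 -size_poly_gt0 sz.
rewrite /ev horner_coef sz big_ord_recr /= addrC (absD_eq wabs) wlead//.
apply: (abs_sum_lt wabs) => [|i _]; first by rewrite mulr_gt0// exprn_gt0.
have [->|cn] := eqVneq (phi T)`_i 0.
  by rewrite mul0r (abs0 wabs) mulr_gt0// exprn_gt0.
rewrite (absM wabs) (absX wabs) wy exprMn.
have [j ij] := qm_supp Mphi cn; have iQ := ltn_ord i.
case: j ij => [|j] ij.
  rewrite ij expn0 (qm_coef1 Mphi) !expr1 mulrCA ltr_pM2l//.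
  apply: (@le_lt_trans _ _ (tau * z)); first by rewrite ler_wpM2r ?(ltW z0)// le_max lexx orbT.
  apply: (@lt_le_trans _ _ (z * z)); first by rewrite ltr_pM2r.
  by rewrite -expr2 ler_weXn2l ?Q_gt1// ltW.
have i0 : (0 < i)%N by rewrite ij expn_gt0 (ltnW q1).
apply: (@le_lt_trans _ _ (a * (D ^+ i.-1 * z ^+ i))).
  have -> : a * (D ^+ i.-1 * z ^+ i) = expq q J ^+ i.-1 * (a ^+ i * z ^+ i).
    by rewrite /D expqD -/a exprMn -[in a ^+ i](prednK i0) exprS; ring.
  rewrite ler_wpM2r ?mulr_ge0 ?exprn_ge0 ?(ltW a0) ?(ltW z0)//.
  by rewrite ij coef_le.
rewrite ltr_pM2l// (@le_lt_trans _ _ (z ^+ i.-1 * z ^+ i))//.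
  by rewrite ler_wpM2r ?exprn_ge0 ?(ltW z0)// expr_le// ltW.
rewrite -exprD ltr_eXn2l// (@leq_trans (i + i))//; first by rewrite ltn_add2r ltn_predL.
have [e Qe'] := Qe; move: iQ; rewrite ij Qe' ltn_exp2l// => je.
apply: (@leq_trans (q ^ j.+2)); last by rewrite leq_exp2l.
by rewrite addnn -mul2n [in leqRHS]expnS leq_mul2r q1 orbT.
Qed.

(** Inside the radius log^+|x| is itself at most the bound and G >= 0. Outside, [far_step] iterates
    to the exact size a z^(Q^N) of phi_(T^N)(x), so G is at least log z. *)
Lemma local_green_ge x :
  logp q (w x) - g T x <= Num.max 0 c + (J + c) + logp q (w (iL T)).
Proof.
have Jc0 := hJc; have a0 : 0 < a by exact: expq_gt0.
have D0 : 0 < D by exact: expq_gt0.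
have g0 := local_green_ge0 x hT.
have m0 : 0 <= Num.max 0 c by rewrite le_max lexx.
have mc : c <= Num.max 0 c by rewrite le_max lexx orbT.
have t0 := logp_ge0 q (w (iL T)).
pose z := w x / a; have wx : w x = a * z by rewrite /z mulrC divfK// gt_eqF.
have [zD|zD] := leP z (D * tau).
  suff : logp q (w x) <= Num.max 0 c + (J + c) + logp q (w (iL T)) by lra.
  rewrite {1}/logp ge_max; apply/andP; split; first by lra.
  have [x0|x0] := eqVneq x 0.
    by rewrite x0 (abs0 wabs) /logq ln0// mul0r; lra.
  have : logq q (w x) <= logq q (a * (D * tau)).
    by apply: logq_le; [|exact: abs_gt0|rewrite wx ler_pM2l].
  by rewrite !logqM ?mulr_gt0// /a /D !expqK// -logp_tau; lra.
have z1 : 1 < z by rewrite (le_lt_trans _ zD)// mulr_ege1// expq_ge1.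
have z0 : 0 < z by exact: lt_trans z1.
have iter N : w (ev (T ^+ N) x) = a * z ^+ (Q T ^ N).
  elim: N => [|N ih]; first by rewrite expr0 ev1 expn0 expr1.
  rewrite exprS evM (far_step ih) ?expnSr ?exprM// (lt_le_trans zD)//.
  by apply: ler_eXnr; [rewrite expn_gt0 ltnW// Q_gt1|exact: ltW].
suff : logq q z <= g T x.
  rewrite {1}/logp wx logqM// /a expqK// => h.
  suff : Num.max 0 (c + logq q z) <= g T x + Num.max 0 c by lra.
  by rewrite ge_max; apply/andP; split; lra.
rewrite -subr_ge0; have cl : (fun N => u T x N - logq q z) @ \oo --> g T x - logq q z.
  by apply: cvgB; [exact: green_cvg|exact: cvg_cst].
apply: (ler_cvg_to (@cvg_pow T c hT) cl); apply: nearW => N.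
have QN0 : 0 < (Q T)%:R ^+ N :> R by rewrite exprn_gt0// (lt_trans _ (QR_gt1 hT)).
rewrite ler_pdivrMr// mulrBl /u mulrAC mulVf ?gt_eqF// mul1r lerBrDr.
have -> : c + logq q z * (Q T)%:R ^+ N = logq q (w (ev (T ^+ N) x)).
  by rewrite iter logqM ?exprn_gt0// logqX// /a expqK// natrX mulrC.
by rewrite /lp /logp le_max lexx orbT.
Qed.

End Bounds.
End Green.

(** The maximum is finite, as it is at least one real term and every term is below +oo; hence [fine]
    does not change it. *)
Lemma fine_bigmax_ge (R : realType) (m : nat) (n : 'I_m -> nat) (P : 'I_m -> pred nat)
    (f : 'I_m -> nat -> R) i0 j0 : (0 < j0 < n i0)%N -> P i0 j0 ->
  f i0 j0 <= fine (\big[maxe/-oo%E]_(i < m)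
    \big[maxe/-oo%E]_(1 <= j < n i | P i j) (f i j)%:E).
Proof.
move=> j0n Pj0; set B := \big[_/_]_(_ < _) _.
have Bge : ((f i0 j0)%:E <= B)%E.
  apply: (bigmax_sup i0) => //; apply: (@bigmax_sup_seq _ _ _ _ _ j0) => //.
  by rewrite mem_index_iota.
have Blt : (B < +oo)%E.
  by apply: bigmax_lt => // i _; apply: bigmax_lt => // j _; exact: ltry.
rewrite -lee_fin fineK// fin_numElt Blt andbT.
exact: lt_le_trans (ltNyr _) Bge.
Qed.

Section LocalHeight.
Variables (R : realType) (F : finFieldType) (A : idomainType) (r m : nat).
Variable T : 'I_m -> A.
Variables (L : fieldType) (iL : A -> L) (phi : A -> {poly L}) (w : L -> R).

Local Notation q := #|F|.
Let q1 : (1 < q)%N. Proof. exact: finRing_gt1. Qed.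

Hypothesis r0 : (0 < r)%N.
Hypothesis wabs : nontrivial_nonarch_abs w.
Hypothesis Mphi : q_module F r iL phi.

Definition nonconstant_norm (S : A) :=
  [/\ S != 0, (1 < norminf S)%N & exists e, norminf S = (q ^ e)%N].

Let degE S : nonconstant_norm S -> norminf S = (q ^ deginf q S)%N.
Proof. by move=> [_ _ [e eE]]; rewrite /deginf eE trunc_expnK. Qed.

Let powE S : nonconstant_norm S -> q%:R ^+ (r * deginf q S) = (norminf S ^ r)%:R :> R.
Proof. by move=> hS; rewrite (degE hS) -expnM -natrX mulnC. Qed.

Let QR_gt1 S : nonconstant_norm S -> 1 < (norminf S ^ r)%:R :> R.
Proof. by move=> [_ S1 _]; rewrite ltr1n -(exp1n r) ltn_exp2r. Qed.

Let lead_gt0 S : nonconstant_norm S -> 0 < w (lead_coef (phi S)).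
Proof. by move=> [S0 _ _]; rewrite abs_gt0// lead_coef_eq0 -size_poly_gt0 (qm_size Mphi). Qed.

Let size_gt1 S : nonconstant_norm S -> (1 < size (phi S))%N.
Proof.
by move=> [S0 S1 _]; rewrite (qm_size Mphi)// ltnS expn_gt0 (ltnW S1).
Qed.

(** phi_S and phi_S' commute; compare the leading coefficients of the two composites. *)
Lemma local_c_indep S S' : nonconstant_norm S -> nonconstant_norm S' ->
  local_c q r phi S w = local_c q r phi S' w.
Proof.
move=> hS hS'; have := lead_coef_comp (phi S) (size_gt1 hS').
have -> : phi S \Po phi S' = phi S' \Po phi S by rewrite -!(qm_comp Mphi) mulrC.
rewrite (lead_coef_comp _ (size_gt1 hS)) => /(congr1 (logq q \o w)) /=.
rewrite !(absM wabs) !(absX wabs) !logqM ?exprn_gt0 ?lead_gt0// !logqX ?lead_gt0//.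
case: (hS) (hS') => S0 _ _ [S'0 _ _]; rewrite !(qm_size Mphi)//= => e.
rewrite /local_c !powE//; congr (- _).
have h1 : (norminf S ^ r)%:R - 1 != 0 :> R by rewrite subr_eq0 gt_eqF// QR_gt1.
have h2 : (norminf S' ^ r)%:R - 1 != 0 :> R by rewrite subr_eq0 gt_eqF// QR_gt1.
apply/eqP; rewrite eqr_div// !mulrBr !mulr1; apply/eqP.
by rewrite ![_ * _%:R]mulrC; lra.
Qed.

Let J := local_j q r T phi w.

Lemma local_j_ge i j : nonconstant_norm (T i) -> (0 < j)%N -> (phi (T i))`_(q ^ j) != 0 ->
  logq q (w (phi (T i))`_(q ^ j)) <= ((q ^ j)%:R - 1) * J.
Proof.
move=> hT j0 cn; have qj : 0 < (q ^ j)%:R - 1 :> R.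
  by rewrite subr_gt0 ltr1n -(exp1n j) ltn_exp2r.
rewrite mulrC -ler_pdivrMr// natrX.
apply: (fine_bigmax_ge (fun i j => logq q (w (phi (T i))`_(q ^ j)) / (q%:R ^+ j - 1))) => //.
rewrite j0 ltnS /=; case: (hT) => T0 _ _.
have : (q ^ j < size (phi (T i)))%N.
  by rewrite ltnNge; apply: contra cn => h; rewrite nth_default.
by rewrite (qm_size Mphi)// ltnS (degE hT) -expnM leq_exp2l// mulnC.
Qed.

Lemma local_jc_ge0 i S : nonconstant_norm (T i) -> nonconstant_norm S ->
  0 <= J + local_c q r phi S w.
Proof.
move=> hT hS; rewrite (local_c_indep hS hT) /local_c powE// subr_ge0.
have Q1 := QR_gt1 hT; have d0 : (0 < r * deginf q (T i))%N.
  by rewrite lt0n; apply: contraTneq Q1 => d0; rewrite -powE// d0 expr0 ltxx.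
have qd : (q ^ (r * deginf q (T i)) = norminf (T i) ^ r)%N.
  by rewrite (degE hT) -expnM mulnC.
have leadE : (phi (T i))`_(q ^ (r * deginf q (T i))) = lead_coef (phi (T i)).
  by rewrite lead_coefE qd; case: (hT) => T0 _ _; rewrite (qm_size Mphi).
have := local_j_ge hT d0; rewrite leadE qd => h.
rewrite ler_pdivrMr ?subr_gt0// mulrC; apply: h.
by rewrite lead_coef_eq0 -size_poly_gt0 ltnW// size_gt1.
Qed.

Let nc S : nonconstant_norm S -> S != 0 /\ (1 < norminf S)%N. Proof. by case. Qed.

Lemma local_green_sub_bounds i S S' x : nonconstant_norm (T i) ->
    nonconstant_norm S -> nonconstant_norm S' ->
  - (Num.max 0 (local_c q r phi S w) + (J + local_c q r phi S w) + logp q (w (iL (T i))))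
    <= local_green q r phi S' w x - logp q (w x)
    <= J + Num.max 0 (local_c q r phi S w) + logp q (w (iL (T i))).
Proof.
move=> hT hS hS'; set c := local_c _ _ _ _ _; set t := logp _ (w (iL _)).
have Jc0 : 0 <= J + c by exact: local_jc_ge0 hT hS.
have hJ : forall j, (0 < j)%N -> (phi (T i))`_(q ^ j) != 0 ->
    logq q (w (phi (T i))`_(q ^ j)) <= ((q ^ j)%:R - 1) * J.
  by move=> j; exact: local_j_ge.
rewrite (local_green_indep r0 wabs Mphi x (nc hS') (nc hT)) lerNl opprB; apply/andP; split.
  apply: (local_green_ge r0 wabs Mphi (nc hT) hJ) => //.
  by rewrite /c (local_c_indep hS hT) /local_c powE.
have := local_green_le r0 wabs Mphi (nc hT) hJ x.
(* As J + c >= 0, the sum J + max(0, c) is nonnegative and at least J. This puts the upper bound in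
   the form that sums to h(phi). *)
have : Num.max 0 J <= J + Num.max 0 c.
  rewrite ge_max lerDl le_max lexx andbT; have : c <= Num.max 0 c by rewrite le_max lexx orbT.
  by lra.
by rewrite -/t; lra.
Qed.

End LocalHeight.

(** * Sums over places *)

Section FiniteSupportSums.
Variables (R : realType) (I : choiceType) (M B : set I) (wt : I -> R).
Hypothesis finB : finite_set B.
Hypothesis BM : B `<=` M.
Hypothesis wt0 : forall w, M w -> 0 <= wt w.

Let vanishing (f : I -> R) := forall w, M w -> ~ B w -> f w = 0.

Let restrict f : vanishing f ->
  \sum_(w \in M) wt w * f w = \sum_(w <- fset_set B) wt w * f w.
Proof.
move=> f0; rewrite -(fsbig_widen B M) ?fsbig_finite// => w [Mw nB] /=.
by rewrite f0 ?mulr0.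
Qed.

Lemma fsum_between (G H lo up : I -> R) :
  (forall w, M w -> - lo w <= G w - H w <= up w) ->
  vanishing H -> vanishing lo -> vanishing up ->
  - (\sum_(w \in M) wt w * lo w) <= \sum_(w \in M) wt w * G w - \sum_(w \in M) wt w * H w
    <= \sum_(w \in M) wt w * up w.
Proof.
(* Finite support of the Green functions comes for free: off [B] the bounds squeeze G between 0 and
   0. *)
move=> hb H0 lo0 up0; have G0 : vanishing G.
  move=> w Mw nB; have := hb w Mw; rewrite H0// lo0// up0// oppr0 addr0 => h.
  by apply/eqP; rewrite eq_le andbC.
rewrite !restrict// -sumrB; apply/andP; split; first rewrite -sumrN.
  rewrite big_seq [leRHS]big_seq; apply: ler_sum => w; rewrite in_fset_set// inE => /BM Mw.
  by rewrite -mulrBr -mulrN ler_wpM2l ?wt0//; have /andP[] := hb w Mw.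
rewrite big_seq [leRHS]big_seq; apply: ler_sum => w; rewrite in_fset_set// inE => /BM Mw.
by rewrite -mulrBr ler_wpM2l ?wt0//; have /andP[] := hb w Mw.
Qed.

Lemma height_sum (J c t : I -> R) : vanishing J -> vanishing c -> vanishing t ->
  \sum_(w \in M) wt w * c w = 0 ->
  let h := \sum_(w \in M) wt w * J w + \sum_(w \in M) wt w * Num.max 0 (c w) in
  \sum_(w \in M) wt w * (Num.max 0 (c w) + (J w + c w) + t w) =
    h + \sum_(w \in M) wt w * t w /\
  \sum_(w \in M) wt w * (J w + Num.max 0 (c w) + t w) = h + \sum_(w \in M) wt w * t w.
Proof.
move=> J0 c0 t0; have m0 : vanishing (fun w => Num.max 0 (c w)).
  by move=> w Mw nB; rewrite c0// maxxx.
have l0 : vanishing (fun w => Num.max 0 (c w) + (J w + c w) + t w).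
  by move=> w Mw nB; rewrite m0// J0// c0// t0// !addr0.
have u0 : vanishing (fun w => J w + Num.max 0 (c w) + t w).
  by move=> w Mw nB; rewrite m0// J0// t0// !addr0.
rewrite !restrict// => sc h; rewrite {}/h; split; rewrite -!big_split /=; last first.
  by apply: eq_bigr => w _; ring.
rewrite -[RHS]addr0 -[X in _ + X]sc -big_split /=; apply: eq_bigr => w _; ring.
Qed.

End FiniteSupportSums.

Section WeightedPlaces.
Variables (R : realType) (G : fieldType) (E : fieldExtType G) (M : set (G -> R)).
Hypothesis Mabs : forall v, M v -> nontrivial_nonarch_abs v.

Local Notation W := (places_above (E := E) M).

Lemma weight_ge0 (w : E -> R) : 0 <= weight w.
Proof. by rewrite /weight divr_ge0. Qed.

Let dim0 : 0 < (\dim {:E})%:R :> R. Proof. by rewrite ltr0n adim_gt0. Qed.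

(** Every place above v has local degree at least 1, and the local degrees above v add up to at most
    [E : G]. *)
Lemma finite_places_above (V : set (G -> R)) : finite_set V -> V `<=` M ->
  finite_set [set w | W w /\ V (below w)].
Proof.
move=> fV VM; have -> : [set w | W w /\ V (below w)] = \bigcup_(v in V) [set w | W w /\ below w = v].
  apply/seteqP; split=> [w [Ww Vw]|w [v Vv [Ww wv]]]; first by exists (below w).
  by split=> //; rewrite wv.
apply: bigcup_finite => // v Vv; apply: (@finite_set_of_bounded _ _ (\dim {:E})) => I f finj hf.
apply: leq_trans (sum_local_degree_le (n := fun i => local_degree (f i)) (Mabs (VM _ Vv)) _ _ finj _).
- by rewrite -sum1_card leq_sum// => i _; apply: local_degree_gt0 (hf i).1.
- by move=> i; exact: (hf i).1.1.
- by move=> i; exact: (hf i).2.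
- by move=> i; apply: local_degreeP (hf i).1.
Qed.

(** Summing first over the places above a fixed v, the weights add up to at most 1; nonnegativity of
    [B] then gives the inequality. *)
Lemma weighted_sum_le (B : (G -> R) -> R) : (forall v, M v -> 0 <= B v) ->
  finite_set [set v | M v /\ B v != 0] ->
  \sum_(w \in W) weight w * B (below w) <= \sum_(v \in M) B v.
Proof.
move=> B0 fB; set V := [set v | _ /\ _] in fB.
have VM : V `<=` M by move=> v [].
have fW := finite_places_above fB VM; set WV := [set w | _ /\ _] in fW.
have -> : \sum_(v \in M) B v = \sum_(v <- fset_set V) B v.
  rewrite -(fsbig_widen V M) ?fsbig_finite// => v [Mv nV] /=.
  by apply: contrapT => /eqP Bv; apply: nV.
have -> : \sum_(w \in W) weight w * B (below w) =
    \sum_(w <- fset_set WV) weight w * B (below w).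
  rewrite -(fsbig_widen WV W) ?fsbig_finite// => [w []//|w [Ww nV] /=].
  rewrite (_ : B (below w) = 0) ?mulr0//; apply: contrapT => /eqP Bv; apply: nV.
  by split=> //; split=> //; exact: Ww.2.
have wV w : w \in fset_set WV -> below w \in fset_set V.
  by rewrite !in_fset_set// !inE => -[].
rewrite big_seq.
have -> : \sum_(w <- fset_set WV | w \in fset_set WV) weight w * B (below w) =
    \sum_(w <- fset_set WV | w \in fset_set WV) \sum_(v <- fset_set V)
      (if below w == v then weight w * B v else 0).
  apply: eq_bigr => w /wV wv; rewrite -big_mkcond/= (big_rem _ wv)/= eqxx.
  rewrite big1_seq ?addr0// => v /andP[/eqP <-].
  by rewrite mem_rem_uniqF ?fset_uniq.
rewrite -big_seq exchange_big /= big_seq [leRHS]big_seq; apply: ler_sum => v vV.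
have Mv : M v by move: vV; rewrite in_fset_set// inE => -[].
rewrite -big_mkcond/= -mulr_suml ler_piMl ?B0// /weight -mulr_suml ler_pdivrMr// mul1r.
rewrite -natr_sum ler_nat.
pose A := [fset w in fset_set WV | below w == v]%fset.
have AP (w : A) : W (val w) /\ below (val w) = v.
  have := valP w; rewrite !inE /= in_fset_set// => /andP[].
  by rewrite inE => -[Ww _] /eqP.
apply: leq_trans (sum_local_degree_le (w := fun w : A => val w)
  (n := fun w : A => local_degree (val w)) (Mabs Mv) _ _ val_inj _).
- rewrite -(big_seq_fsetE _ A predT (fun w => local_degree w)) /= -big_filter.
  rewrite leq_eqVlt; apply/orP; left; apply/eqP; apply: perm_big.
  apply: uniq_perm; rewrite ?filter_uniq ?fset_uniq// => w.
  by rewrite mem_filter !inE andbC.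
- by move=> w; exact: (AP w).1.1.
- by move=> w; exact: (AP w).2.
- by move=> w; apply: local_degreeP (AP w).1.
Qed.

End WeightedPlaces.

Definition trivial_on (R : realType) (L : fieldType) (Y : seq L) (v : L -> R) : Prop :=
  forall y, y \in Y -> y != 0 -> v y = 1.

Lemma finite_nontrivial_on (R : realType) (L : fieldType) (M : set (L -> R)) (Y : seq L) :
  (forall y : L, y != 0 -> finite_set [set v | M v /\ v y != 1]) ->
  finite_set [set v | M v /\ ~ trivial_on Y v].
Proof.
move=> hM; elim: Y => [|y Y ih].
  by rewrite (_ : mkset _ = set0)//; apply/seteqP; split=> // v [_]; case.
apply: (@sub_finite_set _ _ ([set v | M v /\ ~ trivial_on Y v] `|`
    [set v | [/\ M v, y != 0 & v y != 1]])).
  move=> v [Mv nt]; have [tY|tY] := pselect (trivial_on Y v); last by left.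
  right; split=> //; [apply/eqP|apply/eqP] => h; apply: nt => z; rewrite inE => /orP[/eqP->|];
    [by rewrite h eqxx|exact: tY|by []|exact: tY].
rewrite finite_setU; split=> //; have [y0|y0] := eqVneq y 0.
  by rewrite (_ : mkset _ = set0)//; apply/seteqP; split=> // v [].
by apply: sub_finite_set (hM y y0) => v [].
Qed.

Section LocalTerms.
Variables (R : realType) (q r m : nat) (A : idomainType) (T : 'I_m -> A).

Lemma logp_trivial (L : fieldType) (w : L -> R) y : nontrivial_nonarch_abs w ->
  (y != 0 -> w y = 1) -> logp q (w y) = 0.
Proof.
move=> wabs wy; have [->|/wy ->] := eqVneq y 0; rewrite /logp ?(abs0 wabs) ?logq1 ?maxxx//.
by rewrite /logq ln0// mul0r maxxx.
Qed.

Definition height_data (L : fieldType) (phi : A -> {poly L}) (S : A) : seq L :=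
  lead_coef (phi S) :: flatten [seq polyseq (phi (T i)) | i <- enum 'I_m].

Lemma local_c_trivial (L : fieldType) (phi : A -> {poly L}) S (w : L -> R) :
  phi S != 0 -> trivial_on (height_data phi S) w -> local_c q r phi S w = 0.
Proof.
move=> pS h; rewrite /local_c h ?mem_head ?lead_coef_eq0//.
by rewrite logq1 mul0r oppr0.
Qed.

Lemma local_j_trivial (L : fieldType) (phi : A -> {poly L}) S (w : L -> R) :
  trivial_on (height_data phi S) w -> local_j q r T phi w = 0.
Proof.
(* Every coefficient that occurs is a unit, so the maximum is 0, or -oo if nothing occurs; [fine]
   sends both to 0. *)
move=> h; pose P (e : \bar R) := e = 0%E \/ e = -oo%E.
have PM (e1 e2 : \bar R) : P e1 -> P e2 -> P (maxe e1 e2).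
  by move=> [->|->] [->|->]; rewrite /P ?maxxx ?maxeNy ?maxNye; [left|left|left|right].
suff [] : P (\big[maxe/-oo%E]_(i < m)
    \big[maxe/-oo%E]_(1 <= j < (r * deginf q (T i)).+1 | (phi (T i))`_(q ^ j) != 0)
       (logq q (w (phi (T i))`_(q ^ j)) / (q%:R ^+ j - 1))%:E).
- by rewrite /local_j => ->.
- by rewrite /local_j => ->.
elim/big_ind: _ => [|//|i _]; first by right.
elim/big_ind: _ => [|//|j cn]; first by right.
left; rewrite h// ?logq1 ?mul0r// inE; apply/orP; right; apply/flattenP.
exists (polyseq (phi (T i))); first by apply: map_f; rewrite mem_enum.
by apply: mem_nth; rewrite ltnNge; apply: contra cn => hs; rewrite nth_default.
Qed.

Lemma local_c_base_change (L L' : fieldType) (f : {rmorphism L -> L'})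
    (phi : A -> {poly L}) S (w : L' -> R) :
  local_c q r (base_change f phi) S w = local_c q r phi S (w \o f).
Proof. by rewrite /local_c lead_coef_map. Qed.

Lemma local_j_base_change (L L' : fieldType) (f : {rmorphism L -> L'})
    (phi : A -> {poly L}) (w : L' -> R) :
  local_j q r T (base_change f phi) w = local_j q r T phi (w \o f).
Proof.
rewrite /local_j; congr fine; apply: eq_bigr => i _.
by apply: eq_big => j; rewrite coef_map ?fmorph_eq0.
Qed.

Lemma sum_local_c (L : fieldType) (M : set (L -> R)) (wt : (L -> R) -> R)
    (phi : A -> {poly L}) (S : A) :
  \sum_(w \in M) wt w * logq q (w (lead_coef (phi S))) = 0 ->
  \sum_(w \in M) wt w * local_c q r phi S w = 0.
Proof.
move=> s0; transitivity (- (q%:R ^+ (r * deginf q S) - 1)^-1 *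
    \sum_(w \in M) wt w * logq q (w (lead_coef (phi S)))); last by rewrite s0 mulr0.
rewrite mulr_fsumr; apply: eq_fsbigr => w _.
by rewrite /local_c; ring.
Qed.

End LocalTerms.

(** * The global inequality, over L and relative to K *)

Section HeightDifference.
Variables (R : realType) (F : finFieldType) (K : fieldType) (cK : {rmorphism F -> K}).
Variables (A : idomainType) (iA : {rmorphism A -> K}) (m : nat) (T : 'I_m -> A) (r : nat).
Hypothesis iA_inj : injective iA.
Hypothesis hF : forall a, range iA (cK a).
Hypothesis hK : forall x, algebraicOver cK x -> range cK x.
Hypothesis HTnc : forall i, ~ constant_element cK iA (T i).
Hypothesis r0 : (0 < r)%N.
Variable i0 : 'I_m.

Local Notation q := #|F|.
Let q1 : (1 < q)%N. Proof. exact: finRing_gt1. Qed.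

Lemma drinfeld_nonconstant_norm (L : fieldType) (iL : {rmorphism A -> L})
    (phi : A -> {poly L}) S : injective iL -> drinfeld_module q iL phi ->
  drinfeld_rank phi r -> ~ constant_element cK iA S -> nonconstant_norm F S.
Proof.
move=> iL_inj Dphi Rphi hS; have [S0 S1] := norminf_gt1 hK r0 iL_inj Dphi Rphi hS.
by split=> //; apply: (norminf_pow iA_inj hF) => //; exact: ltnW.
Qed.

Section Extension.
Variables (G : fieldType) (M : set (G -> R)) (E : fieldExtType G).
Hypothesis Mabs : forall v, M v -> nontrivial_nonarch_abs v.

Local Notation W := (places_above (E := E) M).

Section GroundField.
Variables (iG : {rmorphism A -> G}) (phi : A -> {poly G}).
Hypothesis iG_inj : injective iG.
Hypothesis Dphi : drinfeld_module q iG phi.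
Hypothesis Rphi : drinfeld_rank phi r.
Hypothesis HPF : product_formula q M.

Lemma ground_field_bound S S' (x : E) :
  ~ constant_element cK iA S -> ~ constant_element cK iA S' ->
  let hphi := drinfeld_height q r T M (fun=> 1) phi S in
  let d := canonical_height q M r (base_change (in_alg E) phi) S' x - weil_height q M x in
  let C := \sum_(v \in M) logp q (v (iG (T i0))) in
  [/\ 0 <= hphi, - (hphi + C) <= d & d <= hphi + C].
Proof.
move=> hS hS' hphi d C.
have ncS X := drinfeld_nonconstant_norm iG_inj Dphi Rphi (S := X).
have Mphi := drinfeld_q_module iA_inj hF r0 iG_inj Dphi Rphi.
have ME := q_module_base_change (in_alg E) Mphi.
(* Listing the coefficients of the minimal polynomial in [Y] makes [x] integral above every place
   outside [V], so log^+|x| vanishes there. *)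
have [p [pm px pa]] := integral_over_base x; have [a aE] := choice pa.
pose Y := (iG (T i0) :: height_data T phi S) ++ [seq a i | i <- iota 0 (size p)].
have fV : finite_set [set v | M v /\ ~ trivial_on Y v].
  by apply: finite_nontrivial_on => y y0; exact: (HPF y0).1.
set V := [set v | _ /\ _] in fV; have VM : V `<=` M by move=> v [].
have trivV v : M v -> ~ V v -> trivial_on Y v.
  by move=> Mv nV; apply: contrapT => nt; apply: nV.
have subY (v : G -> R) : trivial_on Y v -> trivial_on (height_data T phi S) v.
  by move=> h y yY; apply: h; rewrite mem_cat inE yY orbT.
pose J (v : G -> R) := local_j q r T phi v; pose c (v : G -> R) := local_c q r phi S v.
pose t (v : G -> R) := logp q (v (iG (T i0))).
have phiS : phi S != 0 by rewrite -size_poly_gt0 (qm_size Mphi)//; have [] := ncS S hS.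
have J0 v : M v -> ~ V v -> J v = 0.
  by move=> Mv nV; apply: local_j_trivial; apply: subY; exact: trivV.
have c0 v : M v -> ~ V v -> c v = 0.
  by move=> Mv nV; apply: local_c_trivial => //; apply: subY; exact: trivV.
have t0 v : M v -> ~ V v -> t v = 0.
  move=> Mv nV; rewrite /t (logp_trivial _ (Mabs Mv))// => y0; apply: trivV => //.
  by rewrite mem_head.
have sc : \sum_(v \in M) 1 * c v = 0.
  apply: (@sum_local_c R q r A G M (fun=> 1)) => //.
  have lead0 : lead_coef (phi S) != 0 by rewrite lead_coef_eq0.
  rewrite -[RHS](HPF lead0).2.
  by apply: eq_fsbigr => v _; rewrite mul1r.
have [lowE upE] := height_sum fV VM J0 c0 t0 sc.
have hphiE : hphi = \sum_(v \in M) 1 * J v + \sum_(v \in M) 1 * Num.max 0 (c v) by [].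
have CE : C = \sum_(v \in M) 1 * t v by apply: eq_fsbigr => v _; rewrite mul1r.
rewrite -hphiE -CE in lowE upE.
have Jc v : M v -> 0 <= J v + c v.
  move=> Mv; exact: (local_jc_ge0 r0 (Mabs Mv) Mphi (ncS _ (HTnc (i := i0))) (ncS _ hS)).
have m0 v : 0 <= Num.max 0 (c v) by rewrite le_max lexx.
have mc v : c v <= Num.max 0 (c v) by rewrite le_max lexx orbT.
have tp v : 0 <= t v by exact: logp_ge0.
pose lo v := Num.max 0 (c v) + (J v + c v) + t v; pose up v := J v + Num.max 0 (c v) + t v.
have lo0 v : M v -> 0 <= lo v by move=> Mv; have := Jc v Mv; have := m0 v; have := tp v; rewrite /lo; lra.
have up0 v : M v -> 0 <= up v by move=> Mv; have := Jc v Mv; have := mc v; have := tp v; rewrite /up; lra.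
have hphi0 : 0 <= hphi.
  (* With t replaced by 0, [height_sum] writes h(phi) as the sum of the nonnegative terms J + max(0,
     c). *)
  have z0 v : M v -> ~ V v -> (fun _ : G -> R => 0 : R) v = 0 by [].
  have [_] := height_sum fV VM J0 c0 z0 sc.
  rewrite -hphiE [X in _ + X]fsbig1 ?addr0 => [<-|v _]; last by rewrite mulr0.
  apply: fsumr_ge0 => v Mv; rewrite addr0 mul1r.
  by have := Jc v Mv; have := mc v; lra.
have fW := finite_places_above E Mabs fV VM; set WV := [set w | _ /\ _] in fW.
have WVW : WV `<=` W by move=> w [].
have off f : (forall v, M v -> ~ V v -> f v = 0) ->
    forall w, W w -> ~ WV w -> f (below w) = 0 :> R.
  by move=> f0 w Ww nW; apply: f0; [exact: Ww.2|move=> Vw; apply: nW].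
have loV v : M v -> ~ V v -> lo v = 0.
  by move=> Mv nV; rewrite /lo c0// J0// t0// maxxx !addr0.
have upV v : M v -> ~ V v -> up v = 0.
  by move=> Mv nV; rewrite /up c0// J0// t0// maxxx !addr0.
have H0 w : W w -> ~ WV w -> logp q (w x) = 0.
  move=> Ww nW; have Mw := Ww.2; have wabs := Ww.1.
  have tY : trivial_on Y (below w) by apply: trivV => // Vw; exact: nW.
  suff x1 : w x <= 1 by rewrite logpE ?(abs_ge0 wabs)// max_l// logq1.
  apply: (abs_root_le1 wabs pm _ px) => i; have [ip|ip] := ltnP i (size p); last first.
    by rewrite nth_default// (abs0 wabs) ler01.
  rewrite aE; have [->|ai] := eqVneq (a i) 0; first by rewrite rmorph0 (abs0 wabs) ler01.
  rewrite -[w _]/(below w (a i)) tY// mem_cat; apply/orP; right; apply: map_f.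
  by rewrite mem_iota.
have bounds w : W w -> - lo (below w) <=
    local_green q r (base_change (in_alg E) phi) S' w x - logp q (w x) <= up (below w).
  move=> Ww; have := local_green_sub_bounds r0 Ww.1 ME x (ncS _ (HTnc (i := i0))) (ncS _ hS) (ncS _ hS').
  by rewrite local_j_base_change local_c_base_change.
have := fsum_between fW WVW (fun w _ => weight_ge0 w) bounds H0 (off _ loV) (off _ upV).
have fin f : (forall v, M v -> ~ V v -> f v = 0 :> R) -> finite_set [set v | M v /\ f v != 0].
  move=> f0; apply: sub_finite_set fV => v [Mv /eqP fv]; apply: contrapT => nV.
  by apply: fv; exact: f0.
have := weighted_sum_le E Mabs lo0 (fin _ loV).
have := weighted_sum_le E Mabs up0 (fin _ upV).
have -> : \sum_(v \in M) lo v = hphi + C.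
  by rewrite -lowE; apply: eq_fsbigr => v _; rewrite mul1r.
have -> : \sum_(v \in M) up v = hphi + C.
  by rewrite -upE; apply: eq_fsbigr => v _; rewrite mul1r.
rewrite -/(canonical_height _ _ _ _ _ _) -/(weil_height _ _ _) -/d => h1 h2 /andP[h3 h4].
by split=> //; [apply: le_trans h3; rewrite lerN2|apply: le_trans h4 h1].
Qed.

End GroundField.

End Extension.
Section RelativeToK.
Hypothesis HK : curve_function_field cK.
Variables (L E : fieldExtType K) (iota : 'AHom(L, E)) (phi : A -> {poly L}).
Hypothesis Dphi : drinfeld_module q (in_alg L \o iA) phi.
Hypothesis Rphi : drinfeld_rank phi r.

Local Notation MK := (@curve_places R K).
Local Notation W := (places_above (E := E) MK).

(** [K] is regarded as the trivial extension of itself. *)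
Lemma finite_support_curve_places (y : K) : y != 0 ->
  finite_set [set v | MK v /\ v y != 1].
Proof.
move=> y0; apply: sub_finite_set (finite_support R HK (E := K^o) y0) => v [Mv vy].
have bE : below (E := K^o) v = v.
  by apply/funext => a; rewrite /below in_algE; congr v; exact: mulr1.
split=> //; split; [case: (curve_place_abs Mv); split=> //|by rewrite bE].
Qed.

Lemma relative_bound S S' (x : E) :
  ~ constant_element cK iA S -> ~ constant_element cK iA S' ->
  let phi' := base_change iota phi in
  let hphi := drinfeld_height q r T W (@weight R K E) phi' S in
  let d := canonical_height q MK r phi' S' x - weil_height q MK x in
  let C := \sum_(v \in MK) logp q (v (iA (T i0))) in
  [/\ 0 <= hphi, - (hphi + C) <= d & d <= hphi + C].
Proof.
move=> hS hS' phi' hphi d C.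
have iL_inj : injective (in_alg L \o iA).
  by move=> a b h; apply: iA_inj; apply: (fmorph_inj (in_alg L)).
have ncS X := drinfeld_nonconstant_norm iL_inj Dphi Rphi (S := X).
have Mphi := drinfeld_q_module iA_inj hF r0 iL_inj Dphi Rphi.
have ME := q_module_base_change iota Mphi; rewrite -/phi' in ME.
have Mabs v : MK v -> nontrivial_nonarch_abs v by exact: curve_place_abs.
have iE a : iota (in_alg L a) = in_alg E a by rewrite !in_algE rmorph_alg.
(* Nonzero elements of [E] are already known to be units at almost all places of [E], so [x] itself
   is listed instead of its minimal polynomial. *)
pose Y := [:: x, in_alg E (iA (T i0)) & height_data T phi' S].
have fV : finite_set [set w | W w /\ ~ trivial_on Y w].
  by apply: finite_nontrivial_on => y y0; exact: (finite_support R HK).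
set V := [set v | _ /\ _] in fV; have VW : V `<=` W by move=> v [].
have trivV w : W w -> ~ V w -> trivial_on Y w.
  by move=> Ww nV; apply: contrapT => nt; apply: nV.
have subY (w : E -> R) : trivial_on Y w -> trivial_on (height_data T phi' S) w.
  by move=> h y yY; apply: h; rewrite 2!in_cons yY !orbT.
pose J (w : E -> R) := local_j q r T phi' w; pose c (w : E -> R) := local_c q r phi' S w.
pose t (w : E -> R) := logp q (below w (iA (T i0))).
have phiS : phi' S != 0 by rewrite -size_poly_gt0 (qm_size ME)//; have [] := ncS S hS.
have J0 w : W w -> ~ V w -> J w = 0.
  by move=> Ww nV; apply: local_j_trivial; apply: subY; exact: trivV.
have c0 w : W w -> ~ V w -> c w = 0.
  by move=> Ww nV; apply: local_c_trivial => //; apply: subY; exact: trivV.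
have t0 w : W w -> ~ V w -> t w = 0.
  move=> Ww nV; rewrite /t (logp_trivial _ Ww.1)// => y0; apply: trivV => //.
  by rewrite !inE eqxx orbT.
have H0 w : W w -> ~ V w -> logp q (w x) = 0.
  move=> Ww nV; rewrite (logp_trivial _ Ww.1)// => y0; apply: trivV => //.
  by rewrite !inE eqxx.
have sc : \sum_(w \in W) weight w * c w = 0.
  apply: sum_local_c; have lead0 : lead_coef (phi' S) != 0 by rewrite lead_coef_eq0.
  transitivity (((\dim {:E})%:R * ln q%:R)^-1 *
    \sum_(w \in W) (local_degree w)%:R * ln (w (lead_coef (phi' S)))).
    rewrite mulr_fsumr; apply: eq_fsbigr => w _; rewrite /weight /logq invfM; ring.
  by rewrite (above_product_formula R HK lead0) mulr0.
have wt0 (w : E -> R) : W w -> 0 <= weight w by move=> _; exact: weight_ge0.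
have [lowE upE] := height_sum fV VW J0 c0 t0 sc.
have hphiE : hphi = \sum_(w \in W) weight w * J w +
  \sum_(w \in W) weight w * Num.max 0 (c w) by [].
rewrite -hphiE in lowE upE.
have Jc w : W w -> 0 <= J w + c w.
  by move=> Ww; exact: (local_jc_ge0 r0 Ww.1 ME (ncS _ (HTnc (i := i0))) (ncS _ hS)).
have hphi0 : 0 <= hphi.
  have z0 w : W w -> ~ V w -> (fun _ : E -> R => 0 : R) w = 0 by [].
  have [_] := height_sum fV VW J0 c0 z0 sc.
  rewrite -hphiE [X in _ + X]fsbig1 ?addr0 => [<-|w _]; last by rewrite mulr0.
  apply: fsumr_ge0 => w Ww; rewrite addr0 mulr_ge0 ?wt0//.
  have := Jc w Ww; have : c w <= Num.max 0 (c w) by rewrite le_max lexx orbT.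
  by lra.
have bounds w : W w -> - (Num.max 0 (c w) + (J w + c w) + t w) <=
    local_green q r phi' S' w x - logp q (w x) <= J w + Num.max 0 (c w) + t w.
  move=> Ww; have := local_green_sub_bounds r0 Ww.1 ME x (ncS _ (HTnc (i := i0))) (ncS _ hS) (ncS _ hS').
  by rewrite [(_ \o _) (T i0)]iE.
have lo0 w : W w -> ~ V w -> Num.max 0 (c w) + (J w + c w) + t w = 0.
  by move=> Ww nV; rewrite c0// J0// t0// maxxx !addr0.
have up0 w : W w -> ~ V w -> J w + Num.max 0 (c w) + t w = 0.
  by move=> Ww nV; rewrite c0// J0// t0// maxxx !addr0.
have := fsum_between fV VW wt0 bounds H0 lo0 up0.
rewrite lowE upE -/(canonical_height _ _ _ _ _ _) -/(weil_height _ _ _) -/d.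
(* The only term that depends just on the place of [K] below; its sum is bounded by a sum over [MK],
   whatever L and E are. *)
have : \sum_(w \in W) weight w * t w <= C.
  apply: (weighted_sum_le E Mabs (B := fun v => logp q (v (iA (T i0))))).
    by move=> v _; exact: logp_ge0.
  have T0 : iA (T i0) != 0.
    by rewrite -(rmorph0 iA) (inj_eq iA_inj); have [] := ncS _ (HTnc (i := i0)).
  apply: sub_finite_set (finite_support_curve_places T0) => v [Mv vT]; split=> //.
  by apply: contra vT => /eqP vT; rewrite /logp vT logq1 maxxx.
move=> hC /andP[h1 h2]; split=> //; last by apply: le_trans h2 _; rewrite lerD2l.
by apply: le_trans h1; rewrite lerN2 lerD2l.
Qed.

End RelativeToK.
End HeightDifference.

Theorem theorem1p6 (R : realType) (F : finFieldType) (K : fieldType)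
    (cK : {rmorphism F -> K}) (vinf : K -> R)
    (A : idomainType) (iA : {rmorphism A -> K})
    (m : nat) (T : 'I_m -> A) (r : nat)
    (HK : curve_function_field cK)
    (Hinf : rational_point cK vinf)
    (iA_inj : injective iA)
    (HA : range iA = regular_away_from vinf)
    (HT : algebra_generators cK iA T)
    (HTnc : forall i, ~ constant_element cK iA (T i))
    (Hr : (1 <= r)%N) :
  let q := #|F| in
  (forall (L : fieldType) (ML : set (L -> R)) (iL : {rmorphism A -> L}),
    global_function_field q ML -> injective iL ->
    exists C1 C2 : R,
      forall phi : A -> {poly L},
      drinfeld_module q iL phi -> drinfeld_rank phi r ->
      forall L' : fieldExtType L, separable 1%VS {:L'} ->
      forall (x : L') (S S' : A),
      ~ constant_element cK iA S -> ~ constant_element cK iA S' ->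
      let hphi := drinfeld_height q r T ML (fun=> 1) phi S in
      let hhat := canonical_height q ML r (base_change (in_alg L') phi) S' x in
      let h := weil_height q ML x in
      - C1 - (1 - q%:R ^- r)^-1 * hphi <= hhat - h /\
      hhat - h <= hphi + C2) /\
  (exists C1 C2 : R,
    forall (L : fieldExtType K) (phi : A -> {poly L}),
    drinfeld_module q (in_alg L \o iA) phi -> drinfeld_rank phi r ->
    forall (L' : fieldExtType K) (iota : 'AHom(L, L')) (x : L'),
    separable_element (limg iota) x ->
    forall S S' : A,
    ~ constant_element cK iA S -> ~ constant_element cK iA S' ->
    let MK := @curve_places R K in
    let phi' := base_change iota phi in
    let hphi := drinfeld_height q r T (places_above MK) (@weight R K L') phi' S in
    let hhat := canonical_height q MK r phi' S' x in
    let h := weil_height q MK x in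
    - C1 - (1 - q%:R ^- r)^-1 * hphi <= hhat - h /\
    hhat - h <= hphi + C2).
Proof.
move=> q; have hF a : range iA (cK a).
  by rewrite HA => v Mv _; exact: (abs_const_le cK a (curve_place_abs Mv)).
have hK := HK.2; have q1 : (1 < q)%N by exact: finRing_gt1.
have kappa (h : R) : 0 <= h -> h <= (1 - q%:R ^- r)^-1 * h.
  move=> h0; have qr : 1 < q%:R ^+ r :> R by rewrite exprn_egt1 ?ltr1n// -lt0n.
  have qr0 : 0 < q%:R ^+ r :> R by exact: lt_trans qr.
  have k0 : 0 < 1 - q%:R ^- r :> R by rewrite subr_gt0 invf_lt1.
  by rewrite ler_peMl// invf_ge1// gerBl invr_ge0 ltW.
have conclude (h d C : R) : [/\ 0 <= h, - (h + C) <= d & d <= h + C] ->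
    - C - (1 - q%:R ^- r)^-1 * h <= d /\ d <= h + C.
  by move=> [h0 lo up]; split=> //; have := kappa h h0; lra.
(* Without generators every element of [A] is constant, so there is no admissible [S]. *)
have [m0|m0] := posnP m.
  have allc a : constant_element cK iA a.
    suff -> : constant_element cK iA = [set: A] by [].
    apply: HT => //.
    - by move=> i; have := leq_ltn_trans (leq0n i) (ltn_ord i); rewrite m0.
    - by move=> b1 b2 [x _ xE] [y _ yE]; exists (x + y); rewrite // !rmorphD xE yE.
    - by move=> b1 b2 [x _ xE] [y _ yE]; exists (x * y); rewrite // !rmorphM xE yE.
  split=> [L ML iL _ _|]; exists 0, 0; first by move=> ? ? ? ? ? ? S ? /(_ (allc S)).
  by move=> ? ? ? ? ? ? ? ? S ? /(_ (allc S)).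
pose i0 := Ordinal m0; split=> [L ML iL [Mabs HPF] iL_inj|].
  exists (\sum_(v \in ML) logp q (v (iL (T i0)))), (\sum_(v \in ML) logp q (v (iL (T i0)))).
  move=> phi Dphi Rphi L' _ x S S' hS hS' hphi hhat h; apply: conclude.
  exact: (ground_field_bound iA_inj hF hK HTnc Hr i0 Mabs iL_inj Dphi Rphi HPF x hS hS').
exists (\sum_(v \in @curve_places R K) logp q (v (iA (T i0)))),
  (\sum_(v \in @curve_places R K) logp q (v (iA (T i0)))).
move=> L phi Dphi Rphi L' iota x _ S S' hS hS' MK phi' hphi hhat h; apply: conclude.
exact: (relative_bound R iA_inj hF hK HTnc Hr i0 HK iota Dphi Rphi x hS hS').
Qed.
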